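(* Let $M$ be a closed Riemannian manifold, $f:M\to\mathbb R$ a Morse-Smale function, $\Gamma$ an object of $\mathcal C_{b,p+q}$, $N\subset\mathcal M_\Gamma$ a submanifold, and $\vec a=\{a_v\}$ a collection of critical points of $f$ labeled by the univalent vertices of $\Gamma$. When $N$ is compact, the space of piecewise graph flows $\overline{\mathcal M}{}^N_\Gamma(M;\vec a)$ is compact.
   Context: Graphs. $\mathcal C_{b,p+q}$ is the category whose objects are finite connected graphs (subspaces of $\mathbb R^\infty$) of first Betti number $b$ with oriented edges, $p$ incoming leaves (univalent vertices on edges oriented away from them), $q$ outgoing leaves (on edges oriented toward them), and a non-univalent basepoint. Morphisms are cellular maps preserving edge orientations and basepoints, for which inverse images of vertices are trees and inverse images of open edges are open edges. $Aut(\Gamma)$ denotes here the group of automorphisms of $\Gamma$ fixing every leaf. $\mathcal C_\Gamma$ is the category of objects $\Gamma_0\to\Gamma$ over $\Gamma$. $\mathcal S_\Gamma$ is the homotopy colimit over $\mathcal C_\Gamma$ of the functor sending $\Gamma_0\to\Gamma$ to the space of labelings of the edges of $\Gamma_0$ by distinct functions in $C^\infty(M)$. A point $(\Gamma_k,\vec f)\in\mathcal S_\Gamma$ is given by $\vec t\in\Delta^k$, a chain $\Gamma_k\to\cdots\to\Gamma_0\to\Gamma$ and labels $f_E$ of the edges of $\Gamma_k$; edge $E$ has length $\sum_it_i\lambda_i(E)$, $\lambda_i(E)=0$ if $E$ is collapsed in $\Gamma_i$ and $1$ otherwise. $\mathcal M_\Gamma=\mathcal S_\Gamma/Aut(\Gamma)$.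 Graph flows. Let $\tilde\Gamma_k$ be obtained from $\Gamma_k$ by attaching at each leaf $v$ a half-line $E_v$, parametrized by $(-\infty,0]$ if $v$ is incoming and $[0,\infty)$ if outgoing. $\mathcal M_\Gamma(M;\vec a)$ is the quotient by $Aut(\Gamma)$ of the space of $(\Gamma_k,\vec f,\gamma)$ with $\gamma:\tilde\Gamma_k\to M$ continuous, $\dot\gamma_E+\nabla f_E(\gamma_E)=0$ on edges of $\Gamma_k$, $\dot\gamma_{E_v}+\nabla f(\gamma_{E_v})=0$ on half-lines, and $\gamma_{E_v}\to a_v$ at infinity. $\mathcal M_\Gamma^N(M;\vec a)$ is the part lying over $N$ under the projection to $\mathcal M_\Gamma$. Piecewise flows. For critical points $a,b$, $\mathcal M(a,b)$ is the space of gradient flow lines $\dot\gamma+\nabla f(\gamma)=0$ from $a$ to $b$ modulo translation; $a\ge b$ if such a flow exists. $\overline{\mathcal M}(a,b)=\bigcup_{a=a_0\ge a_1\ge\cdots\ge a_j=b}\mathcal M(a,a_1)\times\cdots\times\mathcal M(a_{j-1},b)$ (a single point if $a=b$). Then $$\overline{\mathcal M}{}^N_\Gamma(M;\vec a)=\bigcup_{\vec b}\mathcal M^N_\Gamma(M;\vec b)\times\prod_{v\ \mathrm{incoming}}\overline{\mathcal M}(a_v,b_v)\times\prod_{v\ \mathrm{outgoing}}\overline{\mathcal M}(b_v,a_v),$$ the union over all collections $\vec b$ of critical points labeling the leaves. The topology is the natural one for broken trajectories: convergence means convergence of the structures in $N$ together with uniform convergence of the (continuous, concatenated) maps to $M$,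 with noncompact edges parametrized by the value of $f$.
   Formalization: Morphisms of graphs are additionally required to send incoming leaves to incoming leaves and outgoing leaves to outgoing leaves; without this, collapsing end edges can switch a leaf's type and the half-line conditions defining graph flows are inconsistent on glued points. *)

(* Defs.v *)
From HB Require Import structures.
From Stdlib Require Import Relation_Operators.
From Stdlib Require List.
From mathcomp Require Import all_boot all_order all_algebra.
From mathcomp Require Import generic_quotient finmap.
From mathcomp Require Import all_classical all_reals all_analysis.
Set Implicit Arguments.
Unset Strict Implicit.
Unset Printing Implicit Defensive.
Import Order.TTheory GRing.Theory Num.Theory.
Import numFieldNormedType.Exports.
Local Open Scope classical_set_scope.
Local Open Scope ring_scope.

(** * Topological preliminaries *)

Definition induced_topology (S : Type) (T : topologicalType) (h : S -> T) :
  topologicalType := initial_topology (h : {classic S} -> T).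

Definition disjoint_union (I : Type) (X : I -> topologicalType) :
  topologicalType := {i : {classic I} & X i}.

Section Quotient.
Context (T : topologicalType) (r : T -> T -> Prop).

Definition gen_eq : rel T := fun x y => `[< clos_refl_sym_trans T r x y >].

Lemma gen_eq_refl : reflexive gen_eq.
Proof. by move=> x; apply/asboolP; exact: rst_refl. Qed.

Lemma gen_eq_sym : symmetric gen_eq.
Proof. by move=> x y; apply/asboolP/asboolP => ?; exact: rst_sym. Qed.

Lemma gen_eq_trans : transitive gen_eq.
Proof.
move=> y x z /asboolP xy /asboolP yz; apply/asboolP; exact: rst_trans xy yz.
Qed.

Definition gen_equiv := EquivRel gen_eq gen_eq_refl gen_eq_sym gen_eq_trans.

(* The quotient space of T by the equivalence relation generated by r. *)
Definition quot : topologicalType := quotient_topology {eq_quot gen_equiv}%qT.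

Definition cls (x : T) : quot := (\pi_{eq_quot gen_equiv} x)%qT.

End Quotient.

(** * Smooth and Riemannian manifolds *)

Section SmoothMaps.
Context (R : realType) (n : nat).

Definition partial (i : 'I_n) (h : 'rV[R]_n -> R) : 'rV[R]_n -> R :=
  fun x => 'D_(delta_mx 0 i) h x.

Definition partials (s : seq 'I_n) (h : 'rV[R]_n -> R) : 'rV[R]_n -> R :=
  foldr partial h s.

(* Used for open U only, where it says that all iterated partial derivatives of
   h exist and are continuous on U. *)
Definition smooth_on (U : set 'rV[R]_n) (h : 'rV[R]_n -> R) : Prop :=
  forall s x, U x -> {for x, continuous (partials s h)} /\
    forall i : 'I_n, derivable (partials s h) x (delta_mx 0 i).

End SmoothMaps.

(* A homeomorphism cmap from the open set cdom onto an open subset of R^n, with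
   inverse cinv; the values of cmap outside cdom and of cinv outside the image
   are irrelevant. *)
Record chart (R : realType) (n : nat) (M : topologicalType) := Chart {
  cdom : set M;
  cmap : M -> 'rV[R]_n;
  cinv : 'rV[R]_n -> M;
  cdom_open : open cdom;
  cimg_open : open (cmap @` cdom);
  cmap_cont : forall x, cdom x -> {for x, continuous cmap};
  cinv_cont : forall y, (cmap @` cdom) y -> {for y, continuous cinv};
  cmapK : forall x, cdom x -> cinv (cmap x) = x }.

Definition cimg R n (M : topologicalType) (c : chart R n M) : set 'rV[R]_n :=
  cmap c @` cdom c.

Definition topological_manifold (R : realType) (d : nat)
    (T : topologicalType) : Prop :=
  [/\ hausdorff_space T, @second_countable T &
      forall x : T, exists c : chart R d T, cdom c x].

Definition closed_manifold (M : topologicalType) : Prop :=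
  compact [set: M] /\ hausdorff_space M.

(* The j-th coordinate of the change of charts from c to c'. *)
Definition transition R n (M : topologicalType) (c c' : chart R n M) (j : 'I_n) :
  'rV[R]_n -> R := fun y => cmap c' (cinv c y) 0 j.

(* Tangent vectors are row vectors in charts, so that the Jacobian of a change of
   charts acts on them by multiplication on the right. *)
Record riemannian (R : realType) (n : nat) (M : topologicalType) := Riemannian {
  atlas : set (chart R n M);
  atlas_cover : forall x : M, exists2 c, atlas c & cdom c x;
  atlas_smooth : forall c c' j, atlas c -> atlas c' ->
    smooth_on (cmap c @` (cdom c `&` cdom c')) (transition c c' j);
  metric : chart R n M -> 'rV[R]_n -> 'M[R]_n;
  metric_smooth : forall c i j, atlas c ->
    smooth_on (cimg c) (fun y => metric c y i j);
  metric_sym : forall c y, atlas c -> cimg c y -> (metric c y)^T = metric c y;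
  metric_pos : forall c y (v : 'rV[R]_n), atlas c -> cimg c y -> v != 0 ->
    0 < (v *m metric c y *m v^T) 0 0;
  metric_change : forall c c' x, atlas c -> atlas c' -> cdom c x -> cdom c' x ->
    let J := \matrix_(i < n, j < n) partial i (transition c c' j) (cmap c x) in
    metric c (cmap c x) = J *m metric c' (cmap c' x) *m J^T }.

Section Riemannian.
Context (R : realType) (n : nat) (M : topologicalType) (g : riemannian R n M).

Definition in_chart (h : M -> R) (c : chart R n M) : 'rV[R]_n -> R :=
  h \o cinv c.

Definition smooth (h : M -> R) : Prop :=
  forall c, atlas g c -> smooth_on (cimg c) (in_chart h c).

Definition Cinfty := {h : M -> R | smooth h}.

Definition compact_in_chart (c : chart R n M) (K : set 'rV[R]_n) : Prop :=
  compact K /\ K `<=` cimg c.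

Definition jets (h : Cinfty) : prod_topology
    (fun i : {c : chart R n M | atlas g c} * seq 'I_n =>
       {family compact_in_chart (sval i.1), 'rV[R]_n -> R}) :=
  fun i => partials i.2 (in_chart (sval h) (sval i.1)).

(* The C^infinity topology: uniform convergence of all partial derivatives on
   the compact subsets of the charts. *)
Definition CinftyT : topologicalType := induced_topology jets.

Definition critical (h : M -> R) (x : M) : Prop :=
  forall c i, atlas g c -> cdom c x -> partial i (in_chart h c) (cmap c x) = 0.

Definition hessian (h : M -> R) (c : chart R n M) (x : M) : 'M[R]_n :=
  \matrix_(i, j) partials [:: i; j] (in_chart h c) (cmap c x).

Definition morse (h : M -> R) : Prop :=
  smooth h /\ forall x c, critical h x -> atlas g c -> cdom c x ->
    hessian h c x \in unitmx.

Definition gradient (h : M -> R) (c : chart R n M) (x : M) : 'rV[R]_n :=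
  (\row_i partial i (in_chart h c) (cmap c x)) *m invmx (metric g c (cmap c x)).

(* gamma solves gamma' + grad h (gamma) = 0 on the interval I, with one-sided
   derivatives at the end points of I; if I is a point the equation is void. *)
Definition gradient_flow (h : M -> R) (I : set R) (gamma : R -> M) : Prop :=
  {within I, continuous gamma} /\
  forall t c, I t -> atlas g c -> cdom c (gamma t) ->
    (s - t)^-1 *: (cmap c (gamma s) - cmap c (gamma t)) @[s --> within I t^']
      --> - gradient h c (gamma t).

Definition trajectory (h : M -> R) (a b : M) (gamma : R -> M) : Prop :=
  [/\ gradient_flow h setT gamma, gamma s @[s --> -oo] --> a
    & gamma s @[s --> +oo] --> b].

Definition unstable (h : M -> R) (a : M) : set M :=
  [set x | exists gamma, [/\ gradient_flow h setT gamma, gamma 0 = x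
                           & gamma s @[s --> -oo] --> a]].

Definition stable (h : M -> R) (b : M) : set M :=
  [set x | exists gamma, [/\ gradient_flow h setT gamma, gamma 0 = x
                           & gamma s @[s --> +oo] --> b]].

(* The tangent space at x of a submanifold W, read in the chart c: velocities of
   the smooth curves in W through x. *)
Definition tangent (W : set M) (c : chart R n M) (x : M) : set 'rV[R]_n :=
  [set v | exists sigma : R -> M,
    [/\ sigma 0 = x,
        \forall s \near (0 : R), [/\ W (sigma s), cdom c (sigma s) &
          forall k, derivable (derive1n k (cmap c \o sigma)) s 1]
      & derive1 (cmap c \o sigma) 0 = v]].

Definition transverse (W W' : set M) : Prop :=
  forall x c, W x -> W' x -> atlas g c -> cdom c x ->
  forall v, exists u w, [/\ tangent W c x u, tangent W' c x w & v = u + w].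

Definition morse_smale (h : M -> R) : Prop :=
  morse h /\ forall a b, critical h a -> critical h b ->
    transverse (unstable h a) (stable h b).

End Riemannian.

(** * The category of graphs *)

(* Points of R^infinity are finitely supported sequences. *)
Definition seq_space (R : realType) : choiceType := {classic (nat -> R)}.

Definition arc_space (R : realType) : choiceType := {classic (set (seq_space R))}.

(* c is a characteristic map, onto the closure of the open arc A, for the
   orientation from v to w; ord is the order of the points along A.  The map may
   identify the end points, so that loops are allowed. *)
Definition oriented_arc (R : realType) (v w : seq_space R)
    (A : set (seq_space R)) (ord : set (seq_space R * seq_space R)) : Prop :=
  exists c : R -> seq_space R,
  [/\ c 0 = v, c 1 = w &
      forall i, {within `[0, 1], continuous (fun s => (c s : nat -> R) i)}] /\
  [/\ exists m, forall i s, (m <= i)%N -> 0 <= s <= 1 -> (c s : nat -> R) i = 0,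
      {in `]0, 1[ &, injective c}, A = [set c s | s in `]0, 1[]
    & ord = [set xy | exists s t, [/\ 0 < s, s < t, t < 1 & xy = (c s, c t)]]].

(* A finite graph embedded in R^infinity: vertices are points, edges are open
   arcs, oriented from src to tgt.  For a loop the orientation is seen only by
   eorder. *)
Record graph (R : realType) := Graph {
  vset : {fset seq_space R};
  eset : {fset arc_space R};
  src : eset -> vset;
  tgt : eset -> vset;
  eorder : eset -> set (seq_space R * seq_space R);
  base : vset;
  vset_fin : forall v : vset, exists m, forall i, (m <= i)%N ->
    (val v : nat -> R) i = 0;
  eset_arc : forall e : eset,
    oriented_arc (val (src e)) (val (tgt e)) (val e) (eorder e);
  eset_vset : forall (e : eset) (v : vset), ~ (val e : set (seq_space R)) (val v);
  eset_disj : forall e e' : eset, e <> e' ->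
    (val e : set (seq_space R)) `&` (val e' : set (seq_space R)) = set0 }.
Arguments src {_ _} _.
Arguments tgt {_ _} _.
Arguments base {_} _.

Definition vert (R : realType) (G : graph R) : finType := vset G.
Definition edge (R : realType) (G : graph R) : finType := eset G.

Section Graph.
Context (R : realType) (G : graph R).

Definition adj (A : {set edge G}) : rel (vert G) := fun v w =>
  [exists e in A, ((src e == v) && (tgt e == w)) ||
                  ((src e == w) && (tgt e == v))].

Definition connected_graph (W : {set vert G}) (A : {set edge G}) : Prop :=
  W != finset.set0 /\ {in W &, forall v w, connect (adj A) v w}.

(* dim H_1 of the subgraph with edges A: the boundary map is a matrix from
   chains on A to chains on the vertices. *)
Definition betti1 (A : {set edge G}) : nat :=
  \rank (kermx (\matrix_(i < #|A|, j < #|vert G|)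
    ((enum_val j == tgt (enum_val i))%:R
     - (enum_val j == src (enum_val i))%:R : rat))).

Definition is_tree (W : {set vert G}) (A : {set edge G}) : Prop :=
  connected_graph W A /\ betti1 A = 0%N.

Definition valence (v : vert G) : nat :=
  (#|[set e | src e == v]%SET| + #|[set e | tgt e == v]%SET|)%N.

Definition univalent (v : vert G) : bool := valence v == 1%N.

Definition incoming (v : vert G) : bool :=
  univalent v && [exists e : edge G, src e == v].

Definition outgoing (v : vert G) : bool :=
  univalent v && [exists e : edge G, tgt e == v].

Definition leaf := {v : vert G | univalent v}.

End Graph.

Record object (R : realType) (b p q : nat) := Object {
  gr :> graph R;
  gr_connected : connected_graph [set: vert gr]%SET [set: edge gr]%SET;
  gr_betti : betti1 [set: edge gr]%SET = b;
  gr_incoming : #|[set v : vert gr | incoming v]%SET| = p;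
  gr_outgoing : #|[set v : vert gr | outgoing v]%SET| = q;
  gr_base : ~~ univalent (base gr) }.

(* me e = inl v if the edge e is collapsed to the vertex v, and me e = inr e' if
   it is mapped onto the edge e'. *)
Record mor (R : realType) (G H : graph R) := Mor {
  mv : vert G -> vert H;
  me : edge G -> vert H + edge H;
  mor_ends : forall e, match me e with
    | inl v => mv (src e) = v /\ mv (tgt e) = v
    | inr e' => mv (src e) = src e' /\ mv (tgt e) = tgt e' end;
  mor_edge : forall e', exists! e, me e = inr e';
  mor_tree : forall v, is_tree [set w | mv w == v]%SET [set e | me e == inl v]%SET;
  mor_base : mv (base G) = base H;
  mor_incoming : forall v, incoming v -> incoming (mv v);
  mor_outgoing : forall v, outgoing v -> outgoing (mv v) }.

Definition mcell (R : realType) (G H : graph R) (phi : mor G H)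
    (c : vert G + edge G) : vert H + edge H :=
  match c with inl v => inl (mv phi v) | inr e => me phi e end.

Definition is_id (R : realType) (G : graph R) (phi : mor G G) : Prop :=
  mcell phi =1 id.

Definition is_comp (R : realType) (G H K : graph R) (psi : mor H K)
    (phi : mor G H) (chi : mor G K) : Prop :=
  mcell chi =1 mcell psi \o mcell phi.

(* Aut(Gamma): automorphisms of Gamma fixing every leaf. *)
Definition is_aut (R : realType) (G : graph R) (alpha : mor G G) : Prop :=
  (exists beta : mor G G, cancel (mcell alpha) (mcell beta) /\
                          cancel (mcell beta) (mcell alpha)) /\
  (forall v, univalent v -> mv alpha v = v).

(* A chain Gamma_k -> ... -> Gamma_0, with all the composites of its maps. *)
Record chain (R : realType) (b p q : nat) := Chain {
  chain_len : nat;
  ob : 'I_chain_len.+1 -> object R b p q;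
  cm : forall i j : 'I_chain_len.+1, (i <= j)%N -> mor (ob j) (ob i);
  cm_id : forall (i : 'I_chain_len.+1) (le : (i <= i)%N), is_id (cm le);
  cm_comp : forall (i j k : 'I_chain_len.+1) (ij : (i <= j)%N)
    (jk : (j <= k)%N) (ik : (i <= k)%N),
    is_comp (cm ij) (cm jk) (cm ik) }.

Arguments ob {_ _ _ _} _ _.
Arguments cm {_ _ _ _} _ {_ _} _.

Section Chains.
Context (R : realType) (b p q : nat).
Implicit Types tau : chain R b p q.

Definition top tau : object R b p q := ob tau ord_max.

(* The map Gamma_k -> Gamma_i. *)
Definition from_top tau (i : 'I_(chain_len tau).+1) : mor (top tau) (ob tau i) :=
  @cm _ _ _ _ tau i ord_max (leq_ord i).

Record augmentation (Gam : graph R) tau := Augmentation {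
  am : forall i : 'I_(chain_len tau).+1, mor (ob tau i) Gam;
  am_comp : forall (i j : 'I_(chain_len tau).+1) (ij : (i <= j)%N),
    is_comp (am i) (cm tau ij) (am j) }.

Arguments am {_ _} _ _.

Section Pull.
Context (tau : chain R b p q) (l : nat) (theta : 'I_l.+1 -> 'I_(chain_len tau).+1).
Context (mono : {homo theta : i j / (i <= j)%N}).

Definition pull : chain R b p q.
Proof.
refine (@Chain R b p q l (ob tau \o theta)
         (fun i j le => @cm _ _ _ _ tau _ _ (mono le)) _ _).
- by move=> i le; exact: cm_id.
- by move=> i j k ij jk ik; exact: cm_comp.
Defined.

Definition pull_augmentation Gam (pi : augmentation Gam tau) :
  augmentation Gam pull.
Proof.
refine (@Augmentation Gam pull (fun i => am pi (theta i)) _).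
by move=> i j ij; exact: (am_comp pi (mono ij)).
Defined.

End Pull.

(* A simplex of the nerve of the category of objects over Gamma. *)
Definition simplex (Gam : graph R) := {tau : chain R b p q & augmentation Gam tau}.

End Chains.

Arguments from_top {_ _ _ _} _ _.
Arguments am {_ _ _ _ _ _} _ _.

(** * Metric graph structures *)

Section Structures.
Context (R : realType) (n : nat) (M : topologicalType) (g : riemannian R n M).
Context (b p q : nat).
Implicit Types tau : chain R b p q.

Definition raw_structure tau :=
  ('rV[R]_(chain_len tau).+1 * (edge (top tau) -> Cinfty g))%type.

Definition is_structure tau (y : raw_structure tau) : Prop :=
  [/\ forall i, 0 <= y.1 0 i, \sum_i y.1 0 i = 1 & injective y.2].

Definition raw_structureT tau : topologicalType :=
  ('rV[R]_(chain_len tau).+1 *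
   prod_topology (fun _ : edge (top tau) => CinftyT g))%type.

Definition structure tau := {y : raw_structure tau | is_structure y}.

Definition structureT tau : topologicalType :=
  induced_topology (fun y : structure tau => sval y : raw_structureT tau).

(* The map of standard simplices induced by theta. *)
Definition push k l (theta : 'I_l.+1 -> 'I_k.+1) (t : 'rV[R]_l.+1) :
  'rV[R]_k.+1 := \row_j \sum_(i | theta i == j) t 0 i.

(* The two representatives of one point of the homotopy colimit given by a
   monotone theta : [l] -> [k]: the labels of Gamma_(theta l) are those of the
   corresponding edges of Gamma_k. *)
Definition same_structure tau l (theta : 'I_l.+1 -> 'I_(chain_len tau).+1)
    (mono : {homo theta : i j / (i <= j)%N})
    (y : raw_structure tau) (y' : raw_structure (pull mono)) : Prop :=
  y.1 = push theta y'.1 /\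
  forall e e', me (from_top tau (theta ord_max)) e = inr e' -> y'.2 e' = y.2 e.

Definition edge_length tau (t : 'rV[R]_(chain_len tau).+1)
    (e : edge (top tau)) : R :=
  \sum_i t 0 i * (if me (from_top tau i) e is inr _ then 1 else 0).

Context (Gam : object R b p q).

Definition pre_S : topologicalType :=
  disjoint_union (fun s : simplex b p q Gam => structureT (projT1 s)).

Definition pre_S_pt tau (pi : augmentation Gam tau) (y : structure tau) : pre_S :=
  existT (fun s : {classic simplex b p q Gam} => structureT (projT1 s))
    (existT _ tau pi) y.

Inductive glue_S : pre_S -> pre_S -> Prop :=
| GlueS tau pi l theta mono (y : structure tau)
    (y' : structure (@pull R b p q tau l theta mono)) :
    same_structure (sval y) (sval y') ->
    glue_S (pre_S_pt pi y) (pre_S_pt (pull_augmentation mono pi) y').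

Definition S_Gamma : topologicalType := quot glue_S.

Inductive aut_S : S_Gamma -> S_Gamma -> Prop :=
| AutS alpha tau (pi pi' : augmentation Gam tau) (y : structure tau) :
    is_aut alpha -> (forall i, is_comp alpha (am pi i) (am pi' i)) ->
    aut_S (cls glue_S (pre_S_pt pi y)) (cls glue_S (pre_S_pt pi' y)).

Definition M_Gamma : topologicalType := quot aut_S.

Definition M_Gamma_pt (x : pre_S) : M_Gamma := cls aut_S (cls glue_S x).

(* N, with the topology induced from M_Gamma, is a topological manifold. *)
Definition submanifold (N : set M_Gamma) : Prop :=
  exists d, topological_manifold R d
    (induced_topology (fun x : {x : M_Gamma | N x} => sval x)).

End Structures.

(** * Piecewise graph flows *)

(* M is a uniform space in order to state uniform convergence of maps to M; since
   it will be compact Hausdorff, its topology comes from only one uniformity. *)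
Section Flows.
Context (R : realType) (n : nat) (M : uniformType) (g : riemannian R n M).
Context (f : M -> R).

(* M(a, b): a flow line is the set of all translates of a trajectory. *)
Definition flow_line (a b : M) : set (set (R -> M)) :=
  [set L | exists2 gamma, trajectory g f a b gamma &
           L = [set (fun s => gamma (s + t)) | t in [set: R]]].

(* Broken trajectories a = a_0 > a_1 > ... > a_j = b, given by the sequence of the
   (a_i, L_i) with L_i in M(a_(i-1), a_i); the empty sequence if a = b. *)
Fixpoint broken (a b : M) (s : seq (M * set (R -> M))) : Prop :=
  match s with
  | [::] => a = b
  | (c, L) :: s' => [/\ a <> c, critical g f c, flow_line a c L & broken c b s']
  end.

Definition broken_points (s : seq (M * set (R -> M))) : set M :=
  [set x | exists2 cL, List.In cL s &
           x = cL.1 \/ exists2 gamma, cL.2 gamma & range gamma x].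

Context (b p q : nat) (Gam : object R b p q) (a : leaf Gam -> M).
Implicit Types tau : chain R b p q.

(* A map gamma from Gamma_k with half-lines to M, given by its restrictions, and
   broken trajectories at the leaves.  Leaves of Gamma_k are identified with
   leaves of Gamma. *)
Record raw_flow tau := RawFlow {
  fvert : vert (top tau) -> M;
  fedge : edge (top tau) -> R -> M;
  fhalf : leaf Gam -> R -> M;
  fcrit : leaf Gam -> M;
  fbroken : leaf Gam -> seq (M * set (R -> M)) }.

(* Maps on an interval are extended to R by their values at the end points. *)
Definition edge_flow (h : M -> R) (len : R) (x y : M) (gamma : R -> M) : Prop :=
  [/\ gradient_flow g h `[0, len] gamma,
      forall s, s <= 0 -> gamma s = x & forall s, len <= s -> gamma s = y].

Definition in_flow (c x : M) (gamma : R -> M) : Prop :=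
  [/\ gradient_flow g f `]-oo, 0] gamma, forall s, 0 <= s -> gamma s = x
    & gamma s @[s --> -oo] --> c].

Definition out_flow (x c : M) (gamma : R -> M) : Prop :=
  [/\ gradient_flow g f `[0, +oo[ gamma, forall s, s <= 0 -> gamma s = x
    & gamma s @[s --> +oo] --> c].

Definition is_flow tau (pi : augmentation Gam tau) (y : raw_structure g tau)
    (z : raw_flow tau) : Prop :=
  (forall e, edge_flow (sval (y.2 e)) (edge_length y.1 e)
               (fvert z (src e)) (fvert z (tgt e)) (fedge z e)) /\
  forall (v : leaf Gam) (w : vert (top tau)), univalent w ->
    mv (am pi ord_max) w = val v ->
    [/\ critical g f (fcrit z v),
        incoming (val v) -> in_flow (fcrit z v) (fvert z w) (fhalf z v) /\
                            broken (a v) (fcrit z v) (fbroken z v)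
      & outgoing (val v) -> out_flow (fvert z w) (fcrit z v) (fhalf z v) /\
                            broken (fcrit z v) (a v) (fbroken z v)].

(* The concatenation of the half-line at v and of the broken trajectory at v,
   parametrized by the value of f, which is strictly monotone along it. *)
Definition concat_points tau (z : raw_flow tau) (v : leaf Gam) : set M :=
  [set a v] `|` [set fcrit z v] `|` broken_points (fbroken z v)
  `|` range (fhalf z v).

Definition concat tau (z : raw_flow tau) (v : leaf Gam) (s : R) : M :=
  let x := fhalf z v 0 in
  let r := Num.max (Num.min (f x) (f (a v)))
             (Num.min (Num.max (f x) (f (a v))) s) in
  xget x [set y | concat_points z v y /\ f y = r].

Definition flow tau (pi : augmentation Gam tau) :=
  {yz : structure g tau * raw_flow tau | is_flow pi (sval yz.1) yz.2}.

Definition flow_maps tau (pi : augmentation Gam tau) (u : flow pi) :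
    (structureT g tau *
     (prod_topology (fun _ : vert (top tau) => M) *
      (prod_topology (fun _ : edge (top tau) => {uniform R -> M}) *
       prod_topology (fun _ : leaf Gam => {uniform R -> M}))))%type :=
  let z := (sval u).2 in ((sval u).1, (fvert z, (fedge z, concat z))).

(* Convergence of the structures and uniform convergence of the maps. *)
Definition flowT tau (pi : augmentation Gam tau) : topologicalType :=
  induced_topology (@flow_maps tau pi).

Definition pre_flow : topologicalType :=
  disjoint_union (fun s : simplex b p q Gam => flowT (projT2 s)).

Definition pre_flow_pt tau (pi : augmentation Gam tau) (u : flow pi) : pre_flow :=
  existT (fun s : {classic simplex b p q Gam} => flowT (projT2 s))
    (existT _ tau pi) u.

Definition same_flow tau l (theta : 'I_l.+1 -> 'I_(chain_len tau).+1)
    (mono : {homo theta : i j / (i <= j)%N})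
    (z : raw_flow tau) (z' : raw_flow (pull mono)) : Prop :=
  let m := from_top tau (theta ord_max) in
  [/\ forall v, fvert z' (mv m v) = fvert z v,
      forall e e', me m e = inr e' -> fedge z' e' = fedge z e,
      fhalf z' = fhalf z, fcrit z' = fcrit z & fbroken z' = fbroken z].

Inductive glue_flow : pre_flow -> pre_flow -> Prop :=
| GlueFlow tau (pi : augmentation Gam tau) l theta mono (u : flow pi)
    (u' : flow (@pull_augmentation R b p q tau l theta mono Gam pi)) :
    same_structure (sval (sval u).1) (sval (sval u').1) ->
    same_flow (sval u).2 (sval u').2 ->
    glue_flow (pre_flow_pt u) (pre_flow_pt u').

Definition flow_S : topologicalType := quot glue_flow.

Inductive aut_flow : flow_S -> flow_S -> Prop :=
| AutFlow alpha tau (pi pi' : augmentation Gam tau) (u : flow pi)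
    (u' : flow pi') :
    is_aut alpha -> (forall i, is_comp alpha (am pi i) (am pi' i)) ->
    sval u = sval u' ->
    aut_flow (cls glue_flow (pre_flow_pt u)) (cls glue_flow (pre_flow_pt u')).

Definition piecewise_flows : topologicalType := quot aut_flow.

Definition piecewise_flow_pt (x : pre_flow) : piecewise_flows :=
  cls aut_flow (cls glue_flow x).

(* The part lying over N. *)
Definition piecewise_flows_over (N : set (M_Gamma g Gam)) :
    set piecewise_flows :=
  [set x | exists tau (pi : augmentation Gam tau) (u : flow pi),
     x = piecewise_flow_pt (pre_flow_pt u) /\
     N (M_Gamma_pt (pre_S_pt pi (sval u).1))].

End Flows.

Arguments piecewise_flows_over {R n M g} f {b p q Gam} a N _.

(* Main.v *)
From Stdlib Require Import Relation_Operators.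
From Stdlib Require List.
From mathcomp Require Import all_boot all_order all_algebra.
From mathcomp Require Import generic_quotient finmap.
From mathcomp Require Import all_classical all_reals all_analysis.
From mathcomp Require Import ring lra zify.
Require Import Defs.
Set Implicit Arguments.
Unset Strict Implicit.
Unset Printing Implicit Defensive.
Import Order.TTheory GRing.Theory Num.Theory.
Import numFieldNormedType.Exports.
Local Open Scope classical_set_scope.
Local Open Scope ring_scope.

(* Compactness is tested on ultrafilters.  Every point of the homotopy colimit has a representative on a
   nondegenerate chain with all t_i > 0.  A function of the labels on one Aut(Gamma)-class of nondegenerate
   simplices, weighted by the product of the t_i and summed over faces, descends to a continuous function on
   M_Gamma.  These functions separate points, and they are bounded on the compact set N however large the
   weights: hence the points of N come from finitely many simplices, with labels in totally bounded sets on
   which distinct labels stay apart.  So one may work on one simplex, with converging structures, and the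
   limit structure lies in N.
   On a fixed simplex the flows on the edges are equicontinuous, and by the integrated form of the equation
   their limits are flows of the limit labels.  For half-lines and broken trajectories the speed tends to
   zero at the critical points; but as these are isolated, they are surrounded by barriers across which f
   drops by a definite amount, so that the paths parametrized by the value of f are equicontinuous.  A limit
   path meets finitely many critical points, between which it consists of flow lines, i.e. it is broken. *)

(** * Mean value estimates *)

Section Real.
Context {R : realType}.

(** The quotient topology of [M_Gamma] is accessible only through its continuous functions: neither
    separation of points nor the shape of compact subsets can be read off from the simplices. A
    function on one simplex extends continuously by 0 across the faces only if it vanishes where
    some [t_i] does; this forces the product of the [t_i] as weight, and the value prescribed at a
    chosen point is divided by the weight there, whatever its size. On the side of [M], lying
    downstream on a common flow line is not preserved by limits, because limits break. Paths are
    therefore treated as sets on which [f] is injective and whose points are comparable for a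
    weaker, closed relation; a point of a limit path is then found from its value of [f] alone. An
    ultrafilter makes all the data converge at once, without subsequences, and every case
    distinction valid along it falls on one side. So the place where a limit point comes from
    (critical point, flow line, half-line) may be assumed the same for all indices. *)

Lemma is_derive_slope (u : R -> R) (x d : R) :
  (y - x)^-1 * (u y - u x) @[y --> x^'] --> d -> is_derive x 1 u d.
Proof.
move=> H.
have K : (h^-1 *: ((u \o shift x) (h *: 1) - u x)) @[h --> 0^'] --> d.
  apply/cvgrPdist_lt => e e0.
  move/cvgrPdist_lt : H => /(_ _ e0).
  move=> /nbhs_ballP[r /= r0 hr]; apply/nbhs_ballP; exists r => //= h.
  rewrite -!ball_normE /= sub0r normrN => hr' h0.
  have := hr (h + x); rewrite -ball_normE /= opprD addrCA subrr addr0 normrN => /(_ hr').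
  by rewrite addrK /GRing.scale /= mulr1; apply; rewrite -subr_eq0 addrK.
split; first by apply/cvg_ex; exists d.
exact: cvg_lim.
Qed.

(** Measures the deviation from uniform motion with velocity [w]: [w = 0] bounds a displacement, and
    [w] equal to the derivative at one point makes [C] small. *)
Lemma mvt_le (u : R -> R) (s t C w : R) : s <= t ->
  {within `[s, t], continuous u} ->
  (forall x, s < x < t -> exists2 d : R, is_derive x 1 u d & `|d - w| <= C) ->
  `|u t - u s - (t - s) * w| <= C * (t - s).
Proof.
rewrite le_eqVlt => /predU1P[<- _ _|st cu du].
  by rewrite !subrr mul0r subr0 mulr0 normr0.
(* [MVT] wants the derivative as a function; its value 0 off the open interval is never read. *)
pose df x := if pselect (s < x < t) is left h then sval (cid2 (du x h)) else 0.
have dfP x : s < x < t -> is_derive x 1 u (df x) /\ `|df x - w| <= C.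
  by rewrite /df; case: pselect => // h _; case: cid2.
have [|//|c cst ->] := @MVT R u df s t st.
  by move=> x; rewrite in_itv /= => /dfP[].
rewrite [_ * w]mulrC -mulrBl normrM (@ger0_norm _ (t - s)) ?subr_ge0 ?(ltW st)//.
apply: ler_wpM2r; first by rewrite subr_ge0 ltW.
by case: (dfP c).
Qed.

Lemma mvt_drop (u : R -> R) (s t C : R) : s <= t ->
  {within `[s, t], continuous u} ->
  (forall x, s < x < t -> exists2 d : R, is_derive x 1 u d & d <= - C) ->
  u t - u s <= - C * (t - s).
Proof.
rewrite le_eqVlt => /predU1P[<- _ _|st cu du].
  by rewrite !subrr mulr0.
pose df x := if pselect (s < x < t) is left h then sval (cid2 (du x h)) else 0.
have dfP x : s < x < t -> is_derive x 1 u (df x) /\ df x <= - C.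
  by rewrite /df; case: pselect => // h _; case: cid2.
have [|//|c cst ->] := @MVT R u df s t st.
  by move=> x; rewrite in_itv /= => /dfP[].
apply: ler_wpM2r; first by rewrite subr_ge0 ltW.
by case: (dfP c).
Qed.

Lemma near_ord (T : Type) (F : set_system T) {FF : Filter F} n (P : 'I_n -> T -> Prop) :
  (forall i, \forall x \near F, P i x) -> \forall x \near F, forall i, P i x.
Proof. by move=> H; exact: (@filter_forall _ 'I_n P F). Qed.

End Real.

Section Partial.
Context {R : realType} {n : nat}.
Implicit Types F : 'rV[R]_n -> R.

Lemma partial_mvt F (y : 'rV[R]_n) (i : 'I_n) (a C w : R) :
  (forall r : R, `|r| <= `|a| -> derivable F (y + r *: delta_mx 0 i) (delta_mx 0 i) /\
     `|partial i F (y + r *: delta_mx 0 i) - w| <= C) ->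
  `|F (y + a *: delta_mx 0 i) - F y - a * w| <= C * `|a|.
Proof.
set e := delta_mx 0 i => H.
pose u (r : R) := F (y + r *: e).
have du (r : R) : `|r| <= `|a| -> is_derive r 1 u (partial i F (y + r *: e)).
  move=> /H[/derivableP [D1 D2] _].
  have K : (h^-1 *: ((u \o shift r) (h *: 1) - u r)) @[h --> (0:R)^'] --> partial i F (y + r *: e).
    rewrite /partial -/e.
    have := D1; rewrite /derivable => /cvg_toP.
    move=> /(_ _ erefl); rewrite /derive.
    apply: cvg_trans; apply: near_eq_cvg; near=> h.
    by rewrite /u /= [h%:A]mulr1 scalerDl addrCA.
  split; first by apply/cvg_ex; eexists; exact: K.
  exact: cvg_lim.
have cu (r : R) : `|r| <= `|a| -> {for r, continuous u}.
  by move=> /du[/derivable1_diffP/differentiable_continuous].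
have Hw (r : R) : `|r| <= `|a| -> `|partial i F (y + r *: e) - w| <= C by move=> /H[].
have [a0|a0] := leP 0 a.
- have := @mvt_le R u 0 a C w a0.
  rewrite /u scale0r addr0 subr0 (ger0_norm a0); apply.
  + apply: continuous_in_subspaceT => r; rewrite inE /= in_itv /= => /andP[r0 ra].
    by apply: cu; rewrite !ger0_norm.
  + move=> r /andP[r0 ra]; exists (partial i F (y + r *: e)).
      by apply: du; rewrite !ger0_norm ?(ltW r0) ?(ltW ra).
    by apply: Hw; rewrite !ger0_norm ?(ltW r0) ?(ltW ra).
- have := @mvt_le R u a 0 C w (ltW a0).
  rewrite /u scale0r addr0 sub0r (ltr0_norm a0) => H1.
  have -> : F (y + a *: e) - F y - a * w = - (F y - F (y + a *: e) - - a * w) by ring.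
  rewrite normrN.
  apply: H1.
  + apply: continuous_in_subspaceT => r; rewrite inE /= in_itv /= => /andP[ra r0].
    by apply: cu; rewrite !ler0_norm ?lerN2 ?(ltW a0).
  + move=> r /andP[ra r0]; exists (partial i F (y + r *: e)).
      by apply: du; rewrite !ltr0_norm ?lerN2 ?(ltW ra).
    by apply: Hw; rewrite !ltr0_norm ?lerN2 ?(ltW ra).
Unshelve. all: by end_near. Qed.

Lemma mx_norm_coord (x : 'rV[R]_n) i : `|x 0 i| <= `|x|.
Proof. rewrite [leRHS]/Num.norm /= mx_normrE. exact: (le_bigmax _ _ (0, i)). Qed.

Lemma mx_norm_le (x : 'rV[R]_n) C : 0 <= C -> (forall i, `|x 0 i| <= C) -> `|x| <= C.
Proof.
move=> C0 H; rewrite [leLHS]/Num.norm /= mx_normrE.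
by apply/bigmax_leP; split => // -[i j] _; rewrite ord1.
Qed.

(** Continuous partial derivatives give differentiability: pass from [y] to [z] by changing one
    coordinate at a time, with [partial_mvt] at each step. *)
Lemma partials_diff F (y : 'rV[R]_n) :
  (\forall z \near y, forall i, derivable F z (delta_mx 0 i)) ->
  (forall i, {for y, continuous (partial i F)}) ->
  forall e, 0 < e -> \forall z \near y,
    `|F z - F y - \sum_i (z - y) 0 i * partial i F y| <= e * `|z - y|.
Proof.
move=> dF cF e e0.
(* Each of the [n] coordinate steps may err by [e']; the [+ 1] serves the case [n = 0]. *)
pose e' := e / (n%:R + 1).
have e'0 : 0 < e' by rewrite divr_gt0// ltr_wpDl.
have : \forall z \near y, forall i, derivable F z (delta_mx 0 i) /\ `|partial i F z - partial i F y| <= e'.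
  have : \forall z \near y, forall i, `|partial i F z - partial i F y| <= e'.
    apply: (near_ord (F := nbhs y)) => i; have /cvgrPdist_le/(_ _ e'0) := cF i.
    by apply: filterS => z; rewrite distrC.
  by apply: filterS2 dF => z h1 h2 i.
rewrite -nbhs_nearE => /nbhs_ballP [d /= d0 hd].
near=> z.
have zd : `|z - y| < d.
  by rewrite distrC; near: z; apply/nbhs_ballP; exists d => //= z; rewrite -ball_normE.
(* [p k] takes its first [k] coordinates from [z] and the others from [y]; in the sup norm it is no
   farther from [y] than [z]. *)
pose p k : 'rV[R]_n := y + \sum_(i < n | (i < k)%N) (z - y) 0 i *: delta_mx 0 i.
have pj k j : (p k - y) 0 j = if (j < k)%N then (z - y) 0 j else 0.
  rewrite /p addrC addKr summxE.
  case: ifP => jk.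
    rewrite (bigD1 j) //= big1 ?addr0 => [|i /andP[_ ij]].
      by rewrite !mxE !eqxx mulr1.
    by rewrite !mxE eq_sym (negbTE ij) andbF mulr0.
  rewrite big1 // => i ik; rewrite !mxE; have [ji|_] := eqVneq j i; last by rewrite andbF mulr0.
  by rewrite ji ik in jk.
have step (k : 'I_n) : `|F (p k.+1) - F (p k) - (z - y) 0 k * partial k F y| <= e' * `|z - y|.
  have -> : p k.+1 = p k + (z - y) 0 k *: delta_mx 0 k.
    rewrite /p -addrA (bigD1 k) //= [(z - y) 0 k *: _ + _]addrC; congr (_ + (_ + _)).
    by apply: eq_bigl => i; rewrite ltnS leq_eqVlt (inj_eq val_inj); case: eqP => [->|] //=; rewrite ?ltnn ?andbT.
  apply: le_trans (_ : e' * `|(z - y) 0 k| <= _); last first.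
    by rewrite ler_pM2l// mx_norm_coord.
  apply: partial_mvt => r rz.
  have B : ball y d (p k + r *: delta_mx 0 k).
    rewrite -ball_normE /= distrC.
    apply: le_lt_trans zd; apply: mx_norm_le => // j.
    rewrite addrAC mxE pj !mxE eqxx /=.
    have [->|jk] := eqVneq j k.
      by rewrite ltnn add0r mulr1; exact: le_trans rz (mx_norm_coord _ _).
    rewrite mulr0 addr0; case: ifP => _; last by rewrite normr0.
    by have := mx_norm_coord (z - y) j; rewrite !mxE.
  by have [] := hd _ B k.
have p0 : p 0%N = y by rewrite /p big_pred0 ?addr0.
have pn : p n = z.
  apply/rowP => j; have := pj n j; rewrite ltn_ord !mxE => /(congr1 (+%R^~ (y 0 j))).
  by rewrite !subrK.
have -> : F z - F y = \sum_(k < n) (F (p k.+1) - F (p k)).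
  by rewrite -{1}pn -{1}p0 -(big_mkord xpredT (fun k => F (p k.+1) - F (p k))) telescope_sumr.
rewrite -sumrB; apply: le_trans (ler_norm_sum _ _ _) _.
apply: le_trans (ler_sum _ (fun k _ => step k)) _.
rewrite sumr_const card_ord -mulr_natl mulrA ler_wpM2r// /e'.
rewrite mulrCA ger_pMr// ler_pdivrMr ?mul1r ?lerDl//.
Unshelve. all: by end_near. Qed.

End Partial.

Lemma continuous_coord {R : realType} {m n : nat} (T : topologicalType) (A : T -> 'M[R]_(m, n)) x :
  (forall i j, {for x, continuous (fun y => A y i j)}) <-> {for x, continuous A}.
Proof.
split=> [H|H i j]; last first.
  exact: (continuous_comp H (@coord_continuous _ _ _ i j _)).
apply/cvgrPdist_lt => e e0.
have : \forall y \near x, forall i j, `|A x i j - A y i j| < e.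
  apply: (near_ord (F := nbhs x)) => i; apply: (near_ord (F := nbhs x)) => j.
  by have /cvgrPdist_lt := H i j; apply.
apply: filterS => y h; rewrite [ltLHS]/Num.norm /= mx_normrE.
by apply/bigmax_ltP; split => // -[i j] _; rewrite !mxE.
Qed.

(** Cramer's rule: near [x] the determinant is nonzero, and there [invmx] is the adjugate divided by
    the determinant. *)
Lemma continuous_invmx {R : realType} {n : nat} (T : topologicalType) (A : T -> 'M[R]_n) x :
  A x \in unitmx -> {for x, continuous A} -> {for x, continuous (fun y => invmx (A y))}.
Proof.
move=> uA /continuous_coord cA.
have cdet m (B : T -> 'M[R]_m) : (forall i j, {for x, continuous (fun y => B y i j)}) ->
    {for x, continuous (fun y => \det (B y))}.
  move=> cB; rewrite /determinant; apply: cvg_big => [|s _]; first by move=> ?; exact: add_continuous.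
  apply: cvgM; first exact: cvg_cst.
  apply: cvg_big => [|i _]; last exact: cB.
  by move=> ?; exact: mul_continuous.
have du : \det (A x) != 0 by rewrite -unitfE -unitmxE.
have near_u : \forall y \near x, A y \in unitmx.
  have := cdet _ A cA; move=> /cvgrPdist_lt /(_ `|\det (A x)|); rewrite normr_gt0 => /(_ du).
  apply: filterS => y h; rewrite unitmxE unitfE; apply: contraTneq h => ->.
  by rewrite subr0 ltxx.
have H : (\det (A y))^-1 *: \adj (A y) @[y --> x] --> (\det (A x))^-1 *: \adj (A x).
  suff: {for x, continuous (fun y => (\det (A y))^-1 *: \adj (A y))} by [].
  apply/continuous_coord => i j.
  under [X in {for _, continuous X}]eq_fun do rewrite !mxE.
  apply: cvgM; first by apply: cvgV => //; exact: cdet.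
  apply: cvgM; first exact: cvg_cst.
  by apply: cdet => i' j'; under [X in {for _, continuous X}]eq_fun do rewrite !mxE; exact: cA.
suff: invmx (A y) @[y --> x] --> invmx (A x) by [].
have -> : invmx (A x) = (\det (A x))^-1 *: \adj (A x) by rewrite /invmx uA.
apply: cvg_trans H; apply: near_eq_cvg.
by apply: filterS near_u => y uy; rewrite /invmx uy.
Qed.

Lemma cvg_coord {R : realType} {n : nat} (T : Type) (F : set_system T) {FF : Filter F}
  (z : T -> 'rV[R]_n) (l : 'rV[R]_n) j : z @ F --> l -> z y 0 j @[y --> F] --> l 0 j.
Proof.
move=> /cvgrPdist_lt H; apply/cvgrPdist_lt => e e0; have := H e e0.
by apply: filterS => y; apply: le_lt_trans; have := mx_norm_coord (l - z y) j; rewrite !mxE.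
Qed.

(** * Gradient flows in charts *)

Section Charts.
Context {R : realType} {n : nat} {M : topologicalType} {g : riemannian R n M}.
Implicit Types (c : chart R n M) (h : M -> R) (gamma : R -> M).

Lemma nbhs_cdom c x : cdom c x -> \forall y \near x, cdom c y.
Proof. by move=> cx; apply: open_nbhs_nbhs; split => //; exact: cdom_open. Qed.

Lemma cimg_cmap c x : cdom c x -> cimg c (cmap c x).
Proof. by move=> cx; exists x. Qed.

Lemma cinvK c y : cimg c y -> cdom c (cinv c y) /\ cmap c (cinv c y) = y.
Proof. by move=> [x cx <-]; rewrite cmapK. Qed.

Lemma nbhs_cimg c y : cimg c y -> \forall z \near y, cimg c z.
Proof. by move=> cy; apply: open_nbhs_nbhs; split => //; exact: cimg_open. Qed.

Lemma smooth_continuous h : smooth g h -> continuous h.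
Proof.
move=> sh x; have [c ac cx] := atlas_cover g x.
have [+ _] := sh c ac [::] _ (cimg_cmap cx).
move=> /= H.
have : {for x, continuous (in_chart h c \o cmap c)}.
  by apply: continuous_comp => //; exact: cmap_cont.
move=> H2; suff: h y @[y --> x] --> h x by [].
have -> : h x = (in_chart h c \o cmap c) x by rewrite /in_chart /= cmapK.
apply: cvg_trans H2; apply: near_eq_cvg.
by apply: filterS (nbhs_cdom cx) => y cy; rewrite /in_chart /= cmapK.
Qed.

Lemma continuous_partials h c s x : smooth g h -> atlas g c -> cdom c x ->
  {for x, continuous (fun y => partials s (in_chart h c) (cmap c y))}.
Proof.
move=> sh ac cx; apply: continuous_comp; first exact: cmap_cont.
by have [] := sh c ac s _ (cimg_cmap cx).
Qed.

Lemma metric_unit c y : atlas g c -> cimg c y -> metric g c y \in unitmx.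
Proof.
move=> ac cy; rewrite -row_free_unit -kermx_eq0.
apply/eqP/row_matrixP => i; rewrite row0; apply/eqP/negPn/negP => v0.
have := metric_pos ac cy v0.
have /sub_kermxP -> : (row i (kermx (metric g c y)) <= kermx (metric g c y))%MS by exact: row_sub.
by rewrite mul0mx mxE ltxx.
Qed.

Lemma continuous_gradient h c x : smooth g h -> atlas g c -> cdom c x ->
  {for x, continuous (gradient g h c)}.
Proof.
move=> sh ac cx; apply/continuous_coord => i j.
have /continuous_coord H : {for x, continuous (fun y => invmx (metric g c (cmap c y)))}.
  apply: continuous_invmx; first by apply: metric_unit => //; exact: cimg_cmap.
  apply/continuous_coord => i' j'.
  apply: (@continuous_comp _ _ _ (cmap c) (fun y => metric g c y i' j')); first exact: cmap_cont.
  by have [] := metric_smooth i' j' ac [::] (cimg_cmap cx).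
rewrite /gradient.
under [X in {for _, continuous X}]eq_fun do rewrite !mxE.
apply: cvg_big => [|k _]; first by move=> ?; exact: add_continuous.
apply: cvgM; last exact: H.
under eq_fun do rewrite !mxE.
rewrite mxE; exact: (@continuous_partials h c [:: k] x).
Qed.

(** The squared length of the gradient for the metric, by [energyE]: the rate at which [h] decreases
    along its flow. *)
Definition energy h c x : R :=
  \sum_i gradient g h c x 0 i * partial i (in_chart h c) (cmap c x).

Lemma continuous_energy h c x : smooth g h -> atlas g c -> cdom c x ->
  {for x, continuous (energy h c)}.
Proof.
move=> sh ac cx; apply: cvg_big => [|k _]; first by move=> ?; exact: add_continuous.
apply: cvgM; last exact: (@continuous_partials h c [:: k] x).
by move: k; have /continuous_coord H := continuous_gradient sh ac cx; move=> k; exact: (H 0 k).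
Qed.

Lemma energyE h c x : atlas g c -> cdom c x ->
  energy h c x = (gradient g h c x *m metric g c (cmap c x) *m (gradient g h c x)^T) 0 0.
Proof.
move=> ac cx; have cy := cimg_cmap cx.
rewrite trmx_mul -mulmxA trmx_inv metric_sym// mulKVmx ?metric_unit//.
by rewrite !mxE; apply: eq_bigr => i _; rewrite !mxE.
Qed.

Lemma energy_ge0 h c x : atlas g c -> cdom c x -> 0 <= energy h c x.
Proof.
move=> ac cx; rewrite energyE//.
have [->|/(metric_pos ac (cimg_cmap cx))/ltW//] := eqVneq (gradient g h c x) 0.
by rewrite !mul0mx mxE.
Qed.

Lemma gradient_eq0 h c x : atlas g c -> cdom c x ->
  gradient g h c x = 0 -> forall i, partial i (in_chart h c) (cmap c x) = 0.
Proof.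
move=> ac cx /(congr1 (mulmx^~ (metric g c (cmap c x)))).
rewrite mulmxKV ?metric_unit ?mul0mx//; last exact: cimg_cmap.
by move=> /rowP H i; have := H i; rewrite !mxE.
Qed.

Lemma energy_gt0 h c x i : atlas g c -> cdom c x ->
  partial i (in_chart h c) (cmap c x) != 0 -> 0 < energy h c x.
Proof.
move=> ac cx H; rewrite energyE//; apply: metric_pos => //; first exact: cimg_cmap.
by apply: contraNneq H => /(gradient_eq0 ac cx) ->.
Qed.

Lemma gradient_flowS h (I J : set R) gamma : J `<=` I ->
  gradient_flow g h I gamma -> gradient_flow g h J gamma.
Proof.
move=> JI [cg dg]; split; first exact: continuous_subspaceW cg.
move=> t c Jt ac ct; apply: cvg_trans (dg t c (JI _ Jt) ac ct).
apply: cvg_app => A; change (within I t^' A -> within J t^' A).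
by rewrite /within; apply: (@filterS _ (t^')) => s /= H /JI.
Qed.

Lemma gradient_flow_cvg h I gamma t : gradient_flow g h I gamma -> I t ->
  gamma s @[s --> within I (nbhs t)] --> gamma t.
Proof. by move=> [/subspace_continuousP + _] It; exact. Qed.

Lemma gradient_flow_slope h s t gamma c x : gradient_flow g h `[s, t] gamma ->
  s < x < t -> atlas g c -> cdom c (gamma x) ->
  (y - x)^-1 *: (cmap c (gamma y) - cmap c (gamma x)) @[y --> x^'] --> - gradient g h c (gamma x).
Proof.
move=> [_ dg] /andP[sx xt] ac cx.
have := dg x c; rewrite /= in_itv /= !ltW// => /(_ isT ac cx).
apply: cvg_trans; apply: cvg_app => A.
change (within `[s, t] x^' A -> x^' A); rewrite {1}/within => HA; near=> y.
have : `[s, t]%classic y.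
  rewrite /= in_itv /=; apply/andP; split; apply: ltW; near: y.
    by apply: nbhs_dnbhs; exact: lt_nbhsr.
  by apply: nbhs_dnbhs; exact: lt_nbhsl.
by near: y.
Unshelve. all: by end_near. Qed.

Lemma gradient_flow_continuous h s t gamma x : gradient_flow g h `[s, t] gamma ->
  s < x < t -> {for x, continuous gamma}.
Proof.
move=> fg /andP[sx xt].
have := @gradient_flow_cvg _ _ _ x fg; rewrite /= in_itv /= !ltW// => /(_ isT).
apply: cvg_trans; apply: cvg_app => A; rewrite /within /= => HA.
near=> y; have : `[s, t]%classic y.
  rewrite /= in_itv /=; apply/andP; split; apply: ltW; near: y.
    exact: lt_nbhsr. exact: lt_nbhsl.
by near: y.
Unshelve. all: by end_near. Qed.

Lemma gradient_flow_derive h s t gamma c x j : gradient_flow g h `[s, t] gamma ->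
  s < x < t -> atlas g c -> cdom c (gamma x) ->
  is_derive x 1 (fun r => cmap c (gamma r) 0 j) (- gradient g h c (gamma x) 0 j).
Proof.
move=> fg sxt ac cx; apply: is_derive_slope.
have H := gradient_flow_slope fg sxt ac cx.
have H1 := @cvg_coord R n _ (x^') _ _ _ j H.
have -> : - gradient g h c (gamma x) 0 j = (- gradient g h c (gamma x)) 0 j by rewrite [in RHS]mxE.
apply: cvg_trans (H1 _); apply: near_eq_cvg; near=> y.
by rewrite !mxE.
Unshelve. all: by end_near. Qed.

(** The chain rule in a chart: the linear part of [h] gives the energy, and the remainder of
    [partials_diff] is negligible because the difference quotients of the flow stay bounded by
    [|G| + 1]. *)
Lemma gradient_flow_denergy h s t gamma c x : smooth g h -> gradient_flow g h `[s, t] gamma ->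
  s < x < t -> atlas g c -> cdom c (gamma x) ->
  is_derive x 1 (h \o gamma) (- energy h c (gamma x)).
Proof.
move=> sh fg sxt ac cx; apply: is_derive_slope.
set z := fun y => cmap c (gamma y).
have H := gradient_flow_slope fg sxt ac cx.
set G := gradient g h c (gamma x) in H.
pose F := in_chart h c.
have cg := gradient_flow_continuous fg sxt.
have cz : {for x, continuous z}.
  by apply: continuous_comp => //; exact: cmap_cont.
have D := @partials_diff R n F (z x) _ _.
have lin : \sum_i ((y - x)^-1 *: (z y - z x)) 0 i * partial i F (z x) @[y --> x^'] -->
    - energy h c (gamma x).
  rewrite -sumrN; apply: cvg_big => [|k _]; first by move=> ?; exact: add_continuous.
  rewrite -mulNr; apply: cvgM; last exact: cvg_cst.
  have -> : - gradient g h c (gamma x) 0 k = (- G) 0 k by rewrite [in RHS]mxE.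
  exact: cvg_coord H.
rewrite -[X in _ --> X]addr0.
have rem : (y - x)^-1 * (h (gamma y) - h (gamma x)) -
    \sum_i ((y - x)^-1 *: (z y - z x)) 0 i * partial i F (z x) @[y --> x^'] --> (0 : R).
  apply/cvgrPdist_le => e e0.
  have K0 : 0 < `|G| + 1 by rewrite ltr_wpDl.
  have e'0 : 0 < e / (`|G| + 1) by rewrite divr_gt0.
  have bd : \forall y \near x^', `|(y - x)^-1 *: (z y - z x)| <= `|G| + 1.
    have /cvgrPdist_le/(_ 1 ltr01) := H; apply: filterS => y; rewrite -/(z y) -/(z x); move: (_ *: _) => w h1.
    have -> : w = (w + G) - G by rewrite addrK.
    apply: le_trans (ler_normB _ _) _; rewrite addrC lerD2l.
    by rewrite -normrN opprD addrC.
  have near_c : \forall y \near x^', cdom c (gamma y).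
    by apply: nbhs_dnbhs; apply: cg; exact: nbhs_cdom.
  have nd : \forall y \near x^', `|F (z y) - F (z x) -
      \sum_i (z y - z x) 0 i * partial i F (z x)| <= e / (`|G| + 1) * `|z y - z x|.
    suff nd0 : \forall w \near z x, `|F w - F (z x) - \sum_i (w - z x) 0 i * partial i F (z x)|
        <= e / (`|G| + 1) * `|w - z x|.
      by apply: nbhs_dnbhs; exact: cz nd0.
    apply: D e'0.
      apply: filterS (nbhs_cimg (cimg_cmap cx)) => w cw i.
      by have [_] := sh c ac [::] _ cw; apply.
    by move=> i; have [] := sh c ac [:: i] _ (cimg_cmap cx).
  near=> y.
  have yx : y != x by near: y; exact: nbhs_dnbhs_neq.
  have -> : h (gamma y) - h (gamma x) = F (z y) - F (z x).
    rewrite /F /in_chart /= /z !cmapK//; near: y; exact: near_c.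
  have -> : \sum_i ((y - x)^-1 *: (z y - z x)) 0 i * partial i F (z x) =
     (y - x)^-1 * \sum_i (z y - z x) 0 i * partial i F (z x).
    by rewrite mulr_sumr; apply: eq_bigr => i _; rewrite mxE mulrA.
  rewrite sub0r normrN -mulrBr normrM.
  have /(ler_wpM2l (normr_ge0 (y - x)^-1)) h1 : `|F (z y) - F (z x) -
      \sum_i (z y - z x) 0 i * partial i F (z x)| <= e / (`|G| + 1) * `|z y - z x|.
    by near: y; exact: nd.
  apply: le_trans h1 _; rewrite mulrCA -normrZ -ler_pdivlMl// invf_div.
  rewrite mulfVK ?gt_eqF//; near: y; exact: bd.
apply: cvg_trans (cvgD lin rem); apply: near_eq_cvg.
by near=> y; rewrite /= addrC subrK.
Unshelve. all: by end_near. Qed.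

(** The integrated form of the flow equation, with [w] an approximate gradient. The conclusion
    involves only values of [gamma], so that it passes to uniform limits. *)
Lemma flow_disp h s t gamma c w C : gradient_flow g h `[s, t] gamma -> s <= t -> 0 <= C ->
  atlas g c -> (forall r, s <= r <= t -> cdom c (gamma r)) ->
  (forall r, s < r < t -> `|gradient g h c (gamma r) - w| <= C) ->
  `|cmap c (gamma t) - cmap c (gamma s) + (t - s) *: w| <= C * (t - s).
Proof.
move=> fg st C0 ac cg dg; apply: mx_norm_le => [|j]; first by rewrite mulr_ge0// subr_ge0.
have := @mvt_le R (fun r => cmap c (gamma r) 0 j) s t C (- w 0 j) st.
have -> : (cmap c (gamma t) - cmap c (gamma s) + (t - s) *: w) 0 j =
    cmap c (gamma t) 0 j - cmap c (gamma s) 0 j - (t - s) * - w 0 j.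
  by rewrite !mxE mulrN opprK.
apply.
  apply/subspace_continuousP => x xst.
  have xst' : s <= x <= t by move: xst; rewrite /= in_itv.
  apply: (@cvg_coord R n _ (within `[s, t]%classic (nbhs x)) _ (fun r => cmap c (gamma r)) (cmap c (gamma x)) j).
  apply: cvg_comp (gradient_flow_cvg fg xst) _.
  exact: cmap_cont (cg _ xst').
move=> x xst; have xst' : s <= x <= t by case/andP: xst => ? ?; rewrite !ltW.
exists (- gradient g h c (gamma x) 0 j); first exact: gradient_flow_derive fg xst ac (cg _ xst').
rewrite -opprD normrN; apply: le_trans (dg _ xst).
by have := mx_norm_coord (gradient g h c (gamma x) - w) j; rewrite [X in `|X| <= _ -> _]mxE [X in `|_ + X| <= _ -> _]mxE.
Qed.

Lemma flow_within_continuous h s t gamma : smooth g h -> gradient_flow g h `[s, t] gamma ->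
  {within `[s, t], continuous (h \o gamma)}.
Proof.
move=> sh fg; apply/subspace_continuousP => x xst.
apply: cvg_comp (gradient_flow_cvg fg xst) _; exact: smooth_continuous.
Qed.

Lemma flow_drop h s t gamma c k : smooth g h -> gradient_flow g h `[s, t] gamma -> s <= t ->
  atlas g c -> (forall r, s <= r <= t -> cdom c (gamma r)) ->
  (forall r, s < r < t -> k <= energy h c (gamma r)) ->
  k * (t - s) <= h (gamma s) - h (gamma t).
Proof.
move=> sh fg st ac cg dg.
rewrite -lerN2 opprB -mulNr; apply: (@mvt_drop R (h \o gamma)) => //.
  exact: flow_within_continuous.
move=> x xst; have xst' : s <= x <= t by case/andP: xst => ? ?; rewrite !ltW.
exists (- energy h c (gamma x)); first exact: gradient_flow_denergy sh fg xst ac (cg _ xst').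
by rewrite lerN2 dg.
Qed.

Lemma flow_noninc h s t gamma : smooth g h -> gradient_flow g h `[s, t] gamma -> s <= t ->
  h (gamma t) <= h (gamma s).
Proof.
move=> sh fg st; rewrite -subr_le0 -(mul0r (t - s)) -[0 in leRHS]oppr0.
apply: (@mvt_drop R (h \o gamma)) => //; first exact: flow_within_continuous.
move=> x xst; have [c ac cx] := atlas_cover g (gamma x).
exists (- energy h c (gamma x)); first exact: gradient_flow_denergy sh fg xst ac cx.
by rewrite lerN2 energy_ge0.
Qed.

Lemma noncritical_energy h x : ~ critical g h x ->
  exists c, [/\ atlas g c, cdom c x & 0 < energy h c x].
Proof.
move=> /existsNP[c] /existsNP[i] /not_implyP[ac] /not_implyP[cx] /eqP H.
by exists c; split => //; exact: energy_gt0 H.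
Qed.

Lemma critical_energy h c x : atlas g c -> cdom c x -> critical g h x -> energy h c x = 0.
Proof. by move=> ac cx hx; rewrite /energy big1// => i _; rewrite hx// mulr0. Qed.

Lemma critical_gradient h c x : atlas g c -> cdom c x -> critical g h x -> gradient g h c x = 0.
Proof.
move=> ac cx hx; rewrite /gradient (_ : \row__ _ = 0) ?mul0mx//.
by apply/rowP => i; rewrite !mxE hx.
Qed.

Lemma noncritical_nbhs h x : smooth g h -> ~ critical g h x ->
  exists c k, [/\ atlas g c, 0 < k & \forall y \near x, cdom c y /\ k <= energy h c y].
Proof.
move=> sh /noncritical_energy[c [ac cx e0]]; exists c, (energy h c x / 2).
split => //; first by rewrite divr_gt0.
have := continuous_energy sh ac cx; move=> /cvgrPdist_lt /(_ (energy h c x / 2)).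
rewrite divr_gt0// => /(_ isT) H.
apply: filterS2 (nbhs_cdom cx) H => y cy hy; split => //; move: hy.
move: (energy h c x) (energy h c y) => u v; rewrite ltr_norml => /andP[_ hy].
lra.
Qed.

Lemma critical_closed h : smooth g h -> closed [set x | critical g h x].
Proof.
move=> sh; rewrite -openC openE => x /(noncritical_nbhs sh)[c [k [ac k0]]].
apply: filterS => y [cy ky] hy; move: ky.
by rewrite (critical_energy ac cy hy) leNgt k0.
Qed.

(** Where the energy is at least [k], time costs [h] at the rate [k]; as [h] varies by less than 2
    on [W], the stay is shorter than [T = 2 / k]. *)
Lemma noncritical_escape h x : smooth g h -> ~ critical g h x ->
  exists W T, [/\ nbhs x W, 0 < T & forall gamma s t, gradient_flow g h `[s, t] gamma ->
    s <= t -> (forall r, s <= r <= t -> W (gamma r)) -> t - s < T].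
Proof.
move=> sh nc; have [c [k [ac k0 H]]] := noncritical_nbhs sh nc.
have H2 : \forall y \near x, `|h x - h y| < 1.
  by have /cvgrPdist_lt := smooth_continuous sh (x := x); apply.
exists [set y | (cdom c y /\ k <= energy h c y) /\ `|h x - h y| < 1], (2 / k).
split; [by near=> y; split; near: y|by rewrite divr_gt0|].
move=> gamma s t fg st HW; rewrite ltr_pdivlMr// mulrC.
apply: le_lt_trans (flow_drop (c := c) (k := k) sh fg st ac _ _) _.
- by move=> r /HW[[]].
- by move=> r /andP[sr rt]; have [|[]//] := HW r; rewrite (ltW sr) (ltW rt).
have /HW[_] : s <= t <= t by rewrite st lexx.
rewrite ltr_norml => /andP[h1 h2].
have /HW[_] : s <= s <= t by rewrite st lexx.
rewrite ltr_norml => /andP[h3 h4].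
move: h1 h2 h3 h4; move: (h x) (h (gamma t)) (h (gamma s)) => u v w.
lra.
Unshelve. all: by end_near. Qed.

End Charts.

(** * Clamping, crossing times and truncated chart distances *)

Definition clamp {R : realType} (s t r : R) : R := Num.max s (Num.min t r).

Section Clamp.
Context {R : realType}.
Implicit Types (s t r : R).

Lemma clamp_itv s t r : s <= t -> s <= clamp s t r <= t.
Proof. by move=> st; rewrite /clamp le_max lexx /= ge_max st ge_min lexx. Qed.

Lemma clamp_id s t r : s <= r <= t -> clamp s t r = r.
Proof. by move=> /andP[sr rt]; rewrite /clamp (min_idPr rt) (max_idPr sr). Qed.

Lemma clamp_le s t r : s <= t -> r <= s -> clamp s t r = s.
Proof. by move=> st rs; rewrite /clamp; apply/max_idPl; rewrite ge_min rs orbT. Qed.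

Lemma clamp_ge s t r : s <= t -> t <= r -> clamp s t r = t.
Proof. by move=> st rs; rewrite /clamp (min_idPl rs); apply/max_idPr. Qed.

Lemma clamp_lip s t r r' : `|clamp s t r - clamp s t r'| <= `|r - r'|.
Proof.
rewrite /clamp; have H a b c : `|Num.max a b - Num.max a c| <= `|b - c| :> R.
  by rewrite !maxEle; do 2 case: ifPn; rewrite -?ltNge => *; rewrite ler_norml; apply/andP; split;
  have := ler_norm (b - c); have := ler_norm (c - b); rewrite (distrC c b); lra.
apply: le_trans (H _ _ _) _.
rewrite !minEle; do 2 case: ifPn; rewrite -?ltNge => *; rewrite ler_norml; apply/andP; split;
  have := ler_norm (r - r'); have := ler_norm (r' - r); rewrite (distrC r' r); lra.
Qed.

Lemma clamp_continuous s t : continuous (clamp s t).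
Proof.
move=> r; apply/cvgrPdist_lt => e e0; near=> x.
apply: le_lt_trans (clamp_lip _ _ _ _) _; near: x.
by have /cvgrPdist_lt := (@cvg_id _ (nbhs r)); apply.
Unshelve. all: by end_near. Qed.

Lemma within_clamp (T : topologicalType) s t (u : R -> T) : s <= t ->
  {within `[s, t], continuous u} -> continuous (u \o clamp s t).
Proof.
move=> st /subspace_continuousP cu r.
have cst : `[s, t]%classic (clamp s t r) by rewrite /= in_itv /= clamp_itv.
move=> A /(cu _ cst) HA.
have := @clamp_continuous s t r _ HA => HA'; change (nbhs r ((u \o clamp s t) @^-1` A)).
apply: (@filterS _ (nbhs r)) HA' => x /=; apply; rewrite in_itv /= clamp_itv//.
Qed.

Lemma compact_max (E : set R) : compact E -> E !=set0 -> exists2 m, E m & forall x, E x -> x <= m.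
Proof.
move=> cE E0; have [|m mE mx] := @compact_EVT_max R R id E E0 cE.
  by apply: continuous_subspaceT => x; exact: cvg_id.
by exists m; [rewrite inE in mE|move=> x Ex; apply: mx; rewrite inE].
Qed.

Lemma compact_min (E : set R) : compact E -> E !=set0 -> exists2 m, E m & forall x, E x -> m <= x.
Proof.
move=> cE E0; have [|m mE mx] := @compact_EVT_min R R id E E0 cE.
  by apply: continuous_subspaceT => x; exact: cvg_id.
by exists m; [rewrite inE in mE|move=> x Ex; apply: mx; rewrite inE].
Qed.

(** [t'] is the first time with [u >= b], and [s'] the last time before [t'] with [u <= a]. *)
Lemma crossing (u : R -> R) s t (a b : R) : continuous u -> s <= t -> u s <= a -> a < b -> b <= u t ->
  exists s' t', [/\ s <= s', s' < t', t' <= t & [/\ u s' = a, u t' = b &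
    forall r, s' <= r <= t' -> a <= u r <= b]].
Proof.
move=> cu st usa ab but.
have cE (v : R -> R) x y : continuous v -> compact (`[x, y]%classic `&` v @^-1` [set z | 0 <= z]).
  move=> cv; apply: (@subclosed_compact _ _ `[x, y]%classic).
  - apply: closedI; first exact: itv_closed.
    by apply: closed_comp => [z _|]; [exact: cv|exact: closed_ge].
  - exact: segment_compact.
  - by move=> z [].
have [||t' [/= t'st t'b] mint'] := @compact_min (`[s, t]%classic `&` (fun r => u r - b) @^-1` [set z | 0 <= z]).
- by apply: cE => r; apply: cvgB; [exact: cu|exact: cvg_cst].
- by exists t; rewrite /= in_itv /= st lexx subr_ge0.
move: t'st t'b; rewrite /= in_itv /= subr_ge0 => /andP[st' t't] t'b.
have [||s' [/= s'st s'a] maxs'] := @compact_max (`[s, t']%classic `&` (fun r => a - u r) @^-1` [set z | 0 <= z]).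
- by apply: cE => r; apply: cvgB; [exact: cvg_cst|exact: cu].
- by exists s; rewrite /= in_itv /= st' lexx subr_ge0.
move: s'st s'a; rewrite /= in_itv /= subr_ge0 => /andP[ss' s't'] s'a.
have cuw x y : {within `[x, y], continuous u} by exact: continuous_subspaceT.
have ut' : u t' = b.
  have [|r + ur] := @IVT R u s t' b st' (cuw _ _).
    by rewrite ge_min le_max t'b orbT andbT (le_trans usa) ?(ltW ab).
  rewrite in_itv /= => /andP[sr rt'].
  suff t'r : t' <= r by rewrite -ur (le_anti (_ : t' <= r <= t')) ?t'r.
  by apply: mint'; rewrite /= in_itv /= sr (le_trans rt')// ur subrr.
have us' : u s' = a.
  have [|r + ur] := @IVT R u s' t' a s't' (cuw _ _).
    by rewrite ge_min le_max s'a /= ut' (ltW ab) orbT.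
  rewrite in_itv /= => /andP[sr rt'].
  suff rs' : r <= s' by rewrite -ur (le_anti (_ : r <= s' <= r)) ?rs'.
  by apply: maxs'; rewrite /= in_itv /= rt' (le_trans ss')// ur subrr.
exists s', t'; split => //.
  by rewrite lt_neqAle s't' andbT; apply: contraTneq ab => e; rewrite -us' -ut' e ltxx.
split => // r /andP[s'r rt']; apply/andP; split; rewrite leNgt; apply/negP => H.
- have rs' : r <= s' by apply: maxs'; rewrite /= in_itv /= rt' (le_trans ss')//= subr_ge0 ltW.
  by move: H; rewrite (le_anti (_ : r <= s' <= r)) ?rs'// us' ltxx.
- have rs' : t' <= r by apply: mint'; rewrite /= in_itv /= (le_trans rt')//= (le_trans ss' s'r) subr_ge0 ltW.
  by move: H; rewrite (le_anti (_ : r <= t' <= r)) ?rs' ?rt'// ut' ltxx.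
Qed.
End Clamp.

Lemma compact_lower {R : realType} (T : topologicalType) (K : set T) (u : T -> R) :
  compact K -> (forall x, K x -> {for x, continuous u}) -> (forall x, K x -> 0 < u x) ->
  exists2 k, 0 < k & forall x, K x -> k <= u x.
Proof.
move=> cK cu u0; have [K0|/nonemptyPn K0] := pselect (K !=set0); last first.
  by exists 1 => // x; rewrite K0.
have [|m mK mm] := @compact_EVT_min T R u K K0 cK.
  by apply: continuous_in_subspaceT => x; rewrite inE; exact: cu.
exists (u m); first by apply: u0; rewrite inE in mK.
by move=> x Kx; apply: mm; rewrite inE.
Qed.

Lemma compact_upper {R : realType} (T : topologicalType) (K : set T) (u : T -> R) :
  compact K -> (forall x, K x -> {for x, continuous u}) ->
  exists2 k, 0 < k & forall x, K x -> u x <= k.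
Proof.
move=> cK cu; have [K0|/nonemptyPn K0] := pselect (K !=set0); last first.
  by exists 1 => // x; rewrite K0.
have [|m mK mm] := @compact_EVT_max T R u K K0 cK.
  by apply: continuous_in_subspaceT => x; rewrite inE; exact: cu.
exists (`|u m| + 1); first by rewrite ltr_wpDl.
move=> x Kx; apply: le_trans (mm x _) _; first by rewrite inE.
by apply: le_trans (ler_norm _) _; rewrite lerDl.
Qed.

Lemma dist_continuous {R : realType} (V : normedModType R) (a : V) : continuous (fun y : V => `|y - a|).
Proof.
move=> y; apply/cvgrPdist_lt => e e0; near=> z.
apply: le_lt_trans (ler_dist_dist _ _) _; rewrite opprB addrA subrK; near: z.
by have /cvgrPdist_lt := (@cvg_id _ (nbhs y)); apply.
Unshelve. all: by end_near. Qed.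

Section Bump.
Context {R : realType} {n : nat} {M : topologicalType} {g : riemannian R n M}.
Context (compactM : compact [set: M]) (hausM : hausdorff_space M).
Implicit Types (c : chart R n M) (h : M -> R) (gamma : R -> M).

(** Truncated at [r] so that the chart distance extends to all of [M] by the constant [r],
    continuously as soon as the closed ball of radius [r] lies in the chart. *)
Definition cdist c x (r : R) (z : M) : R :=
  if `[< cdom c z >] then Num.min `|cmap c z - cmap c x| r else r.

Definition cball c x (r : R) : set 'rV[R]_n := [set y | `|y - cmap c x| <= r].

Lemma cball_compact c x r : compact (cball c x r).
Proof.
apply: bounded_closed_compact; last first.
  change (closed ((fun y => `|y - cmap c x|) @^-1` [set z | z <= r])).
  apply: closed_comp; last exact: closed_le.
  by move=> y _; exact: dist_continuous.
exists (r + `|cmap c x|); split; first exact: num_real.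
move=> K rK y; rewrite /cball /= => yr; apply: le_trans (ltW rK).
by rewrite -[y](subrK (cmap c x)); apply: le_trans (ler_normD _ _) _; rewrite lerD2r.
Qed.

Lemma cball_near c x (P : set 'rV[R]_n) : (\forall y \near cmap c x, P y) ->
  exists2 r, 0 < r & cball c x r `<=` P.
Proof.
move=> /nbhs_ballP[r /= r0 rP]; exists (r / 2); first by rewrite divr_gt0.
move=> y; rewrite /cball /= => yr; apply: rP; rewrite -ball_normE /= distrC.
by apply: le_lt_trans yr _; rewrite ltr_pdivrMr// ltr_pMr// ltr1n.
Qed.

Lemma cdist_lt c x r z : cdist c x r z < r -> cdom c z /\ `|cmap c z - cmap c x| < r.
Proof.
by rewrite /cdist; case: asboolP => [cz|_]; rewrite ?ltxx// gt_min ltxx orbF.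
Qed.

Lemma cdist_cdom c x r z : cdom c z -> cdist c x r z = Num.min `|cmap c z - cmap c x| r.
Proof. by move=> cz; rewrite /cdist; case: asboolP. Qed.

(** The delicate points lie outside the chart domain: the image in [M] of the closed ball is
    compact, hence closed, and off it the function is constantly [r]. *)
Lemma cdist_continuous c x r : cball c x r `<=` cimg c -> continuous (cdist c x r).
Proof.
move=> cr z; have [cz|ncz] := pselect (cdom c z).
  suff: cdist c x r w @[w --> z] --> cdist c x r z by [].
  rewrite cdist_cdom//.
  have : Num.min `|cmap c w - cmap c x| r @[w --> z] --> Num.min `|cmap c z - cmap c x| r.
    apply: (@continuous_min R M (fun w => `|cmap c w - cmap c x|) (cst r)); last exact: cvg_cst.
    apply: cvg_norm; apply: cvgB; last exact: cvg_cst.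
    exact: cmap_cont.
  apply: cvg_trans; apply: near_eq_cvg.
  by apply: filterS (nbhs_cdom cz) => w cw; rewrite cdist_cdom.
have cK : closed (cinv c @` cball c x r).
  apply: compact_closed => //; apply: continuous_compact; last exact: cball_compact.
  by apply: continuous_in_subspaceT => y; rewrite inE => /cr; exact: cinv_cont.
have zK : ~ (cinv c @` cball c x r) z by move=> [y /cr/cinvK[+ _]] yz; rewrite yz.
suff: cdist c x r w @[w --> z] --> cdist c x r z by [].
rewrite {2}/cdist asboolF//.
apply: (@cvg_trans _ (r @[_ --> z])); last exact: cvg_cst.
apply: near_eq_cvg; have : \forall w \near z, (~` (cinv c @` cball c x r)) w.
  by apply: open_nbhs_nbhs; split => //; exact: closed_openC.
apply: filterS => w nw; rewrite /cdist; case: asboolP => // cw.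
apply/esym/min_idPr; rewrite leNgt; apply/negP => wr; apply: nw.
by exists (cmap c w); rewrite ?cmapK// /cball /= ltW.
Qed.

(** Between [s'] and [t'] the flow covers a chart distance of at least [r / 4] at speed at most
    [C]. *)
Lemma cdist_crossing c x r h gamma s t C : 0 < r -> cball c x r `<=` cimg c -> atlas g c ->
  gradient_flow g h `[s, t] gamma -> s <= t -> 0 < C ->
  (forall z, r / 4 <= cdist c x r z <= r / 2 -> `|gradient g h c z| <= C) ->
  cdist c x r (gamma s) <= r / 4 -> r / 2 <= cdist c x r (gamma t) ->
  exists s' t', [/\ s <= s', s' < t', t' <= t & r / (4 * C) <= t' - s' /\
    forall q, s' <= q <= t' -> cdom c (gamma q) /\ r / 4 <= cdist c x r (gamma q) <= r / 2].
Proof.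
move=> r0 cr ac fg st C0 HC us ut.
pose u := cdist c x r \o (gamma \o clamp s t).
have cg : continuous (gamma \o clamp s t) by apply: within_clamp => //; case: fg.
have cu : continuous u by move=> q; apply: continuous_comp; [exact: cg|exact: cdist_continuous].
have [|||s' [t' [ss' s't' t't [us' ut' ust]]]] := @crossing R u s t (r / 4) (r / 2) cu st.
- by rewrite /u /= clamp_id// lexx.
- lra.
- by rewrite /u /= clamp_id// lexx andbT.
have uE q : s' <= q <= t' -> u q = cdist c x r (gamma q).
  by move=> /andP[sq qt]; rewrite /u /= clamp_id// (le_trans ss') ?(le_trans qt).
have H q : s' <= q <= t' -> cdom c (gamma q) /\ r / 4 <= cdist c x r (gamma q) <= r / 2.
  move=> qst; have := ust _ qst; rewrite (uE _ qst) => Hq; split => //.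
  suff /cdist_lt[//] : cdist c x r (gamma q) < r.
  by case/andP: Hq => _; move: (cdist _ _ _ _) => w; lra.
exists s', t'; split => //; split => //.
have lst : s' <= t' by exact: ltW.
have := @flow_disp R n M g h s' t' gamma c 0 C _ lst (ltW C0) ac _ _.
rewrite scaler0 addr0 => D.
have {}D : `|cmap c (gamma t') - cmap c (gamma s')| <= C * (t' - s').
  apply: D.
  - apply: gradient_flowS fg => q /=; rewrite !in_itv /= => /andP[s'q qt'].
    by rewrite (le_trans ss') ?(le_trans qt').
  - by move=> q /H[].
  - move=> q /andP[s'q qt']; rewrite subr0; apply: HC.
    by have [|//] := H q; rewrite !ltW.
have [|cs' _] := H s'; first by rewrite lexx.
have [|ct' _] := H t'; first by rewrite lexx andbT.
have es : `|cmap c (gamma s') - cmap c x| = r / 4.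
  have : cdist c x r (gamma s') = r / 4 by rewrite -us' uE ?lexx.
  by rewrite cdist_cdom//; case: leP; lra.
have et : `|cmap c (gamma t') - cmap c x| = r / 2.
  have : cdist c x r (gamma t') = r / 2 by rewrite -ut' uE ?lexx ?andbT.
  by rewrite cdist_cdom//; case: leP; lra.
have := ler_distD (cmap c (gamma s')) (cmap c (gamma t')) (cmap c x).
rewrite es et => D2; rewrite invfM mulrA ler_pdivrMr// mulrC.
lra.
Qed.
End Bump.

Lemma mulmx_norm {R : realType} {n : nat} (u : 'rV[R]_n) (B : 'M[R]_n) :
  `|u *m B| <= n%:R * `|B| * `|u|.
Proof.
apply: mx_norm_le => [|j]; first by rewrite !mulr_ge0.
rewrite mxE; apply: le_trans (ler_norm_sum _ _ _) _.
have -> : n%:R * `|B| * `|u| = \sum_(k < n) (`|B| * `|u|).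
  by rewrite sumr_const card_ord -[RHS]mulr_natl mulrA.
apply: ler_sum => k _.
rewrite normrM mulrC ler_pM//; last exact: mx_norm_coord.
by rewrite [leRHS]/Num.norm /= mx_normrE; exact: (le_bigmax _ _ (k, j)).
Qed.

Lemma ler_lim {R : realType} (T : Type) (F : set_system T) {FF : ProperFilter F} (u v : T -> R) l m :
  u @ F --> l -> v @ F --> m -> (\forall t \near F, u t <= v t) -> l <= m.
Proof.
move=> /cvgrPdist_lt ul /cvgrPdist_lt vm uv; rewrite leNgt; apply/negP => ml.
have e0 : 0 < (l - m) / 2 by rewrite divr_gt0// subr_gt0.
have [t [[h1 h2] h3]] := filter_ex (filterI (filterI (ul _ e0) (vm _ e0)) uv).
move: h1 h2 h3; rewrite /= !ltr_norml => /andP[_ h1] /andP[h2 _] h3.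
move: h1 h2 h3; move: (u t) (v t) => x y; lra.
Qed.

(** * Barriers around critical points *)

Section Hills.
Context {R : realType} {n : nat} {M : topologicalType} {g : riemannian R n M}.
Context (compactM : compact [set: M]) (hausM : hausdorff_space M).
Implicit Types (c : chart R n M) (gamma : R -> M) (f : M -> R).

(** As all partial derivatives vanish at [y0] and at [y], the Hessian maps [y - y0] to a vector of
    lower order; [k] bounds the inverse Hessian, and the error [(2 * k)^-1] leads to
    [|y - y0| <= |y - y0| / 2]. *)
Lemma morse_isolated f c x : morse g f -> critical g f x -> atlas g c -> cdom c x ->
  \forall y \near cmap c x, (forall i, partial i (in_chart f c) y = 0) -> y = cmap c x.
Proof.
move=> [sf /(_ x c) + cr ac cx] => /(_ cr ac cx) uH.
set F := in_chart f c; set y0 := cmap c x; set H := hessian f c x in uH.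
pose k := n%:R * `|invmx H| + 1.
have k0 : 0 < k by rewrite ltr_wpDl// mulr_ge0.
have e0 : 0 < (2 * k)^-1 by rewrite invr_gt0 mulr_gt0.
have D i := @partials_diff R n (partial i F) y0.
have : \forall y \near y0, forall i, `|partial i F y - partial i F y0 -
    \sum_j (y - y0) 0 j * partial j (partial i F) y0| <= (2 * k)^-1 * `|y - y0|.
  apply: (near_ord (F := nbhs y0)) => i; apply: (D i) => //.
    apply: filterS (nbhs_cimg (cimg_cmap cx)) => w cw j.
    by have [_] := sf c ac [:: i] _ cw; apply.
  by move=> j; have [] := sf c ac [:: j; i] _ (cimg_cmap cx).
apply: filterS => y Hy py0; apply/eqP; rewrite -subr_eq0 -normr_le0.
have vH : `|(y - y0) *m H| <= (2 * k)^-1 * `|y - y0|.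
  apply: mx_norm_le => [|i]; first by rewrite mulr_ge0// ltW.
  have := Hy i; rewrite py0 (cr c i ac cx) subrr sub0r normrN mxE.
  suff -> : \sum_j (y - y0) 0 j * partial j (partial i F) y0 = \sum_j (y - y0) 0 j * H j i by [].
  by apply: eq_bigr => j _; rewrite [H j i]mxE.
have : `|y - y0| <= k * `|(y - y0) *m H|.
  rewrite -{1}[y - y0](mulmxK uH); apply: le_trans (mulmx_norm _ _) _.
  by rewrite ler_wpM2r// lerDl.
move=> /le_trans => /(_ _ (ler_wpM2l (ltW k0) vH)).
have -> : k * ((2 * k)^-1 * `|y - y0|) = `|y - y0| / 2 by field; rewrite gt_eqF.
lra.
Qed.

(** At a noncritical point the condition is vacuous nearby, some partial derivative being nonzero.
    Treating both cases alike gives barriers around every point of [M]. *)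
Lemma chart_isolated f x : morse g f -> exists c, [/\ atlas g c, cdom c x &
  \forall y \near cmap c x, (forall i, partial i (in_chart f c) y = 0) -> y = cmap c x].
Proof.
move=> mf; have [cx|nc] := pselect (critical g f x).
  have [c ac xc] := atlas_cover g x; exists c; split => //; exact: morse_isolated.
move: nc => /existsNP[c] /existsNP[i] /not_implyP[ac] /not_implyP[cx] /eqP H.
exists c; split => //.
have [/(_ _ _ _ _)sf _] := mf; have [+ _] := sf c ac [:: i] _ (cimg_cmap cx).
move=> /cvgrPdist_lt /(_ `|partial i (in_chart f c) (cmap c x)|).
rewrite normr_gt0 H => /(_ isT); apply: filterS => y /= + py.
by rewrite py subr0 ltxx.
Qed.

(* A barrier: a flow line crossing the shell 1 <= rho <= 2, which contains no critical point, loses d in f. *)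
Definition hill f (rho : M -> R) (d : R) : Prop :=
  [/\ continuous rho, 0 < d,
      forall gamma s t, gradient_flow g f `[s, t] gamma -> s <= t ->
        rho (gamma s) < 1 -> 2 < rho (gamma t) -> d <= f (gamma s) - f (gamma t)
    & forall x, critical g f x -> rho x < 1 \/ 2 < rho x].

(** A shell around [x] is compact and free of critical points, so the energy there is at least some
    [k > 0] and the speed at most some [C]: a crossing takes a definite time and costs a definite
    amount of [f]. *)
Lemma hill_exists f x (A : set M) : morse g f -> nbhs x A ->
  exists rho d, [/\ hill f rho d, rho x < 1 & forall z, rho z <= 2 -> A z].
Proof.
move=> mf xA; have [sf _] := mf.
have [c [ac cx iso]] := chart_isolated x mf.
have nA : \forall y \near cmap c x, A (cinv c y).
  by apply: cinv_cont; [exact: cimg_cmap|rewrite cmapK].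
have [r r0 hr] := cball_near (filterI (nbhs_cimg (cimg_cmap cx)) (filterI iso nA)).
have cr : cball c x r `<=` cimg c by move=> y /hr[].
have cb := cdist_continuous hausM cr.
pose K := [set z | r / 4 <= cdist c x r z <= r / 2].
have HK z : cdist c x r z <= r / 2 -> [/\ cdom c z, cdist c x r z = `|cmap c z - cmap c x| & cball c x r (cmap c z)].
  move=> zr; have /cdist_lt[cz] : cdist c x r z < r by lra.
  move=> zr'; split => //; last by rewrite /cball /= ltW.
  by rewrite cdist_cdom//; apply/min_idPl/ltW.
have cK : compact K.
  apply: (@subclosed_compact _ _ [set: M]) => //.
  have -> : K = cdist c x r @^-1` `[r / 4, r / 2] by apply/seteqP; split => z; rewrite /K /= in_itv.
  by apply: closed_comp => [z _|]; [exact: cb|exact: itv_closed].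
have cdK z : K z -> cdom c z by move=> /andP[_ /HK[]].
have [C C0 HC] := @compact_upper R M K (fun z => `|gradient g f c z|) cK
  (fun z Kz => cvg_norm (continuous_gradient sf ac (cdK z Kz))).
have [|k k0 Hk] := @compact_lower R M K (energy (g := g) f c) cK
  (fun z Kz => continuous_energy sf ac (cdK z Kz)).
  move=> z /andP[z1 /HK[cz ez Bz]]; have [_ [isoz _]] := hr _ Bz.
  apply: contrapT => e0; have /isoz zx : forall i, partial i (in_chart f c) (cmap c z) = 0.
    by move=> i; apply/eqP; apply: contrapT => /negP pi; apply: e0; exact: energy_gt0 pi.
  by move: z1; rewrite ez zx subrr normr0; lra.
have scale (b : R) : b = r / 4 * (4 / r * b) by field; rewrite gt_eqF.
(* The scaling turns the shell from [r / 4] to [r / 2] into the one from 1 to 2; the drop is [k]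
   times the least crossing time. *)
exists (fun z => 4 / r * cdist c x r z), (k * (r / (4 * C))); split.
- have d0 : 0 < k * (r / (4 * C)) by rewrite mulr_gt0// divr_gt0// mulr_gt0.
  split => //.
  + by move=> z; apply: cvgM; [exact: cvg_cst|exact: cb].
  + move=> gamma s t fg st us ut.
    have us' : cdist c x r (gamma s) <= r / 4.
      by rewrite (scale (cdist _ _ _ _)) -[leRHS]mulr1 ler_pM2l ?divr_gt0// ltW.
    have ut' : r / 2 <= cdist c x r (gamma t).
      by rewrite (scale (cdist _ _ _ _)) -ler_pdivrMl ?divr_gt0// ltW// invf_div mulrA mulfVK ?gt_eqF//; lra.
    have [s' [t' [ss' s't' t't [D H]]]] := cdist_crossing hausM r0 cr ac fg st C0 HC us' ut'.
    have ffS a b : s <= a -> b <= t -> gradient_flow g f `[a, b] gamma.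
      move=> sa bt; apply: gradient_flowS fg => q /=; rewrite !in_itv /= => /andP[aq qb].
      by rewrite (le_trans sa) ?(le_trans qb).
    have D1 := flow_noninc sf (ffS s s' (lexx _) (le_trans (ltW s't') t't)) ss'.
    have D2 := flow_noninc sf (ffS t' t (le_trans ss' (ltW s't')) (lexx _)) t't.
    have D3 := flow_drop (c := c) (k := k) sf (ffS s' t' ss' t't) (ltW s't') ac.
    have {}D3 : k * (t' - s') <= f (gamma s') - f (gamma t').
      apply: D3 => [q /H[]//|q /andP[sq qt]].
      by have [|_ /Hk//] := H q; rewrite !ltW.
    have := ler_wpM2l (ltW k0) D => D4.
    lra.
  + move=> z cz; have [zr|] := leP (cdist c x r z) (r / 2); last first.
      by move=> zr; right; rewrite mulrC mulrA ltr_pdivlMr//; lra.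
    have [cdz ez Bz] := HK z zr; have [_ [isoz _]] := hr _ Bz.
    left; rewrite ez isoz ?subrr ?normr0 ?mulr0// => i; exact: cz.
- by rewrite cdist_cdom// subrr normr0 (min_idPl (ltW r0)) mulr0.
- move=> z zr; have [|cz _ Bz] := HK z; last by have [_ [_]] := hr _ Bz; rewrite cmapK.
  by rewrite -(ler_pM2l (_ : 0 < 4 / r)) ?divr_gt0// (le_trans zr)// mulrA mulfVK ?gt_eqF//; lra.
Qed.

(* What survives in the limit of "q is downstream of p on a flow line": unlike the latter it is closed
   under limits, and it is transitive at critical points. *)
Definition down f p q : Prop := f q <= f p /\
  forall rho d, hill f rho d -> rho p < 1 -> 2 < rho q -> d <= f p - f q.

Lemma down_flow f gamma s t : smooth g f -> gradient_flow g f `[s, t] gamma -> s <= t ->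
  down f (gamma s) (gamma t).
Proof.
move=> sf fg st; split; first exact: flow_noninc sf fg st.
by move=> rho d [_ _ H _]; exact: H.
Qed.

Lemma down_refl f p : down f p p.
Proof.
split => // rho d _ h1 h2; have := lt_trans h1 (lt_trans _ h2).
by rewrite ltxx => /(_ _); rewrite ltr1n => /(_ isT).
Qed.

(* A critical point in the middle lies on one side of every hill, so that one of the two
   pieces already climbs it. *)
Lemma down_trans f p q r : critical g f q -> down f p q -> down f q r -> down f p r.
Proof.
move=> cq [pq Hpq] [qr Hqr]; split; first exact: le_trans qr pq.
move=> rho d H hp hr; have [_ _ _ /(_ _ cq)[q1|q2]] := H.
  by apply: le_trans (Hqr _ _ H q1 hr) _; rewrite lerB.
by apply: le_trans (Hpq _ _ H hp q2) _; rewrite lerB.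
Qed.

(** The premises [rho p < 1] and [2 < rho q] are open, so they hold along [F]; the inequalities to
    be proved are closed. *)
Lemma down_lim (T : Type) (F : set_system T) {FF : ProperFilter F} f (p q : T -> M) p0 q0 :
  continuous f -> p @ F --> p0 -> q @ F --> q0 ->
  (\forall t \near F, down f (p t) (q t)) -> down f p0 q0.
Proof.
move=> cf pp qq D.
have fp : f (p t) @[t --> F] --> f p0 by apply: cvg_comp pp (cf p0).
have fq : f (q t) @[t --> F] --> f q0 by apply: cvg_comp qq (cf q0).
split.
  by apply: (ler_lim fq fp); apply: filterS D => t [].
move=> rho d H hp hq; have [cr _ _ _] := H.
have rp : \forall t \near F, rho (p t) < 1.
  have h0 : \forall z \near p0, rho z < 1 by exact: (cr p0 [set y | y < 1] (lt_nbhsl hp)).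
  exact: pp h0.
have rq : \forall t \near F, 2 < rho (q t).
  have h0 : \forall z \near q0, 2 < rho z by exact: (cr q0 [set y | 2 < y] (lt_nbhsr hq)).
  exact: qq h0.
apply: (ler_lim (cvg_cst d) (cvgB fp fq)).
by apply: filterS3 D rp rq => t [_ Ht] h1 h2; exact: Ht h1 h2.
Qed.

End Hills.
Arguments hill {R n M} g f rho d.
Arguments down {R n M} g f p q.

(** * Moduli of continuity *)

Section Modulus.
Context {R : realType} {n : nat} {M : uniformType} {g : riemannian R n M}.
Context (compactM : compact [set: M]) (hausM : hausdorff_space M).
Implicit Types (c : chart R n M) (gamma : R -> M) (f : M -> R).

Lemma entourage_eq (x y : M) : (forall A, entourage A -> A (x, y)) -> x = y.
Proof.
move=> H; apply: hausM => A B /nbhsP[E entE EA] /nbhs_singleton By; exists y; split => //.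
by apply: EA; rewrite /xsection /= inE; exact: H.
Qed.

(** Cover [M] by the sets [rho < 1] of hills whose sets [rho <= 2] are small: a small enough drop
    does not suffice to cross any of finitely many hills. *)
Lemma down_modulus f (A : set (M * M)) : morse g f -> entourage A ->
  exists2 d, 0 < d & forall p q, down g f p q -> f p - f q < d -> A (p, q).
Proof.
move=> mf entA; have [sf _] := mf.
have /compact_near_coveringP := compactM.
pose P (d : R) (p : M) := forall q, down g f p q -> f p - f q < d -> A (p, q).
move=> /(_ R (0^'+) P _).
have near_d (x : M) : \forall x' \near x & d \near 0^'+, P d x'.
  pose E := split_ent A; have entE : entourage E by exact: entourage_split_ent.
  have nE : nbhs x [set z | E (z, x) /\ E (x, z)].
    have h1 := nbhs_entourage x entE.
    have h2 := nbhs_entourage x (entourage_inv entE).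
    by apply: filterS2 h1 h2 => z; rewrite /xsection /= !inE.
  have [rho [d [H rx HA]]] := hill_exists compactM hausM mf nE.
  have [cr d0 _ _] := H.
  exists ([set z | rho z < 1], [set e | e < d]); first split => /=.
  - exact: (cr x [set y | y < 1] (lt_nbhsl rx)).
  - exact: nbhs_right_lt.
  move=> [p e] /= [rp ed] q [_ /(_ _ _ H rp) Hq] drop.
  have [] := leP (rho q) 2 => [/HA[_ h]|/Hq]; last by move=> h; lra.
  have [h' _] : E (p, x) /\ E (x, p) by apply: HA; rewrite ltW// (lt_trans rp)// ltr1n.
  exact: entourage_split h' h.
move=> H; have {}H : \forall d \near 0^'+, [set: M] `<=` P d by apply: H => x _; exact: near_d.
near (0 : R)^'+ => d; exists d => //.
have HP : [set: M] `<=` P d by near: d.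
by move=> p q; exact: HP.
Unshelve. all: by end_near. Qed.

Lemma down_eq f p q : morse g f -> down g f p q -> f p = f q -> p = q.
Proof.
move=> mf D e; apply: entourage_eq => A /(down_modulus mf)[d d0]; apply => //.
by rewrite e subrr.
Qed.

Definition grad_conv (T : Type) (V : set_system T) (h : T -> M -> R) (h0 : M -> R) : Prop :=
  forall c (K : set M), atlas g c -> compact K -> K `<=` cdom c -> forall e, 0 < e ->
    \forall i \near V, forall z, K z -> `|gradient g (h i) c z - gradient g h0 c z| <= e.

Lemma cball_preimage c x r : 0 < r -> cball c x r `<=` cimg c ->
  compact [set z | cdist c x r z <= r / 2] /\ [set z | cdist c x r z <= r / 2] `<=` cdom c.
Proof.
move=> r0 cr; split.
  apply: (@subclosed_compact _ _ [set: M]) => //.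
  change (closed (cdist c x r @^-1` [set y | y <= r / 2])).
  by apply: closed_comp => [z _|]; [exact: cdist_continuous|exact: closed_le].
by move=> z /= zr; have /cdist_lt[] : cdist c x r z < r by lra.
Qed.

(** If [C] bounds the gradient of [h0] on a chart ball, [C + 1] bounds those of the [h i]
    eventually, and getting from distance [r / 4] to [r / 2] takes time at least
    [r / (4 * (C + 1))]. Compactness makes the time uniform over [M]. *)
Lemma uniform_speed (T : Type) (V : set_system T) {FV : Filter V} (h : T -> M -> R) h0 (A : set (M * M)) :
  smooth g h0 -> grad_conv V h h0 -> entourage A ->
  exists2 tau, 0 < tau & \forall i \near V, forall gamma s t, gradient_flow g (h i) `[s, t] gamma ->
    s <= t -> t - s < tau -> A (gamma s, gamma t).
Proof.
move=> sh ch entA.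
have /compact_near_coveringP := compactM.
pose P (i : T * R) (p : M) := forall gamma s t, gradient_flow g (h i.1) `[s, t] gamma ->
    s <= t -> t - s < i.2 -> gamma s = p -> A (gamma s, gamma t).
move=> /(_ (T * R)%type (filter_prod V 0^'+) P _).
have near_d (x : M) : \forall x' \near x & i \near filter_prod V 0^'+, P i x'.
  pose E := split_ent A; have entE : entourage E by exact: entourage_split_ent.
  have nE : nbhs x [set z | E (z, x) /\ E (x, z)].
    have h1 := nbhs_entourage x entE.
    have h2 := nbhs_entourage x (entourage_inv entE).
    by apply: filterS2 h1 h2 => z; rewrite /xsection /= !inE.
  have [c ac cx] := atlas_cover g x.
  have nA : \forall y \near cmap c x, E (cinv c y, x) /\ E (x, cinv c y).
    suff : nbhs (cinv c (cmap c x)) [set z | E (z, x) /\ E (x, z)] by exact: cinv_cont (cimg_cmap cx) _.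
    by rewrite cmapK.
  have [r r0 hr] := cball_near (filterI (nbhs_cimg (cimg_cmap cx)) nA).
  have cr : cball c x r `<=` cimg c by move=> y /hr[].
  have cb := cdist_continuous hausM cr.
  have [cK cdK] := cball_preimage r0 cr.
  have HK z : cdist c x r z <= r / 2 -> E (z, x) /\ E (x, z).
    move=> zr; have /cdist_lt[cz zr'] : cdist c x r z < r by lra.
    by have [_] := hr _ (ltW zr'); rewrite cmapK.
  have [C C0 HC] := @compact_upper R M _ (fun z => `|gradient g h0 c z|) cK
    (fun z Kz => cvg_norm (continuous_gradient sh ac (cdK z Kz))).
  have C10 : 0 < C + 1 by rewrite ltr_wpDl// ltW.
  exists ([set z | cdist c x r z < r / 4], [set i | (forall z, cdist c x r z <= r / 2 ->
      `|gradient g (h i.1) c z - gradient g h0 c z| <= 1) /\ i.2 < r / (4 * (C + 1))]).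
    split => /=.
      have b0 : cdist c x r x < r / 4 by rewrite cdist_cdom// subrr normr0 (min_idPl (ltW r0)) divr_gt0.
      exact: (cb x [set y | y < r / 4] (lt_nbhsl b0)).
    exists ([set i | forall z, cdist c x r z <= r / 2 -> `|gradient g (h i) c z - gradient g h0 c z| <= 1],
      [set t | t < r / (4 * (C + 1))]); first split => /=.
    - exact: (ch c _ ac cK cdK 1 ltr01).
    - by apply: nbhs_right_lt; rewrite divr_gt0// mulr_gt0.
    by move=> [i t] /= [].
  move=> [p [i tau]] /= [rp [Hi Htau]] gamma s t /= fg st tt sp.
  have [zr|zr] := leP (cdist c x r (gamma t)) (r / 2).
    have [_ h1] := HK _ zr; have [|h2 _] := HK (gamma s).
      by rewrite sp (le_trans (ltW rp))//; lra.
    exact: entourage_split h2 h1.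
  have HC1 z : r / 4 <= cdist c x r z <= r / 2 -> `|gradient g (h i) c z| <= C + 1.
    move=> /andP[_ z2]; rewrite -[gradient g (h i) c z](subrK (gradient g h0 c z)) addrC.
    by apply: le_trans (ler_normD _ _) _; rewrite lerD ?HC ?Hi.
  have [] := cdist_crossing hausM r0 cr ac fg st C10 HC1 _ (ltW zr).
    by rewrite sp ltW.
  move=> s' [t' [ss' s't' t't [D _]]]; lra.
move=> H; have {H}[[Q1 Q2] /= [VQ1 VQ2] HQ] : \forall i \near filter_prod V 0^'+, [set: M] `<=` P i.
  by apply: H => x _; exact: near_d.
have [tau [Qtau tau0]] : exists tau, Q2 tau /\ 0 < tau.
  near (0 : R)^'+ => tau; exists tau; split => //; near: tau; exact: VQ2.
exists tau => //; apply: filterS VQ1 => i Qi gamma s t fg st tt.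
by apply: (HQ (i, tau) (conj Qi Qtau) (gamma s) I gamma s t).
Unshelve. all: by end_near. Qed.

End Modulus.
Arguments grad_conv {R n M} g {T} V h h0.

Lemma ultra_map (T U : Type) (f : T -> U) (V : set_system T) :
  UltraFilter V -> UltraFilter (f @ V).
Proof.
move=> UV; split; first exact: fmap_proper_filter.
move=> G PG sub; apply/seteqP; split => // A GA.
have [//|nA] := in_ultra_setVsetC (f @^-1` A) UV.
have /(filterI GA) := sub (~` A) nA.
by rewrite setICr => /filter_not_empty.
Qed.

(** * Limits of gradient flows *)

Section Limits.
Context {R : realType} {M : uniformType}.
Context (compactM : compact [set: M]).
Context {T : Type} (V : set_system T) {UV : UltraFilter V}.

Lemma ultra_cvg (x : T -> M) : exists p : M, x @ V --> p.
Proof.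
have := compactM; rewrite compact_ultra => /(_ (x @ V) (ultra_map x UV) filterT)[p [_ xp]].
by exists p.
Qed.

Lemma entourage_split3 (A : set (M * M)) : entourage A -> exists2 B, entourage B &
  forall x y z w, B (x, y) -> B (y, z) -> B (z, w) -> A (x, w).
Proof.
move=> entA; pose B := split_ent (split_ent A).
have entB : entourage B by do 2 apply: entourage_split_ent.
exists (B `&` split_ent A).
  by apply: filterI => //; exact: entourage_split_ent.
move=> x y z w [xy _] [yz _] [_ zw]; apply: (entourage_split z) => //.
exact: entourage_split xy yz.
Qed.

Definition equi (phi : T -> R -> M) : Prop := forall A, entourage A -> exists2 tau, 0 < tau &
  \forall i \near V, forall s t, `|s - t| < tau -> A (phi i s, phi i t).

Definition loc_unif (phi : T -> R -> M) (phi0 : R -> M) : Prop := forall a b A, entourage A ->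
  \forall i \near V, forall s, a <= s <= b -> A (phi0 s, phi i s).

Lemma loc_unif_cvg phi phi0 s : loc_unif phi phi0 -> phi i s @[i --> V] --> phi0 s.
Proof.
move=> H; apply/cvg_app_entourageP => A entA.
by apply: filterS (H s s A entA) => i; apply; rewrite lexx.
Qed.

(** The theorem of Arzela and Ascoli along an ultrafilter: pointwise limits exist by compactness of
    [M], and equicontinuity makes the convergence uniform on segments. *)
Lemma equi_limit phi : equi phi -> exists phi0 : R -> M, continuous phi0 /\ loc_unif phi phi0.
Proof.
move=> eq; have /boolp.choice[phi0 phi0P] : forall s, exists p : M, phi i s @[i --> V] --> p.
  by move=> s; exact: ultra_cvg.
have near_s s A : entourage A -> \forall i \near V, A (phi0 s, phi i s).
  by move=> entA; have /cvg_app_entourageP := phi0P s; apply.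
have near_s' s A : entourage A -> \forall i \near V, A (phi i s, phi0 s).
  by move=> /entourage_inv /(near_s s).
have eq0 A : entourage A -> exists2 tau, 0 < tau & forall s t, `|s - t| < tau -> A (phi0 s, phi0 t).
  move=> /entourage_split3[B entB BA]; have [tau tau0 H] := eq B entB.
  exists tau => // s t st.
  have [i [[h1 h2] h3]] := filter_ex (filterI (filterI (near_s s B entB) (near_s' t B entB)) H).
  exact: BA h1 (h3 _ _ st) h2.
exists phi0; split.
  move=> s; apply/cvg_app_entourageP => A /eq0[tau tau0 H].
  near=> t; apply: H; near: t.
  by have /cvgrPdist_lt := (@cvg_id _ (nbhs s)); apply.
move=> a b A /entourage_split3[B entB BA].
have /compact_near_coveringP := @segment_compact R a b.
move=> /(_ T V (fun i s => A (phi0 s, phi i s)) _) H.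
have {}H : \forall i \near V, `[a, b] `<=` (fun s => A (phi0 s, phi i s)).
  apply: H => s _; have [tau tau0 H1] := eq B entB; have [tau' tau'0 H2] := eq0 B entB.
  exists ([set t | `|s - t| < Num.min tau tau'], [set i | B (phi0 s, phi i s) /\
     forall s t, `|s - t| < tau -> B (phi i s, phi i t)]); first split => /=.
  - have : 0 < Num.min tau tau' by rewrite lt_min tau0.
    by have /cvgrPdist_lt := (@cvg_id _ (nbhs s)); apply.
  - exact: filterI (near_s s B entB) H1.
  move=> [t i] /= [st [h1 h2]]; move: st; rewrite lt_min => /andP[st st'].
  by apply: BA h1 (h2 _ _ st); apply: H2; rewrite distrC.
by apply: filterS H => i Hi s sab; apply: Hi; rewrite /= in_itv.
Unshelve. all: by end_near. Qed.

Lemma loc_unif_clamp phi phi0 a b : a <= b -> loc_unif phi phi0 ->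
  (\forall i \near V, forall s, phi i s = phi i (clamp a b s)) -> hausdorff_space M ->
  (forall s, phi0 s = phi0 (clamp a b s)) /\
  forall A, entourage A -> \forall i \near V, forall s, A (phi0 s, phi i s).
Proof.
move=> ab lu cl hM.
have e0 s : phi0 s = phi0 (clamp a b s).
  apply: entourage_eq => // A /entourage_split3[B entB BA].
  have h1 := loc_unif_cvg (s := s) lu; have h2 := loc_unif_cvg (s := clamp a b s) lu.
  move/cvg_app_entourageP: h1 => /(_ B entB) h1.
  move/cvg_app_entourageP: h2 => /(_ _ (entourage_inv entB)) h2.
  have [i [[k1 k2] k3]] := filter_ex (filterI (filterI h1 h2) cl).
  by move: k1 k2; rewrite /= k3 => k1 k2; apply: BA k1 _ k2; exact: entourage_refl.
split => // A entA; apply: filterS2 cl (lu a b A entA) => i h1 h2 s.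
by rewrite h1 e0; apply: h2; exact: clamp_itv.
Qed.

End Limits.

Section FlowLimit.
Context {R : realType} {n : nat} {M : uniformType} {g : riemannian R n M}.
Context (compactM : compact [set: M]) (hausM : hausdorff_space M).
Context {T : Type} (V : set_system T) {UV : UltraFilter V}.
Context (h : T -> M -> R) (h0 : M -> R) (sh : smooth g h0) (ch : grad_conv g V h h0).
Context (gamma : T -> R -> M) (gamma0 : R -> M) (cg : continuous gamma0) (lu : loc_unif V gamma gamma0).

Lemma flow_lim_disp_open (I : T -> set R) (c : chart R n M) s t (w : 'rV[R]_n) C :
  atlas g c -> s <= t -> (forall i, gradient_flow g (h i) (I i) (gamma i)) ->
  (\forall i \near V, `[s, t] `<=` I i) -> 0 <= C ->
  (forall r, s <= r <= t -> cdom c (gamma0 r)) ->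
  (forall r, s <= r <= t -> `|gradient g h0 c (gamma0 r) - w| <= C) ->
  `|cmap c (gamma0 t) - cmap c (gamma0 s) + (t - s) *: w| <= C * (t - s).
Proof.
move=> ac st fg sub C0 cd dg.
apply/ler_addgt0Pr => e e0.
have [d d0 de] : exists2 d, 0 < d & (C + d) * (t - s) <= C * (t - s) + e.
  exists (e / (t - s + 1)); first by rewrite divr_gt0// ltr_wpDl// subr_ge0.
  rewrite mulrDl lerD2l mulrAC -mulrA ger_pMr// ler_pdivrMr ?mul1r ?lerDl//.
  by rewrite ltr_wpDl// subr_ge0.
apply: le_trans de.
have /compact_near_coveringP := @segment_compact R s t.
move=> /(_ T V (fun i r => cdom c (gamma i r) /\ `|gradient g (h i) c (gamma i r) - w| <= C + d) _) H.
have {H}near_i : \forall i \near V, `[s, t] `<=` (fun r => cdom c (gamma i r) /\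
     `|gradient g (h i) c (gamma i r) - w| <= C + d).
  apply: H => r /=; rewrite in_itv /= => rst; set x := gamma0 r; have cx := cd _ rst.
  have [r1 r10 hr] := cball_near (nbhs_cimg (cimg_cmap cx)).
  have cb := cdist_continuous hausM hr.
  have [cK cdK] := cball_preimage compactM hausM r10 hr.
  have d20 : 0 < d / 2 by rewrite divr_gt0.
  have Hi := ch ac cK cdK d20.
  have b0 : cdist c x r1 x < r1 / 2 by rewrite cdist_cdom// subrr normr0 (min_idPl (ltW r10)) divr_gt0.
  have nW : nbhs x [set z | cdist c x r1 z <= r1 / 2 /\ `|gradient g h0 c z - w| <= C + d / 2].
    have h1 : \forall z \near x, cdist c x r1 z < r1 / 2 := cb x [set y | y < r1 / 2] (lt_nbhsl b0).
    have /cvgrPdist_le/(_ _ d20) h2 := continuous_gradient sh ac cx.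
    apply: filterS2 h1 h2 => z z1 z2; split; first exact: ltW.
    rewrite -[gradient g h0 c z](subrK (gradient g h0 c x)) -addrA addrC.
    apply: le_trans (ler_normD _ _) _; apply: lerD; first exact: dg.
    by rewrite distrC.
  have [E entE Ex] := (nbhsP x _).1 nW.
  pose F := split_ent E; have entF : entourage F by exact: entourage_split_ent.
  have near_r : \forall r' \near r, F (x, gamma0 r') /\ `|r - r'| < 1.
    apply: filterI; first by have /cvg_app_entourageP := @cg r; apply.
    by have /cvgrPdist_lt := (@cvg_id _ (nbhs r)); apply.
  exists ([set r' | F (x, gamma0 r') /\ `|r - r'| < 1], [set i |
    (forall z, cdist c x r1 z <= r1 / 2 -> `|gradient g (h i) c z - gradient g h0 c z| <= d / 2) /\
    forall s, r - 1 <= s <= r + 1 -> F (gamma0 s, gamma i s)]); first split => //=.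
  - exact: filterI Hi (lu _ _ entF).
  move=> [r' i] /= [[h1 h2] [h3 h4]].
  have /Ex/=[z1 z2] : xsection E x (gamma i r').
    rewrite /xsection /= inE; apply: entourage_split h1 (h4 _ _) => //.
    by move: h2; rewrite ltr_norml => /andP[? ?]; apply/andP; split; lra.
  split; first exact: cdK.
  rewrite -[gradient g (h i) c _](subrK (gradient g h0 c (gamma i r'))) -addrA addrC.
  apply: le_trans (ler_normD _ _) _; have := h3 _ z1; lra.
have := ler_lim (F := V) (u := fun i => `|cmap c (gamma i t) - cmap c (gamma i s) + (t - s) *: w|)
  (v := cst ((C + d) * (t - s))).
apply; last first.
- apply: filterS2 near_i sub => i Hi si; apply: (flow_disp _ st _ ac).
  + by apply: gradient_flowS (fg i).
  + by rewrite addr_ge0// ltW.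
  + by move=> r rst; have [] := Hi r; rewrite /= ?in_itv.
  + by move=> r /andP[sr rt]; have [] := Hi r; rewrite /= ?in_itv /= ?(ltW sr) ?(ltW rt).
- exact: cvg_cst.
apply: cvg_norm; apply: cvgD; last exact: cvg_cst.
have H r : s <= r <= t -> cmap c (gamma i r) @[i --> V] --> cmap c (gamma0 r).
  move=> /cd cr; apply: cvg_comp (loc_unif_cvg (s := r) lu) _; exact: cmap_cont.
by apply: cvgB; apply: H; rewrite ?lexx ?st.
Qed.

(** The domains [I i] only exhaust the open interval, as when edge lengths increase to [t]: shrink
    it by [x] at both ends and let [x] tend to 0. *)
Lemma flow_lim_disp (I : T -> set R) (c : chart R n M) s t (w : 'rV[R]_n) C :
  atlas g c -> s < t -> (forall i, gradient_flow g (h i) (I i) (gamma i)) ->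
  (forall s' t', s < s' -> s' <= t' -> t' < t -> \forall i \near V, `[s', t'] `<=` I i) -> 0 <= C ->
  (forall r, s <= r <= t -> cdom c (gamma0 r)) ->
  (forall r, s <= r <= t -> `|gradient g h0 c (gamma0 r) - w| <= C) ->
  `|cmap c (gamma0 t) - cmap c (gamma0 s) + (t - s) *: w| <= C * (t - s).
Proof.
move=> ac st fg sub C0 cd dg.
have := ler_lim (F := 0^'+) (u := fun x : R => `|cmap c (gamma0 (t - x)) - cmap c (gamma0 (s + x)) +
    ((t - x) - (s + x)) *: w|) (v := fun x => C * ((t - x) - (s + x))).
have ct : t - x @[x --> 0^'+] --> t.
  rewrite -[X in _ --> X]subr0; apply: cvgB; first exact: cvg_cst.
  exact: cvg_at_right_filter cvg_id.
have cs : s + x @[x --> 0^'+] --> s.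
  rewrite -[X in _ --> X]addr0; apply: cvgD; first exact: cvg_cst.
  exact: cvg_at_right_filter cvg_id.
have cc r (u : R -> R) : s <= r <= t -> u x @[x --> 0^'+] --> r ->
    cmap c (gamma0 (u x)) @[x --> 0^'+] --> cmap c (gamma0 r).
  move=> /cd cr ur.
  have H1 : {for r, continuous (fun q => cmap c (gamma0 q))}.
    by apply: continuous_comp; [exact: cg|exact: cmap_cont].
  exact: (@cvg_comp _ _ _ u (fun q => cmap c (gamma0 q)) (0^'+) (nbhs r) (nbhs (cmap c (gamma0 r))) ur H1).
apply.
- apply: cvg_norm; apply: cvgD; last by apply: cvgZr_tmp; exact: cvgB ct cs.
  by apply: cvgB; apply: cc => //; rewrite lexx (ltW st).
- by apply: cvgM; [exact: cvg_cst|exact: cvgB ct cs].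
near=> x.
have x0 : 0 < x by near: x; exact: nbhs_right_gt.
have xts : x < (t - s) / 2 by near: x; apply: nbhs_right_lt; rewrite divr_gt0// subr_gt0.
apply: flow_lim_disp_open ac _ fg _ C0 _ _.
- lra.
- by apply: sub; lra.
- by move=> r /andP[r1 r2]; apply: cd; apply/andP; split; lra.
- by move=> r /andP[r1 r2]; apply: dg; apply/andP; split; lra.
Unshelve. all: by end_near. Qed.

(** The integrated equation with [w] the gradient at [gamma0 t] and [C] the wanted precision gives
    back the difference quotients on either side of [t]. *)
Lemma flow_lim (I : T -> set R) (I0 : set R) : is_interval I0 ->
  (forall i, gradient_flow g (h i) (I i) (gamma i)) ->
  (forall s s' t' t, I0 s -> I0 t -> s < s' -> s' <= t' -> t' < t ->
    \forall i \near V, `[s', t'] `<=` I i) ->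
  gradient_flow g h0 I0 gamma0.
Proof.
move=> iI0 fg sub; split; first by apply: continuous_subspaceT => x; exact: cg.
move=> t c It ac ct; apply/cvgrPdist_le => e e0.
have H : \forall s \near t, cdom c (gamma0 s) /\
    `|gradient g h0 c (gamma0 t) - gradient g h0 c (gamma0 s)| <= e.
  have h1 : \forall s \near t, cdom c (gamma0 s) := cg (nbhs_cdom ct).
  have : {for t, continuous (gradient g h0 c \o gamma0)}.
    by apply: continuous_comp; [exact: cg|exact: continuous_gradient].
  by move=> /cvgrPdist_le /(_ e e0) h2; exact: filterI h1 h2.
move/nbhs_ballP : H => [d /= d0 Hd].
have D s r : `|t - s| < d -> (s <= r <= t) || (t <= r <= s) -> cdom c (gamma0 r) /\
    `|gradient g h0 c (gamma0 r) - gradient g h0 c (gamma0 t)| <= e.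
  move=> sd sr; rewrite [X in _ /\ X <= _]distrC; apply: Hd; rewrite -ball_normE /=.
  apply: le_lt_trans sd; case/orP: sr => /andP[sr rt].
    by rewrite !ger0_norm; lra.
  by rewrite !ler0_norm; lra.
rewrite near_withinE; near=> s => Is.
have st : s != t by near: s; exact: nbhs_dnbhs_neq.
have sd : `|t - s| < d.
  by near: s; apply: nbhs_dnbhs; have /cvgrPdist_lt := (@cvg_id _ (nbhs t)); apply.
rewrite -normrN opprB opprK.
have -> : (s - t)^-1 *: (cmap c (gamma0 s) - cmap c (gamma0 t)) + gradient g h0 c (gamma0 t) =
    (s - t)^-1 *: (cmap c (gamma0 s) - cmap c (gamma0 t) + (s - t) *: gradient g h0 c (gamma0 t)).
  by rewrite [in RHS]scalerDr scalerA mulVf ?scale1r// subr_eq0.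
rewrite normrZ normfV ler_pdivrMl ?normr_gt0 ?subr_eq0// mulrC.
have [s_t|t_s|] := ltgtP s t; last by move=> e1; rewrite e1 eqxx in st.
- rewrite ltr0_norm ?subr_lt0// opprB.
  have -> : cmap c (gamma0 s) - cmap c (gamma0 t) + (s - t) *: gradient g h0 c (gamma0 t) =
    - (cmap c (gamma0 t) - cmap c (gamma0 s) + (t - s) *: gradient g h0 c (gamma0 t)).
    by rewrite opprD opprB -scaleNr opprB.
  rewrite normrN; apply: flow_lim_disp ac s_t fg _ (ltW e0) _ _.
  + by move=> s' t' h1 h2 h3; exact: sub h1 h2 h3.
  + by move=> r rr; have [] := D s r sd _; rewrite ?rr.
  + by move=> r rr; have [] := D s r sd _; rewrite ?rr.
- rewrite gtr0_norm ?subr_gt0//.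
  apply: flow_lim_disp ac t_s fg _ (ltW e0) _ _.
  + by move=> s' t' h1 h2 h3; exact: sub h1 h2 h3.
  + by move=> r rr; have [] := D s r sd _; rewrite ?rr ?orbT.
  + by move=> r rr; have [] := D s r sd _; rewrite ?rr ?orbT.
Unshelve. all: by end_near. Qed.

End FlowLimit.

(** * Ends of flow lines *)

Section Ends.
Context {R : realType} {n : nat} {M : uniformType} {g : riemannian R n M}.
Context (compactM : compact [set: M]) (hausM : hausdorff_space M).
Context (f : M -> R) (mf : morse g f).
Implicit Types (gamma : R -> M) (s t r : R).

Let sf : smooth g f := mf.1.
Let cf : continuous f := smooth_continuous sf.

Lemma f_bounds : exists m m' : R, forall x, m <= f x <= m'.
Proof.
have [B B0 HB] := compact_upper compactM (fun x _ => cf (x := x)).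
have [B' B'0 HB'] := compact_upper compactM (u := fun x => - f x) (fun x _ => cvgN (cf (x := x))).
by exists (- B'), B => x; rewrite lerNl HB' ?HB.
Qed.

Lemma flow_sub (h : M -> R) I gamma s t : is_interval I -> gradient_flow g h I gamma -> I s -> I t ->
  gradient_flow g h `[s, t] gamma.
Proof.
move=> iI fg Is It; apply: gradient_flowS fg => r /=; rewrite in_itv /=; exact: iI Is It _.
Qed.

Lemma flow_down I gamma s t : is_interval I -> gradient_flow g f I gamma -> I s -> I t -> s <= t ->
  down g f (gamma s) (gamma t).
Proof. by move=> iI fg Is It st; apply: down_flow => //; exact: flow_sub iI fg Is It. Qed.

(** Compactness gives a cluster point; since small drops of [f] mean small distances by
    [down_modulus], it is the limit. *)
Lemma cauchy_down (F : set_system R) {FF : ProperFilter F} gamma :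
  (forall d, 0 < d -> exists2 Q, F Q & forall s t, Q s -> Q t -> s <= t ->
     down g f (gamma s) (gamma t) /\ f (gamma s) - f (gamma t) < d) ->
  exists c : M, gamma @ F --> c.
Proof.
move=> H; have [c [_ cc]] := compactM (fmap_proper_filter gamma FF) filterT.
exists c; apply/cvg_app_entourageP => A entA; pose B := split_ent A.
have entB : entourage B by exact: entourage_split_ent.
have entB' : entourage (B `&` B^-1%relation) by apply: filterI => //; exact: entourage_inv.
have [d d0 Hd] := down_modulus compactM hausM mf entB'.
have [Q FQ HQ] := H d d0.
have HB s t : Q s -> Q t -> B (gamma s, gamma t).
  move=> Qs Qt; have [st|/ltW ts] := leP s t.
    by have [D drop] := HQ s t Qs Qt st; have [] := Hd _ _ D drop.
  by have [D drop] := HQ t s Qt Qs ts; have [] := Hd _ _ D drop.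
have FQ' : F (gamma @^-1` (gamma @` Q)) by apply: filterS FQ => s Qs; exists s.
have [_ [[t Qt <-] Bt]] := cc _ _ FQ' (nbhs_entourage c entB).
apply: filterS FQ => s Qs; rewrite /xsection /= inE in Bt.
exact: entourage_split Bt (HB _ _ Qt Qs).
Qed.

(** Near a noncritical limit the flow could stay only for a time less than [T], whereas it stays
    there for arbitrarily long times. *)
Lemma critical_cvg (F : set_system R) {FF : ProperFilter F} I gamma c :
  is_interval I -> gradient_flow g f I gamma -> gamma @ F --> c ->
  (forall W T, F W -> 0 < T -> exists s t, [/\ I s, I t, s <= t, T <= t - s &
     forall r, s <= r <= t -> W r]) -> critical g f c.
Proof.
move=> iI fg gc H; apply: contrapT => /(noncritical_escape sf)[W [T [nW T0 HW]]].
have [s [t [Is It st Tst Hr]]] := H _ T (gc _ nW) T0.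
by have := HW _ _ _ (flow_sub iI fg Is It) st Hr; rewrite ltNge Tst.
Qed.

Lemma is_interval_itv (i : interval R) : is_interval [set` i].
Proof. exact: interval_is_interval. Qed.

Lemma critical_cvg_ninfty s0 gamma c : gradient_flow g f `]-oo, s0] gamma ->
  gamma s @[s --> -oo] --> c -> critical g f c.
Proof.
move=> fg gc; apply: critical_cvg (@is_interval_itv _) fg gc _ => W T [B [_ HB]] T0.
pose t := Num.min (B - 1) s0; exists (t - T), t.
split; rewrite /= ?in_itv /= ?ge_min ?lexx ?orbT; try lra.
- have : t <= s0 by rewrite /t ge_min lexx orbT.
  lra.
- move=> r /andP[_ rt]; apply: HB; have : t <= B - 1 by rewrite /t ge_min lexx.
  lra.
Qed.

Lemma critical_cvg_pinfty s0 gamma c : gradient_flow g f `[s0, +oo[ gamma ->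
  gamma s @[s --> +oo] --> c -> critical g f c.
Proof.
move=> fg gc; apply: critical_cvg (@is_interval_itv _) fg gc _ => W T [B [_ HB]] T0.
pose t := Num.max (B + 1) s0; exists t, (t + T).
have t1 : s0 <= t by rewrite /t le_max lexx orbT.
have t2 : B + 1 <= t by rewrite /t le_max lexx.
split; rewrite /= ?in_itv /= ?andbT; try lra.
by move=> r /andP[tr _]; apply: HB; lra.
Qed.

(** Backwards in time [f] increases to a finite supremum, so that drops between early times are
    small. *)
Lemma flow_cvg_ninfty s0 gamma : gradient_flow g f `]-oo, s0] gamma ->
  exists2 c, critical g f c & gamma s @[s --> -oo] --> c.
Proof.
move=> fg; have [m [m' Hm]] := f_bounds.
have D s t : s <= t -> t <= s0 -> down g f (gamma s) (gamma t).
  by move=> st ts; apply: (flow_down (@is_interval_itv _) fg _ _ st); rewrite /= in_itv //= (le_trans st).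
suff [c gc] : exists c : M, gamma s @[s --> -oo] --> c.
  by exists c => //; exact: critical_cvg_ninfty fg gc.
apply: cauchy_down => d d0.
pose E := [set f (gamma s) | s in `]-oo, s0]].
have supE : has_sup E.
  split; first by exists (f (gamma s0)), s0 => //; rewrite /= in_itv /=.
  by exists m' => _ [s _ <-]; case/andP: (Hm (gamma s)).
have [_ [s1 s1s0 <-] h1] := sup_adherent d0 supE.
rewrite /= in_itv /= in s1s0.
exists [set s | s <= s1]; first by apply: nbhs_ninfty_le; exact: num_real.
move=> s t /= ss ts st; split; first by apply: D => //; exact: le_trans ts s1s0.
have h2 : f (gamma s) <= sup E.
  by apply: ub_le_sup; [case: supE|exists s => //; rewrite /= in_itv /= (le_trans ss)].
have [h3 _] := D t s1 ts s1s0.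
by move: h1 h2 h3; move: (f _) (f _) (f _) (sup E) => x y z w; lra.
Qed.

Lemma flow_cvg_pinfty s0 gamma : gradient_flow g f `[s0, +oo[ gamma ->
  exists2 c, critical g f c & gamma s @[s --> +oo] --> c.
Proof.
move=> fg; have [m [m' Hm]] := f_bounds.
have D s t : s <= t -> s0 <= s -> down g f (gamma s) (gamma t).
  by move=> st ts; apply: (flow_down (@is_interval_itv _) fg _ _ st); rewrite /= in_itv /= andbT// (le_trans ts).
suff [c gc] : exists c : M, gamma s @[s --> +oo] --> c.
  by exists c => //; exact: critical_cvg_pinfty fg gc.
apply: cauchy_down => d d0.
pose E := [set f (gamma s) | s in `[s0, +oo[].
have infE : has_inf E.
  split; first by exists (f (gamma s0)), s0 => //; rewrite /= in_itv /= lexx.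
  by exists m => _ [s _ <-]; case/andP: (Hm (gamma s)).
have [_ [s1 s1s0 <-] h1] := inf_adherent d0 infE.
rewrite /= in_itv /= andbT in s1s0.
exists [set s | s1 <= s]; first by apply: nbhs_pinfty_ge; exact: num_real.
move=> s t /= ss ts st; split; first by apply: D => //; exact: le_trans s1s0 ss.
have h2 : inf E <= f (gamma t).
  by apply: ge_inf; [case: infE|exists t => //; rewrite /= in_itv /= andbT (le_trans s1s0)].
have [h3 _] := D s1 s ss s1s0.
by move: h1 h2 h3; move: (f _) (f _) (f _) (inf E) => x y z w; lra.
Qed.

Lemma down_ninfty s0 gamma c s : gradient_flow g f `]-oo, s0] gamma ->
  gamma s @[s --> -oo] --> c -> s <= s0 -> down g f c (gamma s).
Proof.
move=> fg gc ss0; apply: (down_lim (F := -oo) cf gc (cvg_cst (gamma s))).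
near=> t; have ts : t <= s by near: t; apply: nbhs_ninfty_le; exact: num_real.
by apply: (flow_down (@is_interval_itv _) fg _ _ ts); rewrite /= in_itv //= (le_trans ts).
Unshelve. all: by end_near. Qed.

Lemma down_pinfty s0 gamma c s : gradient_flow g f `[s0, +oo[ gamma ->
  gamma s @[s --> +oo] --> c -> s0 <= s -> down g f (gamma s) c.
Proof.
move=> fg gc ss0; apply: (down_lim (F := +oo) cf (cvg_cst (gamma s)) gc).
near=> t; have st : s <= t by near: t; apply: nbhs_pinfty_ge; exact: num_real.
by apply: (flow_down (@is_interval_itv _) fg _ _ st); rewrite /= in_itv /= andbT// (le_trans ss0).
Unshelve. all: by end_near. Qed.

Lemma gradient_flow_shift (h : M -> R) (I : set R) gamma s0 : gradient_flow g h I gamma ->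
  gradient_flow g h [set s | I (s + s0)] (fun s => gamma (s + s0)).
Proof.
have cshift t : (fun s : R => s + s0) @ (nbhs t) --> t + s0.
  by apply: cvgD; [exact: cvg_id|exact: cvg_cst].
have dshift t : (fun s : R => s + s0) @ t^' --> (t + s0)^'.
  move=> A; rewrite /dnbhs /within /= => HA.
  by have := cshift t _ HA; apply: (@filterS _ (nbhs t)) => s /= + st; apply; rewrite (inj_eq (addIr s0)).
move=> [/subspace_continuousP cg dg]; split.
  apply/subspace_continuousP => t It A HA.
  have := cg _ It A HA; change (within I (nbhs (t + s0)) (gamma @^-1` A) ->
    within [set s | I (s + s0)] (nbhs t) ((fun s => gamma (s + s0)) @^-1` A)).
  by rewrite /within /= => /(cshift t).
move=> t c It ac ct.
have := dg _ c It ac ct => H A /H.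
change (within I (t + s0)^' ((fun s => (s - (t + s0))^-1 *: (cmap c (gamma s) - cmap c (gamma (t + s0)))) @^-1` A) ->
  within [set s | I (s + s0)] t^' ((fun s => (s - t)^-1 *: (cmap c (gamma (s + s0)) - cmap c (gamma (t + s0)))) @^-1` A)).
rewrite /within /= => /(dshift t); apply: (@filterS _ (t^')) => s /= + Is.
by move=> /(_ Is); rewrite opprD addrACA subrr addr0.
Qed.

End Ends.

(** * Broken trajectories *)

Section Paths.
Context {R : realType} {n : nat} {M : uniformType} {g : riemannian R n M}.
Context (compactM : compact [set: M]) (hausM : hausdorff_space M).
Context (f : M -> R) (mf : morse g f).
Implicit Types (gamma : R -> M) (P Q : set M) (s t r : R).

Let sf : smooth g f := mf.1.
Let cf : continuous f := smooth_continuous sf.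

(** A descending path as a mere set of points. By [dpath_inj] and the last clause, [f] maps it
    bijectively onto [[f b, f a]], so that it has just one parametrization by [f]. *)
Definition dpath P (a b : M) : Prop := [/\ P a, P b,
  forall p, P p -> down g f a p /\ down g f p b,
  forall p q, P p -> P q -> down g f p q \/ down g f q p
  & forall r, f b <= r <= f a -> exists2 p, P p & f p = r].

Lemma dpath_down P a b : dpath P a b -> down g f a b.
Proof. by move=> [Pa Pb H _ _]; have [_] := H a Pa. Qed.

Lemma dpath_inj P a b p q : dpath P a b -> P p -> P q -> f p = f q -> p = q.
Proof.
move=> [_ _ _ H _] Pp Pq e; have [D|D] := H p q Pp Pq.
  exact: (down_eq compactM hausM mf D).
exact/esym/(down_eq compactM hausM mf D).
Qed.

Lemma dpath_itv P a b p : dpath P a b -> P p -> f b <= f p <= f a.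
Proof. by move=> [_ _ H _ _] /H[[-> _] [-> _]]. Qed.

Lemma dpath1 a : dpath [set a] a a.
Proof.
split => //; first by move=> p ->; split; exact: down_refl.
  by move=> p q -> ->; left; exact: down_refl.
by move=> r; exists a => //; apply: le_anti.
Qed.

(** The pieces meet at a critical point, where [down] can be composed. *)
Lemma dpath_cat P Q a b c : critical g f b -> dpath P a b -> dpath Q b c -> dpath (P `|` Q) a c.
Proof.
move=> cb dP dQ; have Dab := dpath_down dP; have Dbc := dpath_down dQ.
case: dP dQ => Pa Pb HP HP' cP [Qb Qc HQ HQ' cQ]; split; [by left|by right| | |].
- move=> p [Pp|Qp].
    have [Dap Dpb] := HP _ Pp; split => //; exact: down_trans cb Dpb Dbc.
  have [Dbp Dpc] := HQ _ Qp; split => //; exact: down_trans cb Dab Dbp.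
- move=> p q [Pp|Qp] [Pq|Qq].
  + exact: HP'.
  + by left; apply: down_trans cb _ _; [case: (HP _ Pp)|case: (HQ _ Qq)].
  + by right; apply: down_trans cb _ _; [case: (HP _ Pq)|case: (HQ _ Qp)].
  + exact: HQ'.
- move=> r /andP[cr ra]; have [rb|/ltW br] := leP r (f b).
    by have [|p Qp fp] := cQ r; [rewrite cr|exists p => //; right].
  by have [|p Pp fp] := cP r; [rewrite br|exists p => //; left].
Qed.

Lemma flow_ivt I gamma s t r : is_interval I -> gradient_flow g f I gamma -> I s -> I t -> s <= t ->
  f (gamma t) <= r <= f (gamma s) -> exists2 q, s <= q <= t & f (gamma q) = r.
Proof.
move=> iI fg Is It st /andP[tr rs].
have [||q] := @IVT R (f \o gamma) s t r st.
- by apply: flow_within_continuous; [exact: sf|exact: flow_sub iI fg Is It].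
- by rewrite ge_min le_max /= tr rs orbT.
by rewrite in_itv /= => qst fq; exists q.
Qed.

Lemma dpath_half_in c x gamma : in_flow g f c x gamma -> dpath (c |` range gamma) c x.
Proof.
move=> [fg gx gc].
have g0 s : gamma s = gamma (Num.min s 0).
  by case: leP => // /ltW s0; rewrite !gx.
have s0 s : Num.min s 0 <= 0 :> R by rewrite ge_min lexx orbT.
have D s t : s <= t -> t <= 0 -> down g f (gamma s) (gamma t).
  by move=> st ts; apply: (flow_down mf (@is_interval_itv _ _) fg _ _ st); rewrite /= in_itv //= (le_trans st).
have gmin s t : s <= t -> Num.min s 0 <= Num.min t 0 :> R.
  by move=> st; rewrite le_min !ge_min st lexx orbT.
have Dc s : down g f c (gamma s) by rewrite g0; exact: down_ninfty fg gc (s0 s).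
have Dx s : down g f (gamma s) x by rewrite g0 -(gx 0 (lexx 0)); exact: D.
have Dcx : down g f c x by rewrite -(gx 0 (lexx 0)).
split; [by left|by right; exists 0 => //; exact: gx| | |].
- by move=> p [->|[s _ <-]]; split => //; exact: down_refl.
- move=> p q [->|[s _ <-]] [->|[t _ <-]]; [by left; exact: down_refl|by left|by right|].
  rewrite (g0 s) (g0 t); have [st|/ltW st] := leP s t; [left|right]; apply: D => //; exact: gmin.
- move=> r /andP[xr]; rewrite le_eqVlt => /predU1P[->|rc]; first by exists c => //; left.
  have : \forall s \near -oo, r < f (gamma s) /\ s <= 0.
    apply: filterI; last by apply: nbhs_ninfty_le; exact: num_real.
    by apply: (gc [set y | r < f y]); exact: (cf (x := c) (lt_nbhsr rc)).
  move=> /filter_ex[s [rs ss0]].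
  have [||||q _ fq] := @flow_ivt _ gamma s 0 r (@is_interval_itv _ _) fg.
  + by rewrite /= in_itv.
  + by rewrite /= in_itv /= lexx.
  + by [].
  + by rewrite gx// xr ltW.
  by exists (gamma q) => //; right; exists q.
Qed.

Lemma dpath_half_out c x gamma : out_flow g f x c gamma -> dpath (c |` range gamma) x c.
Proof.
move=> [fg gx gc].
have g0 s : gamma s = gamma (Num.max s 0).
  by case: leP => // s0; rewrite !gx.
have s0 s : 0 <= Num.max s 0 :> R by rewrite le_max lexx orbT.
have D s t : s <= t -> 0 <= s -> down g f (gamma s) (gamma t).
  by move=> st ts; apply: (flow_down mf (@is_interval_itv _ _) fg _ _ st); rewrite /= in_itv /= andbT// (le_trans ts).
have gmax s t : s <= t -> Num.max s 0 <= Num.max t 0 :> R.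
  by move=> st; rewrite ge_max !le_max st lexx orbT.
have Dc s : down g f (gamma s) c by rewrite g0; exact: down_pinfty fg gc (s0 s).
have Dx s : down g f x (gamma s) by rewrite g0 -(gx 0 (lexx 0)); exact: D.
have Dcx : down g f x c by rewrite -(gx 0 (lexx 0)).
split; [by right; exists 0 => //; exact: gx|by left| | |].
- by move=> p [->|[s _ <-]]; split => //; exact: down_refl.
- move=> p q [->|[s _ <-]] [->|[t _ <-]]; [by left; exact: down_refl|by right|by left|].
  rewrite (g0 s) (g0 t); have [st|/ltW st] := leP s t; [left|right]; apply: D => //; exact: gmax.
- move=> r /andP[]; rewrite le_eqVlt => /predU1P[<- _|cr rx]; first by exists c => //; left.
  have : \forall s \near +oo, f (gamma s) < r /\ 0 <= s.
    apply: filterI; last by apply: nbhs_pinfty_ge; exact: num_real.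
    by apply: (gc [set y | f y < r]); exact: (cf (x := c) (lt_nbhsl cr)).
  move=> /filter_ex[s [rs ss0]].
  have [||||q _ fq] := @flow_ivt _ gamma 0 s r (@is_interval_itv _ _) fg.
  + by rewrite /= in_itv /= lexx.
  + by rewrite /= in_itv /= andbT.
  + by [].
  + by rewrite (gx 0 (lexx 0)) rx andbT ltW.
  by exists (gamma q) => //; right; exists q.
Qed.

Lemma is_intervalT : is_interval [set: R]. Proof. by []. Qed.

Lemma trajectory_critical a b gamma : trajectory g f a b gamma -> critical g f a /\ critical g f b.
Proof.
move=> [fg ga gb]; split.
  by apply: (critical_cvg_ninfty mf _ ga (s0 := 0)); exact: gradient_flowS fg.
by apply: (critical_cvg_pinfty mf _ gb (s0 := 0)); exact: gradient_flowS fg.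
Qed.

Lemma dpath_trajectory a b gamma : trajectory g f a b gamma -> dpath ([set a; b] `|` range gamma) a b.
Proof.
move=> tr; have [ca cb] := trajectory_critical tr; case: tr => fg ga gb.
have Da s : down g f a (gamma s).
  by apply: (down_ninfty mf _ ga (lexx s)); exact: gradient_flowS fg.
have Db s : down g f (gamma s) b.
  by apply: (down_pinfty mf _ gb (lexx s)); exact: gradient_flowS fg.
have Dab : down g f a b.
  by apply: (down_lim (F := +oo) cf (cvg_cst a) gb); near=> s; exact: Da.
have D s t : s <= t -> down g f (gamma s) (gamma t).
  by move=> st; exact: (flow_down mf is_intervalT fg _ _ st).
split; [by left; left|by left; right| | |].
- by move=> p [[]->|[s _ <-]]; split => //; exact: down_refl.
- move=> p q [[]->|[s _ <-]] [[]->|[t _ <-]]; try by [left; exact: down_refl|left|right].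
  by have [st|/ltW st] := leP s t; [left|right]; exact: D.
- move=> r /andP[]; rewrite le_eqVlt => /predU1P[<- _|cr]; first by exists b => //; left; right.
  rewrite le_eqVlt => /predU1P[->|rx]; first by exists a => //; left; left.
  have [s rs] : exists s, f (gamma s) < r.
    by apply: (filter_ex (F := +oo)); apply: (gb [set y | f y < r]); exact: (cf (x := b) (lt_nbhsl cr)).
  have [t rt] : exists s, r < f (gamma s).
    by apply: (filter_ex (F := -oo)); apply: (ga [set y | r < f y]); exact: (cf (x := a) (lt_nbhsr rx)).
  have ts : t <= s.
    by rewrite leNgt; apply/negP => /ltW /D[h _]; move: h rs rt; move: (f _) (f _) => y z; lra.
  have [//|q _ fq] := flow_ivt is_intervalT fg I I ts (r := r); first by rewrite !ltW.
  by exists (gamma q) => //; right; exists q.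
Unshelve. all: by end_near. Qed.

Lemma broken_critical a b l : critical g f a -> broken g f a b l -> critical g f b.
Proof. by elim: l a => [|[c L] l IH] a /= ca; [move=> <-|move=> [_ cc _ /IH]; apply]. Qed.

Lemma broken_points_cons c L l : broken_points ((c, L) :: l) =
  ([set c] `|` [set x | exists2 gamma, L gamma & range gamma x]) `|` @broken_points R M l.
Proof.
apply/seteqP; split => x.
- move=> [cL [<-|incL]] [->|H]; [by left; left|by left; right|by right; exists cL => //; left|].
  by right; exists cL => //; right.
- move=> [[->|H]|[cL incL H]]; [by exists (c, L); [left|left]|by exists (c, L); [left|right]|].
  by exists cL => //; right.
Qed.

Lemma flow_line_range a b L gamma : trajectory g f a b gamma ->
  L = [set (fun s => gamma (s + t)) | t in [set: R]] ->
  [set x | exists2 gamma, L gamma & range gamma x] = range gamma.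
Proof.
move=> _ ->; apply/seteqP; split => x.
  by move=> [_ [t _ <-] [s _ <-]]; exists (s + t).
move=> [s _ <-]; exists gamma; last by exists s.
by exists 0 => //; apply/funext => r; rewrite addr0.
Qed.

Lemma dpath_broken a b l : critical g f a -> broken g f a b l -> dpath (a |` broken_points l) a b.
Proof.
elim: l a => [|[c L] l IH] a /= ca.
  move=> <-; rewrite (_ : broken_points [::] = set0) ?setU0; first exact: dpath1.
  by apply/seteqP; split => // x [].
move=> [_ cc [gamma tr eL] /(IH _ cc) dQ]; rewrite broken_points_cons (flow_line_range tr eL).
have := dpath_cat cc (dpath_trajectory tr) dQ.
congr (dpath _ _ _); apply/seteqP; split => x.
  by move=> [[[->|->]|?]|[->|?]]; [left|right; left; left|right; left; right|right; left; left|right; right].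
by move=> [->|[[->|?]|?]]; [left; left; left|left; left; right|left; right|right; right].
Qed.

(** Serves to take limits pointwise: a point is followed through the entire flow line on which it
    lies, whatever the number of breaks and the position among them. *)
Lemma broken_local a b l p : critical g f a -> broken g f a b l -> (a |` broken_points l) p ->
  critical g f p \/ exists gamma, [/\ gradient_flow g f setT gamma, gamma 0 = p &
    forall s, (a |` broken_points l) (gamma s)].
Proof.
elim: l a => [|[c L] l IH] a ca /=.
  by move=> _ [->|[? []]]; left.
move=> [_ cc [gamma tr eL] br]; rewrite broken_points_cons (flow_line_range tr eL).
move=> [->|[[->|[s _ <-]]|Hp]]; [by left|by left| |].
- right; exists (fun r => gamma (r + s)); split; last by move=> r; right; left; right; exists (r + s).
    by case: tr => fg _ _; exact: gradient_flow_shift fg.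
  by rewrite add0r.
- have [||[gamma' [fg g0 gP]]] := IH c cc br; [by right|by left|right].
  exists gamma'; split => // r; have [->|?] := gP r; [by right; left; left|by right; right].
Qed.

End Paths.
Arguments dpath {R n M} g f P a b.

(** * Cutting a path at its critical points *)

Lemma within_setT (T : Type) (F : set_system T) : within setT F = F.
Proof.
apply/funext => A; rewrite /within /=; congr F.
by apply/funext => x; apply/propext; split => [|h _]; [apply|].
Qed.

Section Cut.
Context {R : realType} {n : nat} {M : uniformType} {g : riemannian R n M}.
Context (compactM : compact [set: M]) (hausM : hausdorff_space M).
Context (f : M -> R) (mf : morse g f).
Implicit Types (gamma : R -> M) (s t r : R).

Let sf : smooth g f := mf.1.
Let cf : continuous f := smooth_continuous sf.

Lemma critical_finite : finite_set [set x | critical g f x].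
Proof.
have /compact_near_coveringP := compactM.
(* The filter of properties shared by all large enough finite sets [D]. Near each point there is at
   most one critical point, so that along this filter [D] contains it. *)
pose F : set_system (set M) := fun S => exists2 D0, finite_set D0 & forall D, finite_set D -> D0 `<=` D -> S D.
have FF : Filter F.
  split; first by exists set0.
  - move=> S S' [D fD HD] [D' fD' HD']; exists (D `|` D'); first by rewrite finite_setU.
    by move=> E fE sE; split; [apply: HD|apply: HD'] => // x Dx; apply: sE; [left|right].
  - by move=> S S' SS' [D fD HD]; exists D => // E fE sE; apply: SS'; exact: HD.
move=> /(_ (set M) F (fun D x => critical g f x -> D x) FF) H.
have [|D fD HD] := H.
  move=> x _; have [c [ac cx iso]] := chart_isolated x mf.
  exists ([set y | cdom c y /\ (critical g f y -> y = x)], [set D : set M | D x]); first split => /=.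
  - have h1 : \forall y \near x, (forall i, partial i (in_chart f c) (cmap c y) = 0) ->
        cmap c y = cmap c x := cmap_cont cx iso.
    have h2 := nbhs_cdom cx.
    apply: filterS2 h1 h2 => y h1 cy; split => // cry.
    rewrite -(cmapK cy) h1 ?cmapK// => i; exact: cry.
  - by exists [set x] => // D fD; apply.
  - by move=> [y D] /= [[cy h] Dx] /h ->.
apply: (@sub_finite_set _ _ D) => // x cx; exact: HD fD _ x I cx.
Qed.

Lemma flowT_continuous h gamma : gradient_flow g h setT gamma -> continuous gamma.
Proof. by move=> fg t; have := gradient_flow_cvg fg (I : setT t); rewrite within_setT. Qed.

(** At a critical point both the flow line and the constant map have velocity 0, so that passing
    from one to the other there preserves the equation. *)
Lemma critical_slope gamma (rho : R -> R) :
  gradient_flow g f setT gamma -> continuous rho ->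
  (forall t, (\forall s \near t, rho s = s) \/
    critical g f (gamma (rho t)) /\ \forall s \near t, rho s = rho t \/ rho s = s /\ rho t = t) ->
  gradient_flow g f setT (gamma \o rho).
Proof.
move=> fg crho H; have cg := flowT_continuous fg; split.
  by apply: continuous_subspaceT => t; apply: continuous_comp; [exact: crho|exact: cg].
move=> t c _ ac ct; have dg := fg.2 (rho t) c I ac ct.
rewrite within_setT in dg; rewrite within_setT.
have [near_id|[cr near_t]] := H t.
  have e := nbhs_singleton near_id; move: dg; rewrite /= e; apply: cvg_trans; apply: near_eq_cvg.
  by apply: filterS (nbhs_dnbhs near_id) => s /= ->.
rewrite (critical_gradient ac ct cr) oppr0 in dg *.
apply/cvgrPdist_lt => e e0.
have [rt|rt] := eqVneq (rho t) t; last first.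
  near=> s => /=; have [->|[_ ert]] : rho s = rho t \/ rho s = s /\ rho t = t by near: s; exact: nbhs_dnbhs.
    by rewrite subrr scaler0 subrr normr0.
  by rewrite ert eqxx in rt.
rewrite rt in dg; move/cvgrPdist_lt : dg => /(_ e e0) dg.
apply: filterS2 dg (nbhs_dnbhs near_t) => s h /= [->|[es _]].
  by rewrite subrr scaler0 subrr normr0.
by rewrite es rt.
Unshelve. all: by end_near. Qed.

(* Stopping a flow line at a critical point on it gives a flow line: this replaces the uniqueness of solutions. *)
Lemma cut_left gamma s1 : gradient_flow g f setT gamma -> critical g f (gamma s1) ->
  gradient_flow g f setT (fun s => gamma (Num.max s s1)).
Proof.
move=> fg cr; apply: (critical_slope (rho := fun s => Num.max s s1)) => //.
  by move=> t; apply: continuous_max; [exact: cvg_id|exact: cvg_cst].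
move=> t; have [ts|ts|ts] := ltgtP t s1.
- right; split => //; near=> s; left; apply/max_idPr/ltW; near: s; exact: lt_nbhsl.
- left; near=> s; apply/max_idPl/ltW; near: s; exact: lt_nbhsr.
- right; split; first by rewrite ts.
  by near=> s; rewrite -ts; case: (leP s t); [left|right].
Unshelve. all: by end_near. Qed.

Lemma cut_right gamma s1 : gradient_flow g f setT gamma -> critical g f (gamma s1) ->
  gradient_flow g f setT (fun s => gamma (Num.min s s1)).
Proof.
move=> fg cr; apply: (critical_slope (rho := fun s => Num.min s s1)) => //.
  by move=> t; apply: continuous_min; [exact: cvg_id|exact: cvg_cst].
move=> t; have [ts|ts|ts] := ltgtP t s1.
- left; near=> s; apply/min_idPl/ltW; near: s; exact: lt_nbhsl.
- right; split => //; near=> s; left; apply/min_idPr/ltW; near: s; exact: lt_nbhsr.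
- right; split; first by rewrite ts.
  by near=> s; rewrite -ts; case: (leP s t); [right|left].
Unshelve. all: by end_near. Qed.

Section Segment.
Context (k : R -> M) (ck : continuous k) (b a : R).
Context (nocr : forall r, b < r < a -> ~ critical g f (k r)).

(** If [gamma] attains the level [a] at some [s1 <= 0], it is at the critical point [k a] and is
    stopped there. Otherwise its limit at [-oo] is a critical point of the path at a level in []b,
    a]], which can only be [k a]. *)
Lemma segment_left gamma : critical g f (k a) -> gradient_flow g f setT gamma -> b < f (gamma 0) < a ->
  (forall s, b <= f (gamma s) <= a -> gamma s = k (f (gamma s))) ->
  exists gamma', [/\ gradient_flow g f setT gamma', forall s, 0 <= s -> gamma' s = gamma s,
    gamma' s @[s --> -oo] --> k a &
    forall s, s <= 0 -> f (gamma 0) <= f (gamma' s) <= a /\ gamma' s = k (f (gamma' s))].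
Proof.
move=> ca fg /andP[b0 a0] gk.
have D s t : s <= t -> f (gamma t) <= f (gamma s).
  by move=> st; apply: (flow_noninc sf _ st); exact: gradient_flowS fg.
have [[s [s0 sa]]|H] := pselect (exists s, s <= 0 /\ a <= f (gamma s)).
  have [|s1 /andP[ss1 s10] fs1] := flow_ivt mf is_intervalT fg I I s0 (r := a).
    by rewrite sa (ltW a0).
  have ks1 : gamma s1 = k a by rewrite gk fs1// lexx andbT ltW// (lt_trans b0).
  exists (fun s => gamma (Num.max s s1)); split.
  - by apply: cut_left => //; rewrite ks1.
  - by move=> t t0; rewrite (max_idPl (le_trans s10 t0)).
  - rewrite -ks1; apply: (@cvg_trans _ (gamma s1 @[_ --> -oo])); last exact: cvg_cst.
    apply: near_eq_cvg; near=> t; have ts1 : t <= s1; last by rewrite (max_idPr ts1).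
    by near: t; apply: nbhs_ninfty_le; exact: num_real.
  - move=> t t0; set q := Num.max t s1.
    have fq : f (gamma 0) <= f (gamma q) <= a.
      by rewrite -fs1 !D// /q ?ge_max ?t0// le_max lexx orbT.
    by split => //; apply: gk; case/andP: fq => h ->; rewrite (le_trans (ltW b0)).
have {}H s : s <= 0 -> f (gamma s) < a.
  by move=> s0; rewrite ltNge; apply/negP => h; apply: H; exists s.
have Hr s : s <= 0 -> f (gamma 0) <= f (gamma s) <= a /\ gamma s = k (f (gamma s)).
  move=> s0; have h : f (gamma 0) <= f (gamma s) <= a by rewrite D//= ltW// H.
  by split => //; apply: gk; case/andP: h => h ->; rewrite (le_trans (ltW b0)).
exists gamma; split => //.
have [p cp gp] := flow_cvg_ninfty compactM hausM mf (gradient_flowS (@subsetT _ `]-oo, 0]) fg).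
have fp : f (gamma s) @[s --> -oo] --> f p by apply: cvg_comp gp _; exact: cf.
have near0 : \forall s \near -oo, s <= (0 : R) by apply: nbhs_ninfty_le; exact: num_real.
have fp0 : f (gamma 0) <= f p.
  by apply: (ler_lim (F := -oo) (cvg_cst _) fp); apply: filterS near0 => s s0; exact: D.
have fpa : f p <= a.
  by apply: (ler_lim (F := -oo) fp (cvg_cst _)); apply: filterS near0 => s s0; exact: ltW (H s s0).
have pk : p = k (f p).
  apply: (@cvg_unique _ hausM (gamma s @[s --> -oo])) => //.
  have : k (f (gamma s)) @[s --> -oo] --> k (f p) by apply: cvg_comp fp _; exact: ck.
  by apply: cvg_trans; apply: near_eq_cvg; apply: filterS near0 => s /Hr[_ <-].
move: fpa; rewrite le_eqVlt => /predU1P[<-|fpa]; first by rewrite -pk.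
by exfalso; apply: (@nocr (f p)); rewrite -?pk// (lt_le_trans b0) .
Unshelve. all: by end_near. Qed.

Lemma segment_right gamma : critical g f (k b) -> gradient_flow g f setT gamma -> b < f (gamma 0) < a ->
  (forall s, 0 <= s -> b <= f (gamma s) <= a -> gamma s = k (f (gamma s))) ->
  exists gamma', [/\ gradient_flow g f setT gamma', forall s, s <= 0 -> gamma' s = gamma s,
    gamma' s @[s --> +oo] --> k b &
    forall s, 0 <= s -> b <= f (gamma' s) <= f (gamma 0) /\ gamma' s = k (f (gamma' s))].
Proof.
move=> ca fg /andP[b0 a0] gk.
have D s t : s <= t -> f (gamma t) <= f (gamma s).
  by move=> st; apply: (flow_noninc sf _ st); exact: gradient_flowS fg.
have [[s [s0 sb]]|H] := pselect (exists s, 0 <= s /\ f (gamma s) <= b).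
  have [|s1 /andP[s10 ss1] fs1] := flow_ivt mf is_intervalT fg I I s0 (r := b).
    by rewrite sb (ltW b0).
  have ks1 : gamma s1 = k b by rewrite gk// fs1// lexx /= ltW// (lt_trans b0).
  exists (fun s => gamma (Num.min s s1)); split.
  - by apply: cut_right => //; rewrite ks1.
  - by move=> t t0; rewrite (min_idPl (le_trans t0 s10)).
  - rewrite -ks1; apply: (@cvg_trans _ (gamma s1 @[_ --> +oo])); last exact: cvg_cst.
    apply: near_eq_cvg; near=> t; have ts1 : s1 <= t; last by rewrite (min_idPr ts1).
    by near: t; apply: nbhs_pinfty_ge; exact: num_real.
  - move=> t t0; set q := Num.min t s1.
    have q0 : 0 <= q by rewrite /q le_min t0.
    have fq : b <= f (gamma q) <= f (gamma 0).
      by rewrite -fs1 !D// /q ge_min lexx orbT.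
    by split => //; apply: gk => //; case/andP: fq => -> h; rewrite (le_trans h (ltW a0)).
have {}H s : 0 <= s -> b < f (gamma s).
  by move=> s0; rewrite ltNge; apply/negP => h; apply: H; exists s.
have Hr s : 0 <= s -> b <= f (gamma s) <= f (gamma 0) /\ gamma s = k (f (gamma s)).
  move=> s0; have h : b <= f (gamma s) <= f (gamma 0) by rewrite D// andbT ltW// H.
  by split => //; apply: gk => //; case/andP: h => -> h; rewrite (le_trans h (ltW a0)).
exists gamma; split => //.
have [p cp gp] := flow_cvg_pinfty compactM hausM mf (gradient_flowS (@subsetT _ `[0, +oo[) fg).
have fp : f (gamma s) @[s --> +oo] --> f p by apply: cvg_comp gp _; exact: cf.
have near0 : \forall s \near +oo, (0 : R) <= s by apply: nbhs_pinfty_ge; exact: num_real.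
have fp0 : f p <= f (gamma 0).
  by apply: (ler_lim (F := +oo) fp (cvg_cst _)); apply: filterS near0 => s s0; exact: D.
have fpb : b <= f p.
  by apply: (ler_lim (F := +oo) (cvg_cst _) fp); apply: filterS near0 => s s0; exact: ltW (H s s0).
have pk : p = k (f p).
  apply: (@cvg_unique _ hausM (gamma s @[s --> +oo])) => //.
  have : k (f (gamma s)) @[s --> +oo] --> k (f p) by apply: cvg_comp fp _; exact: ck.
  by apply: cvg_trans; apply: near_eq_cvg; apply: filterS near0 => s /Hr[_ <-].
move: fpb; rewrite le_eqVlt => /predU1P[->|fpb]; first by rewrite -pk.
by exfalso; apply: (@nocr (f p)); rewrite -?pk// fpb (le_lt_trans fp0).
Unshelve. all: by end_near. Qed.

Lemma segment_trajectory gamma : critical g f (k a) -> critical g f (k b) ->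
  gradient_flow g f setT gamma -> b < f (gamma 0) < a ->
  (forall s, b <= f (gamma s) <= a -> gamma s = k (f (gamma s))) ->
  exists2 gamma', trajectory g f (k a) (k b) gamma' &
    forall s, b <= f (gamma' s) <= a /\ gamma' s = k (f (gamma' s)).
Proof.
move=> ca cb fg ba gk.
have [g1 [fg1 e1 l1 r1]] := segment_left ca fg ba gk.
have e10 : g1 0 = gamma 0 by rewrite e1.
have [||g2 [fg2 e2 l2 r2]] := segment_right cb fg1 _ _.
- by rewrite e10.
- by move=> s s0; rewrite e1//; exact: gk.
case/andP: ba => b0 a0; exists g2.
  split => //; apply: cvg_trans l1; apply: near_eq_cvg; near=> s.
  have s0 : s <= 0 by near: s; apply: nbhs_ninfty_le; exact: num_real.
  by rewrite e2.
move=> s; have [s0|/ltW s0] := leP s 0.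
  by rewrite e2//; have [/andP[h1 h2] h3] := r1 s s0; rewrite (le_trans (ltW b0) h1).
by have [/andP[h1 h2] h3] := r2 s s0; rewrite e10 in h2; rewrite h1 (le_trans h2 (ltW a0)).
Unshelve. all: by end_near. Qed.

End Segment.

(** Splits off the part of the path from [a] down to the next critical level [r']; the flow line
    through the point halfway spans it. The induction is on the size of a list containing the
    critical levels in [[b, a[], from which [r'] then disappears. *)
Lemma broken_exists (k : R -> M) (b a : R) : continuous k -> b <= a ->
  (forall r, b <= r <= a -> f (k r) = r) -> critical g f (k b) -> critical g f (k a) ->
  (forall r, b < r < a -> ~ critical g f (k r) -> exists gamma, [/\ gradient_flow g f setT gamma,
     gamma 0 = k r & forall s, b <= f (gamma s) <= a -> gamma s = k (f (gamma s))]) ->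
  exists l, broken g f (k a) (k b) l /\
    forall p, (k a |` broken_points l) p -> exists2 r, b <= r <= a & p = k r.
Proof.
move=> ck ba fk cb.
have /finite_seqP[l0 El0] := finite_image f critical_finite.
have : forall r, b <= r < a -> critical g f (k r) -> r \in l0.
  move=> r /andP[br ra] cr; suff : [set` l0] r by [].
  by rewrite -El0; exists (k r) => //; apply: fk; rewrite br ltW.
have [m] := ubnP (size l0); elim: m l0 {El0} a ba fk => // m IH l a ba fk lm crl ca GT.
move: ba; rewrite le_eqVlt => /predU1P[e|ba].
  exists [::]; split; first by rewrite /= e.
  by move=> p [->|[? []]]; exists a => //; rewrite e lexx.
have [r' [/andP[br' r'a] cr'] r'max] : exists2 r, b <= r < a /\ critical g f (k r) &
    forall q, b <= q < a -> critical g f (k q) -> q <= r.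
  have fE : finite_set [set r | b <= r < a /\ critical g f (k r)].
    by apply: (@sub_finite_set _ _ [set` l]) => // r [bra cr]; apply: crl.
  have [|r Er Hr] := compact_max (finite_compact fE); last by exists r => // q qba cq; apply: Hr.
  by exists b; split => //; rewrite lexx ba.
have [|||||l' [br Hl']] := IH [seq r <- l | r < r'] r' br'.
- by move=> r /andP[br rr']; apply: fk; rewrite br (le_trans rr') ?ltW.
- rewrite -ltnS (leq_trans _ lm)// ltnS size_filter -(count_predC (< r') l) -addn1 leq_add2l.
  rewrite -has_count; apply/hasP; exists r'; last by rewrite /= ltxx.
  by apply: crl => //; rewrite br' r'a.
- move=> r /andP[br rr'] cr; rewrite mem_filter rr' /=; apply: crl => //.
  by rewrite br (lt_trans rr').
- by [].
- move=> r /andP[br rr'] ncr; have [|gamma [fg g0 gk]] := GT r _ ncr.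
    by rewrite br (lt_trans rr').
  exists gamma; split => // s /andP[h1 h2]; apply: gk.
  by rewrite h1 (le_trans h2)// ltW.
have ncr r : r' < r < a -> ~ critical g f (k r).
  move=> /andP[r'r ra] cr; have := r'max r; rewrite ra (le_trans br' (ltW r'r)) => /(_ isT cr).
  by rewrite leNgt r'r.
pose r0 := (r' + a) / 2.
have [r'r0 r0a] : r' < r0 /\ r0 < a by rewrite /r0; split; lra.
have fk0 : f (k r0) = r0 by apply: fk; rewrite (ltW r0a) (le_trans br' (ltW r'r0)).
have [||gamma [fg g0 gk]] := GT r0; first by rewrite r0a (le_lt_trans br' r'r0).
  by apply: ncr; rewrite r'r0.
have fk' r : r' <= r <= a -> f (k r) = r.
  by move=> /andP[r'r ra]; apply: fk; rewrite ra (le_trans br' r'r).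
have [||gamma' tr Hg'] := segment_trajectory ck ncr ca cr' fg.
- by rewrite g0 fk0 r'r0.
- by move=> s /andP[h1 h2]; apply: gk; rewrite h2 (le_trans br' h1).
exists ((k r', [set (fun s => gamma' (s + t)) | t in [set: R]]) :: l'); split.
  split => //; last by exists gamma'.
  move=> e; have := fk' a; rewrite lexx ltW// => /(_ isT); rewrite e fk'; last by rewrite lexx ltW.
  by move=> er; rewrite er ltxx in r'a.
have Hl p : (k r' |` broken_points l') p -> exists2 r, b <= r <= a & p = k r.
  by move=> /Hl'[r /andP[h1 h2] ->]; exists r => //; rewrite h1 (le_trans h2 (ltW r'a)).
move=> p; rewrite broken_points_cons (flow_line_range tr erefl) => -[->|[[->|[s _ <-]]|Hp]].
- by exists a => //; rewrite lexx ltW.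
- by exists r' => //; rewrite br' ltW.
- have [/andP[h1 h2] h3] := Hg' s; exists (f (gamma' s)) => //.
  by rewrite h2 (le_trans br' h1).
- by apply: Hl; right.
Qed.

End Cut.

(** * Limits of edge flows, half-lines and broken trajectories *)

Lemma cvg_maxr {R : realType} (T : Type) (F : set_system T) {FF : Filter F} (u v : T -> R) (a b : R) :
  u @ F --> a -> v @ F --> b -> Num.max (u t) (v t) @[t --> F] --> Num.max a b.
Proof.
move=> ua vb; under eq_fun do rewrite maxr_absE; rewrite maxr_absE.
apply: cvgM; last exact: cvg_cst.
by apply: cvgD; [exact: cvgD|apply: cvg_norm; exact: cvgB].
Qed.

Lemma cvg_minr {R : realType} (T : Type) (F : set_system T) {FF : Filter F} (u v : T -> R) (a b : R) :
  u @ F --> a -> v @ F --> b -> Num.min (u t) (v t) @[t --> F] --> Num.min a b.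
Proof.
move=> ua vb; under eq_fun do rewrite minr_absE; rewrite minr_absE.
apply: cvgM; last exact: cvg_cst.
by apply: cvgB; [exact: cvgD|apply: cvg_norm; exact: cvgB].
Qed.

Lemma clamp_clamp {R : realType} (m b t m' r : R) : m <= b -> b <= t -> t <= m' ->
  clamp b t (clamp m m' r) = clamp b t r.
Proof.
move=> mb bt tm'; have mm' : m <= m' by rewrite (le_trans mb)// (le_trans bt).
have [rm|/ltW mr] := leP r m.
  by rewrite (clamp_le mm' rm) !clamp_le// (le_trans rm).
have [m'r|/ltW rm'] := leP m' r; last by rewrite (@clamp_id _ m m')// mr.
by rewrite (clamp_ge mm' m'r) !clamp_ge// (le_trans tm').
Qed.

Section LimitTools.
Context {R : realType} {n : nat} {M : uniformType} {g : riemannian R n M}.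
Context (compactM : compact [set: M]) (hausM : hausdorff_space M).
Context {T : Type} (V : set_system T) {UV : UltraFilter V}.
Implicit Types (s t r : R).

Lemma ultra_lim_unique (u : T -> M) (p q : M) : u @ V --> p -> u @ V --> q -> p = q.
Proof. exact: cvg_unique. Qed.

Lemma loc_unif_comp (phi : T -> R -> M) phi0 (r : T -> R) r0 : continuous phi0 ->
  loc_unif V phi phi0 -> r @ V --> r0 -> phi i (r i) @[i --> V] --> phi0 r0.
Proof.
move=> c0 lu rr; apply/cvg_app_entourageP => A entA; pose B := split_ent A.
have entB : entourage B by exact: entourage_split_ent.
have h1 : \forall r' \near r0, B (phi0 r0, phi0 r') by have /cvg_app_entourageP := @c0 r0; apply.
have {}h1 : \forall i \near V, B (phi0 r0, phi0 (r i)) := rr _ h1.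
have h2 := lu (r0 - 1) (r0 + 1) B entB.
have /cvgrPdist_lt/(_ 1 ltr01) h3 := rr.
apply: filterS3 h1 h2 h3 => i k1 k2 k3; apply: entourage_split k1 (k2 _ _) => //.
by move: k3; rewrite ltr_norml => /andP[? ?]; apply/andP; split; lra.
Qed.

(** Covers edges, half-lines, their translates and entire flow lines at once: the map is extended
    beyond [I] through a 1-Lipschitz [rho] into [I], which carries equicontinuity from [I] to the
    whole line. *)
Definition flow_data (h : M -> R) (gamma : R -> M) (I : set R) (rho : R -> R) : Prop :=
  [/\ is_interval I, gradient_flow g h I gamma, forall s, I (rho s) /\ gamma s = gamma (rho s)
    & forall s t, `|rho s - rho t| <= `|s - t|].

Lemma flow_equi (h : T -> M -> R) h0 (gamma : T -> R -> M) (I : T -> set R) (rho : T -> R -> R) :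
  smooth g h0 -> grad_conv g V h h0 ->
  (\forall i \near V, flow_data (h i) (gamma i) (I i) (rho i)) -> equi V gamma.
Proof.
move=> sh ch H A entA.
have entA' : entourage (A `&` A^-1%relation) by apply: filterI => //; exact: entourage_inv.
have [tau tau0 HV] := uniform_speed compactM hausM sh ch entA'; exists tau => //.
apply: filterS2 H HV => i [iI fg rI lip] HA s t st.
rewrite (rI s).2 (rI t).2; have lst := le_lt_trans (lip s t) st.
have [rr|/ltW rr] := leP (rho i s) (rho i t).
  have [] := HA _ _ _ (flow_sub iI fg (rI s).1 (rI t).1) rr _ => //.
  by move: lst; rewrite distrC ger0_norm// subr_ge0.
have [] := HA _ _ _ (flow_sub iI fg (rI t).1 (rI s).1) rr _ => //.
by move: lst; rewrite ger0_norm// subr_ge0.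
Qed.

Lemma edge_limit (h : T -> M -> R) h0 (len : T -> R) len0 (x y : T -> M) x0 y0 (gamma : T -> R -> M) :
  smooth g h0 -> grad_conv g V h h0 -> (forall i, 0 <= len i) -> len @ V --> len0 ->
  x @ V --> x0 -> y @ V --> y0 -> (forall i, edge_flow g (h i) (len i) (x i) (y i) (gamma i)) ->
  exists gamma0, edge_flow g h0 len0 x0 y0 gamma0 /\
    forall A, entourage A -> \forall i \near V, forall s, A (gamma0 s, gamma i s).
Proof.
move=> sh ch len_ge0 lenl xx yy ef.
have len00 : 0 <= len0.
  by apply: (ler_lim (cvg_cst (0 : R)) lenl); exact: nearW.
have gcl i s : gamma i s = gamma i (clamp 0 (len i) s).
  have [_ g0 gl] := ef i; have [s0|s0] := leP s 0; first by rewrite clamp_le// !g0.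
  have [ls|sl] := leP (len i) s; first by rewrite clamp_ge// !gl.
  by rewrite clamp_id// !ltW.
have eqg : equi V gamma.
  apply: (flow_equi (h := h) (I := fun i => `[0, len i]%classic) (rho := fun i => clamp 0 (len i)) sh ch).
  apply: nearW => i; have [fg _ _] := ef i; split => //.
  - exact: is_interval_itv.
  - by move=> s; split => //; rewrite /= in_itv /=; exact: clamp_itv.
  - by move=> s t; exact: clamp_lip.
have [gamma0 [cg lu]] := equi_limit compactM eqg.
have nl : \forall i \near V, `|len0 - len i| < 1 by have /cvgrPdist_lt := lenl; apply.
(* Eventually all lengths are below [len0 + 1], so that all motion takes place in one compact
   interval and the convergence is uniform. *)
have [||] := @loc_unif_clamp _ _ _ V _ gamma gamma0 0 (len0 + 1) _ lu _ hausM.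
- by rewrite addr_ge0.
- apply: filterS nl => i li s; have [s1|/ltW s1] := leP s (len0 + 1); last first.
    have [_ _ gl] := ef i; rewrite clamp_ge ?addr_ge0// !gl//; move: li; rewrite ltr_norml => /andP[? ?]; lra.
  have [s0|/ltW s0] := leP 0 s; first by rewrite clamp_id// s0.
  by have [_ g0 _] := ef i; rewrite clamp_le ?addr_ge0// !g0.
move=> _ unif; exists gamma0; split => //; split.
- apply: (flow_lim compactM hausM sh ch cg lu (I := fun i => `[0, len i]%classic)).
  + exact: is_interval_itv.
  + by move=> i; have [] := ef i.
  + move=> s s' t' t; rewrite /= !in_itv /= => /andP[s0 _] /andP[_ tl] ss' s't' t't.
    have e0 : 0 < t - t' by rewrite subr_gt0.
    have /cvgrPdist_lt/(_ _ e0) := lenl; apply: filterS => i; rewrite ltr_norml => /andP[h1 h2] r /=.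
    by rewrite !in_itv /= => /andP[h3 h4]; apply/andP; split; lra.
- move=> s s0; apply: (ultra_lim_unique (loc_unif_cvg (s := s) lu)).
  by apply: cvg_trans xx; apply: near_eq_cvg; apply: nearW => i; have [_ -> ] := ef i.
(* At the time [Num.max s (len i)] the value is exactly [y i], and these times tend to [s]. *)
- move=> s sl; apply: (@ultra_lim_unique (fun i => gamma i (Num.max s (len i)))).
    apply: loc_unif_comp => //; rewrite -[X in _ --> X](max_idPl sl).
    have : {for len0, continuous (fun l => Num.max s l)}.
      by apply: continuous_max; [exact: cvg_cst|exact: cvg_id].
    by move=> H; apply: cvg_comp lenl H.
  apply: cvg_trans yy; apply: near_eq_cvg; apply: nearW => i; have [_ _ ->//] := ef i.
  by rewrite le_max lexx orbT.
Unshelve. all: by end_near. Qed.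

Context (f : M -> R) (mf : morse g f).
Let sf : smooth g f := mf.1.
Let cf : continuous f := smooth_continuous sf.

Lemma grad_conv_cst : grad_conv g V (fun=> f) f.
Proof. by move=> c K _ _ _ e e0; apply: nearW => i z _; rewrite subrr normr0 ltW. Qed.

Section Concat.
Context (P : T -> set M) (top bot : T -> M) (top0 bot0 : M).
Context (dP : forall i, dpath g f (P i) (top i) (bot i)).
Context (topl : top @ V --> top0) (botl : bot @ V --> bot0).
Context (k : T -> R -> M) (kP : forall i r, P i (k i r)).
Context (fk : forall i r, f (k i r) = clamp (f (bot i)) (f (top i)) r).

Lemma concat_eq i p r : P i p -> f p = clamp (f (bot i)) (f (top i)) r -> k i r = p.
Proof. by move=> Pp fp; apply: (dpath_inj compactM hausM mf (dP i) (kP i r) Pp); rewrite fk fp. Qed.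

Lemma bot_le_top i : f (bot i) <= f (top i).
Proof. by have [] := dpath_down (dP i). Qed.

Lemma concat_id i p : P i p -> k i (f p) = p.
Proof. by move=> Pp; apply: concat_eq => //; rewrite clamp_id//; exact: dpath_itv (dP i) Pp. Qed.

(** In the parametrization by [f], the drop is at most the change of parameter; [down_modulus]
    bounds the motion uniformly in [i], however long the flow lingers near critical points. *)
Lemma concat_equi : equi V k.
Proof.
move=> A entA.
have entA' : entourage (A `&` A^-1%relation) by apply: filterI => //; exact: entourage_inv.
have [d d0 H] := down_modulus compactM hausM mf entA'; exists d => //; apply: nearW => i s t st.
have {}st : `|f (k i s) - f (k i t)| < d by rewrite !fk (le_lt_trans (clamp_lip _ _ _ _)).
have [_ _ _ /(_ _ _ (kP i s) (kP i t)) [D|D] _] := dP i.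
- by have [] := H _ _ D (le_lt_trans (ler_norm _) st).
- by rewrite distrC in st; have [] := H _ _ D (le_lt_trans (ler_norm _) st).
Qed.

(** The convergence is uniform because parameters may be clamped to a bounded interval containing
    the values of [f]. The last clause is the means of identification: whatever arises as a limit of
    points of the paths is the point of [k0] at its own level. *)
Lemma concat_limit : exists k0 : R -> M, [/\ continuous k0, loc_unif V k k0,
   forall A, entourage A -> \forall i \near V, forall r, A (k0 r, k i r),
   forall r, f (k0 r) = clamp (f bot0) (f top0) r /\ k0 r = k0 (clamp (f bot0) (f top0) r) &
   forall (p : T -> M) p0, (\forall i \near V, P i (p i)) -> p @ V --> p0 -> k0 (f p0) = p0].
Proof.
have [k0 [ck lu]] := equi_limit compactM concat_equi.
have fl (u : T -> M) p : u @ V --> p -> f (u i) @[i --> V] --> f p.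
  by move=> up; apply: cvg_comp up _; exact: cf.
have cl r : clamp (f (bot i)) (f (top i)) r @[i --> V] --> clamp (f bot0) (f top0) r.
  by apply: cvg_maxr; [exact: fl|apply: cvg_minr; [exact: fl|exact: cvg_cst]].
have [m [m' Hm]] := f_bounds compactM mf.
have [||_ unif] := @loc_unif_clamp _ _ _ V _ k k0 m m' _ lu _ hausM.
- by have /andP[h1 h2] := Hm bot0; exact: le_trans h1 h2.
- apply: nearW => i r; apply: concat_eq; first exact: kP.
  have [/andP[h1 _] /andP[_ h2]] := (Hm (bot i), Hm (top i)).
  by rewrite fk clamp_clamp//; exact: bot_le_top.
exists k0; split => //.
- move=> r; split.
    apply: (@cvg_unique _ (@Rhausdorff R) (f (k i r) @[i --> V])).
      by apply: fl; exact: loc_unif_cvg.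
    by apply: cvg_trans (cl r); apply: near_eq_cvg; apply: nearW => i; rewrite fk.
  apply: (ultra_lim_unique (loc_unif_cvg (s := r) lu)).
  apply: cvg_trans (loc_unif_comp ck lu (cl r)); apply: near_eq_cvg; apply: nearW => i.
  apply/esym/concat_eq => //; rewrite fk clamp_id//; apply: clamp_itv; exact: bot_le_top.
- move=> p p0 Pp pp; apply: (ultra_lim_unique (loc_unif_comp ck lu (fl _ _ pp))).
  by apply: cvg_trans pp; apply: near_eq_cvg; apply: filterS Pp => i /concat_id ->.
Qed.

Context (k0 : R -> M) (ck : continuous k0) (lu : loc_unif V k k0).
Context (k0P : forall (p : T -> M) p0, (\forall i \near V, P i (p i)) -> p @ V --> p0 -> k0 (f p0) = p0).

(** As the domains exhaust the line, the limit is an entire flow line; as the flow lines stay in the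
    [P i], it runs on [k0]. *)
Lemma full_limit (gamma : T -> R -> M) (I : T -> set R) (rho : T -> R -> R) r :
  (\forall i \near V, [/\ flow_data f (gamma i) (I i) (rho i), gamma i 0 = k i r &
     forall s, P i (gamma i s)]) ->
  (forall N, \forall i \near V, `[- N, N] `<=` I i) ->
  exists gamma0, [/\ gradient_flow g f setT gamma0, gamma0 0 = k0 r &
    forall s, gamma0 s = k0 (f (gamma0 s))].
Proof.
move=> H HN.
have eqg : equi V gamma.
  by apply: (flow_equi sf grad_conv_cst (I := I) (rho := rho)); apply: filterS H => i [].
have [gamma0 [cg lug]] := equi_limit compactM eqg.
exists gamma0; split.
(* [flow_lim] wants flows for all [i], while they are given only along [V]: for the other indices
   the domain is made empty. *)
- pose J i := [set s | I i s /\ gradient_flow g f (I i) (gamma i)].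
  apply: (flow_lim compactM hausM sf grad_conv_cst cg lug (I := J)) => //.
  + move=> i; have [fg|nfg] := pselect (gradient_flow g f (I i) (gamma i)).
      by apply: gradient_flowS fg => s [].
    have -> : J i = set0 by apply/seteqP; split => // s [].
    by split => //; exact: continuous_subspace0.
  + move=> s s' t' t _ _ _ _ _; apply: filterS2 (HN (Num.max `|s'| `|t'|)) H => i hN [[_ fg _ _] _ _] q /=.
    rewrite in_itv /= => /andP[h1 h2]; split => //; apply: hN.
    rewrite /= in_itv /= lerNl !le_max; apply/andP; split.
      by apply/orP; left; have := ler_norm (- s'); rewrite normrN; lra.
    by apply/orP; right; have := ler_norm t'; lra.
- apply: (ultra_lim_unique (loc_unif_cvg (s := 0) lug)).
  apply: cvg_trans (loc_unif_cvg (s := r) lu); apply: near_eq_cvg.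
  by apply: filterS H => i [_ -> _].
- move=> s; apply/esym/(k0P _ (loc_unif_cvg (s := s) lug)).
  by apply: filterS H => i [_ _].
Qed.

End Concat.
(** [concat_points] at one leaf, with its data unbundled. *)
Definition path_set (a c : M) (l : seq (M * set (R -> M))) (gamma : R -> M) : set M :=
  [set a] `|` [set c] `|` broken_points l `|` range gamma.

Lemma dpath_in a c x l gamma : critical g f a -> broken g f a c l -> in_flow g f c x gamma ->
  dpath g f (path_set a c l gamma) a x.
Proof.
move=> ca br fl; have cc := broken_critical ca br.
have := dpath_cat cc (dpath_broken mf ca br) (dpath_half_in mf fl).
congr (dpath _ _ _ _ _); rewrite /path_set; apply/seteqP; split => y.
  by move=> [[->|?]|[->|?]]; [left; left; left|left; right|left; left; right|right].
by move=> [[[->|->]|?]|?]; [left; left|right; left|left; right|right; right].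
Qed.

Lemma dpath_out a c x l gamma : critical g f c -> broken g f c a l -> out_flow g f x c gamma ->
  dpath g f (path_set a c l gamma) x a.
Proof.
move=> cc br fl; have := dpath_cat cc (dpath_half_out mf fl) (dpath_broken mf cc br).
have ac : (c |` broken_points l) a by have [] := dpath_broken mf cc br.
congr (dpath _ _ _ _ _); rewrite /path_set; apply/seteqP; split => y.
  by move=> [[->|?]|[->|?]]; [left; left; right|right|left; left; right|left; right].
move=> [[[->|->]|?]|?]; [by right|by left; left|by right; right|by left; right].
Qed.

Section HalfLimit.
Context (x : T -> M) (x0 : M) (xl : x @ V --> x0) (gamma : T -> R -> M) (c : T -> M).

(** Convergence is only locally uniform: the part of the half-lines that escapes to [-oo] is missing
    from [gamma0], whose end [c0] need not be a limit of the [c i]. It comes back as part of the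
    limit broken trajectory. *)
Lemma in_half_limit : (forall i, in_flow g f (c i) (x i) (gamma i)) ->
  exists gamma0 c0, [/\ continuous gamma0, loc_unif V gamma gamma0, critical g f c0 &
    in_flow g f c0 x0 gamma0].
Proof.
move=> fl.
have eqg : equi V gamma.
  apply: (flow_equi sf grad_conv_cst (I := fun=> `]-oo, 0]%classic) (rho := fun=> Num.min 0)).
  apply: nearW => i; have [fg g0 _] := fl i; split => //; first exact: is_interval_itv.
    move=> s; split; first by rewrite /= in_itv /= ge_min lexx.
    by case: leP => // s0; rewrite !g0.
  by move=> s t; rewrite !minEle; do 2 case: ifPn; rewrite -?ltNge => *; rewrite ler_norml;
    apply/andP; split; have := ler_norm (s - t); have := ler_norm (t - s); rewrite (distrC t s); lra.
have [gamma0 [cg lu]] := equi_limit compactM eqg.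
have fg0 : gradient_flow g f `]-oo, 0] gamma0.
  apply: (flow_lim compactM hausM sf grad_conv_cst cg lu (I := fun=> `]-oo, 0]%classic)).
  - exact: is_interval_itv.
  - by move=> i; have [] := fl i.
  - move=> s s' t' t _; rewrite /= in_itv /= => t0 _ _ t't; apply: nearW => i q /=.
    by rewrite !in_itv /= => /andP[_ qt']; rewrite (le_trans qt')// (le_trans (ltW t't)).
have [c0 cc0 gc0] := flow_cvg_ninfty compactM hausM mf fg0.
exists gamma0, c0; split => //; split => // s s0.
apply: (ultra_lim_unique (loc_unif_cvg (s := s) lu)).
by apply: cvg_trans xl; apply: near_eq_cvg; apply: nearW => i; have [_ gx _] := fl i; rewrite gx.
Qed.

Lemma out_half_limit : (forall i, out_flow g f (x i) (c i) (gamma i)) ->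
  exists gamma0 c0, [/\ continuous gamma0, loc_unif V gamma gamma0, critical g f c0 &
    out_flow g f x0 c0 gamma0].
Proof.
move=> fl.
have eqg : equi V gamma.
  apply: (flow_equi sf grad_conv_cst (I := fun=> `[0, +oo[%classic) (rho := fun=> Num.max 0)).
  apply: nearW => i; have [fg g0 _] := fl i; split => //; first exact: is_interval_itv.
    move=> s; split; first by rewrite /= in_itv /= andbT le_max lexx.
    by case: leP => // s0; rewrite !g0// ltW.
  by move=> s t; rewrite !maxEle; do 2 case: ifPn; rewrite -?ltNge => *; rewrite ler_norml;
    apply/andP; split; have := ler_norm (s - t); have := ler_norm (t - s); rewrite (distrC t s); lra.
have [gamma0 [cg lu]] := equi_limit compactM eqg.
have fg0 : gradient_flow g f `[0, +oo[ gamma0.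
  apply: (flow_lim compactM hausM sf grad_conv_cst cg lu (I := fun=> `[0, +oo[%classic)).
  - exact: is_interval_itv.
  - by move=> i; have [] := fl i.
  - move=> s s' t' t; rewrite /= in_itv /= andbT => s0 _ ss' _ _; apply: nearW => i q /=.
    by rewrite !in_itv /= andbT => /andP[s'q _]; rewrite (le_trans s0)// (le_trans (ltW ss')).
have [c0 cc0 gc0] := flow_cvg_pinfty compactM hausM mf fg0.
exists gamma0, c0; split => //; split => // s s0.
apply: (ultra_lim_unique (loc_unif_cvg (s := s) lu)).
by apply: cvg_trans xl; apply: near_eq_cvg; apply: nearW => i; have [_ gx _] := fl i; rewrite gx.
Qed.

End HalfLimit.

Lemma ultra_or (A B : T -> Prop) : (\forall i \near V, A i \/ B i) ->
  (\forall i \near V, A i) \/ \forall i \near V, B i.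
Proof.
move=> H; have [VA|VA] := in_ultra_setVsetC [set i | A i] UV; [by left|right].
by apply: filterS2 H VA => i [].
Qed.

Lemma critical_lim (p : T -> M) p0 : p @ V --> p0 -> (\forall i \near V, critical g f (p i)) ->
  critical g f p0.
Proof. move=> pp H; apply: contrapT => nc; have : nbhs p0 (~` [set x | critical g f x]).
  by apply: open_nbhs_nbhs; split => //; exact: closed_openC (critical_closed sf).
by move=> /pp /(filterI H) /filter_ex[i []]. Qed.

Lemma real_lim_bounded (t : T -> R) N : (\forall i \near V, - N <= t i <= N) ->
  exists2 t0, t @ V --> t0 & - N <= t0 <= N.
Proof.
move=> H; have := @segment_compact R (- N) N; rewrite compact_ultra => /(_ (t @ V) (ultra_map t UV)) [].
  by apply: filterS H => i; rewrite /= in_itv.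
by move=> t0 [/= + tt0]; rewrite in_itv => ?; exists t0.
Qed.

(** The limit path [k0] consists of the limit half-line below the level [f c0] and, by
    [broken_exists], of a broken trajectory above it. What has to be found is a flow line on [k0]
    through each noncritical point above that level. *)
Lemma in_limit (a : M) (x c : T -> M) x0 (gamma : T -> R -> M) (l : T -> seq (M * set (R -> M)))
  (k : T -> R -> M) : critical g f a -> x @ V --> x0 ->
  (forall i, in_flow g f (c i) (x i) (gamma i)) -> (forall i, broken g f a (c i) (l i)) ->
  (forall i r, path_set a (c i) (l i) (gamma i) (k i r)) ->
  (forall i r, f (k i r) = clamp (f (x i)) (f a) r) ->
  exists c0 gamma0 l0 k0, [/\ critical g f c0, in_flow g f c0 x0 gamma0, broken g f a c0 l0,
    forall A, entourage A -> \forall i \near V, forall r, A (k0 r, k i r) &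
    forall k' : R -> M, (forall r, path_set a c0 l0 gamma0 (k' r)) ->
      (forall r, f (k' r) = clamp (f x0) (f a) r) -> k' = k0].
Proof.
move=> ca xl fl br kP fk; pose P i := path_set a (c i) (l i) (gamma i).
have dP i : dpath g f (P i) a (x i) by apply: dpath_in => //; exact: br.
have [k0 [ck lu unif fk0 k0P]] := concat_limit dP (cvg_cst a) xl kP fk.
have [gamma0 [c0 [cg lug cc0 fl0]]] := in_half_limit xl fl.
have [fg0 g0 gc0] := fl0.
have k0a : k0 (f a) = a.
  by apply: (k0P (fun=> a) a _ (cvg_cst a)); apply: nearW => i; left; left; left.
have k0x : k0 (f x0) = x0.
  by apply: (k0P x x0 _ xl); apply: nearW => i; have [] := dP i.
have k0g s : k0 (f (gamma0 s)) = gamma0 s.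
  by apply: (k0P (gamma^~ s) _ _ (loc_unif_cvg (s := s) lug)); apply: nearW => i; right; exists s.
have fgl : f (gamma0 s) @[s --> -oo] --> f c0 by apply: cvg_comp gc0 _; exact: cf.
have k0c : k0 (f c0) = c0.
  apply: (@cvg_unique _ hausM (gamma0 s @[s --> -oo])) => //.
  have : k0 (f (gamma0 s)) @[s --> -oo] --> k0 (f c0) by apply: cvg_comp fgl _; exact: ck.
  by apply: cvg_trans; apply: near_eq_cvg; apply: nearW => s; rewrite k0g.
have fgc s : s <= 0 -> f (gamma0 s) <= f c0.
  by move=> s0; have [] := down_ninfty mf fg0 gc0 s0.
have fxa : f x0 <= f a.
  have h1 : f (x i) @[i --> V] --> f x0 by apply: cvg_comp xl _; exact: cf.
  by apply: (ler_lim h1 (cvg_cst (f a))); apply: nearW => i; have [] := dpath_down (dP i).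
have frange p : k0 (f p) = p -> f x0 <= f p <= f a.
  by move=> kp; have := (fk0 (f p)).1; rewrite kp => e; rewrite e; exact: clamp_itv.
have /andP[xc0 c0a] := frange c0 k0c.
have fkr r : f c0 <= r <= f a -> f (k0 r) = r.
  by move=> /andP[h1 h2]; rewrite (fk0 r).1 clamp_id// h2 (le_trans xc0).
have [||| l0 [br0 Hl0]] := @broken_exists R n M g compactM hausM f mf k0 (f c0) (f a) ck c0a fkr.
- by rewrite k0c.
- by rewrite k0a.
- move=> r /andP[cr ra] ncr.
  pose full i := exists gamma', [/\ gradient_flow g f setT gamma', gamma' 0 = k i r & forall s, P i (gamma' s)].
  (* The point at level [r] is critical, or on a flow line of the broken trajectory, or on the
     half-line; the ultrafilter settles which. *)
  have : \forall i \near V, (critical g f (k i r) \/ full i) \/ exists2 t, t <= 0 & k i r = gamma i t.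
    apply: nearW => i; have [[[->|->]|Hp]|[t _ <-]] := kP i r; [by left; left|by left; left; exact: broken_critical ca (br i)| |].
    - left; have [|?|[gamma' [fg' g'0 g'P]]] := broken_local ca (br i) (p := k i r).
      + by right.
      + by left.
      right; exists gamma'; split => // s; have [->|?] := g'P s; [by left; left; left|by left; right].
    - right; exists (Num.min t 0); first by rewrite ge_min lexx orbT.
      by have [_ gx _] := fl i; case: leP => // t0; rewrite !gx// ltW.
  move=> /ultra_or[/ultra_or[Hc|Hfull]|Hhalf].
  - by exfalso; apply: ncr; apply: critical_lim Hc; exact: loc_unif_cvg lu.
  - have /boolp.choice[gam Hgam] : forall i, exists gamma' : R -> M, full i ->
        [/\ gradient_flow g f setT gamma', gamma' 0 = k i r & forall s, P i (gamma' s)].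
      move=> i; have [[gamma' H]|nf] := pselect (full i); first by exists gamma'.
      by exists (gamma i).
    have [||gam0 [h1 h2 h3]] := full_limit lu k0P (gamma := gam) (I := fun=> setT) (rho := fun=> id) (r := r).
    + by apply: filterS Hfull => i /Hgam[h1 h2 h3].
    + by move=> N; apply: nearW => i.
    by exists gam0; split => // s _.
  - have /boolp.choice[t Ht] : forall i, exists t : R, (exists2 t, t <= 0 & k i r = gamma i t) ->
        t <= 0 /\ k i r = gamma i t.
      move=> i; have [[t H1 H2]|nf] := pselect (exists2 t, t <= 0 & k i r = gamma i t); first by exists t.
      by exists 0.
    have {Hhalf}Ht : \forall i \near V, t i <= 0 /\ k i r = gamma i (t i) by apply: filterS Hhalf => i /Ht.
    (* If the times tend to [-oo], the half-lines translated so as to pass through [k i r] at time 0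
       exhaust the line and converge to a flow line. If not, the times are bounded, and the limit
       point lies on [gamma0], at a level at most [f c0 < r]. *)
    have [HN|/existsNP[N HN]] := pselect (forall N, \forall i \near V, t i <= - N).
      have [||gam0 [h1 h2 h3]] := full_limit lu k0P (gamma := fun i s => gamma i (s + t i))
        (I := fun i => [set s | s + t i <= 0]) (rho := fun i s => Num.min (s + t i) 0 - t i) (r := r).
      + apply: filterS Ht => i [ti0 kr]; have [fg gx _] := fl i; split.
        * split.
          - by move=> p q /= p0 q0 s /andP[ps sq]; rewrite (le_trans _ q0)// lerD2r.
          - by have := gradient_flow_shift (t i) fg; congr (gradient_flow _ _ _ _).
          - move=> s /=; rewrite subrK ge_min lexx orbT; split => //.
            by case: leP => // s0; rewrite !gx// ltW.
          - move=> p q; rewrite opprB addrA subrK; have := lexx (`|p - q|).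
            have {1}-> : p - q = (p + t i) - (q + t i) by ring.
            move: (p + t i) (q + t i) => u v; rewrite !minEle; do 2 case: ifPn; rewrite -?ltNge => *; rewrite ler_norml;
            apply/andP; split; have := ler_norm (u - v); have := ler_norm (v - u); rewrite (distrC v u); lra.
        * by rewrite add0r.
        * by move=> s; right; exists (s + t i).
      + move=> N; apply: filterS (HN N) => i ti s /=; rewrite in_itv /= => /andP[_ sN]; lra.
      by exists gam0; split => // s _.
    have {}HN : \forall i \near V, ~ t i <= - N by have [] := in_ultra_setVsetC [set i | t i <= - N] UV.
    have [|t0 tt0 _] := @real_lim_bounded t `|N|.
      apply: filterS2 HN Ht => i /negP; rewrite -ltNge => tN [t0 _]; apply/andP; split.
        by apply: le_trans (ltW tN); rewrite lerN2 ler_norm.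
      exact: le_trans t0 (normr_ge0 _).
    have kr : k0 r = gamma0 t0.
      apply: (ultra_lim_unique (loc_unif_cvg (s := r) lu)).
      apply: cvg_trans (loc_unif_comp cg lug tt0); apply: near_eq_cvg.
      by apply: filterS Ht => i [_ ->].
    have t00 : t0 <= 0 by apply: (ler_lim tt0 (cvg_cst (0 : R))); apply: filterS Ht => i [].
    have := fgc _ t00; rewrite -kr fkr ?(ltW cr) ?(ltW ra)//.
    by rewrite leNgt cr.
rewrite k0a k0c in br0 Hl0.
(* All points of the limit path are on [k0] at their own level, so any choice of points with
   prescribed levels, such as the one made by [xget] in [concat], agrees with [k0]. *)
exists c0, gamma0, l0, k0; split => // k' k'P fk'; apply/funext => r.
have Pk p : path_set a c0 l0 gamma0 p -> k0 (f p) = p.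
  move=> [[[->|->]|Hp]|[s _ <-]] //; have [|r' r'b ->] := Hl0 p; first by right.
  by rewrite fkr.
by rewrite -(Pk _ (k'P r)) fk' -(fk0 r).2.
Qed.

(** The mirror image of [in_limit]. That the [c i] are critical is now a hypothesis, since [broken]
    records this only for the points after the first. *)
Lemma out_limit (a : M) (x c : T -> M) x0 (gamma : T -> R -> M) (l : T -> seq (M * set (R -> M)))
  (k : T -> R -> M) : critical g f a -> (forall i, critical g f (c i)) -> x @ V --> x0 ->
  (forall i, out_flow g f (x i) (c i) (gamma i)) -> (forall i, broken g f (c i) a (l i)) ->
  (forall i r, path_set a (c i) (l i) (gamma i) (k i r)) ->
  (forall i r, f (k i r) = clamp (f a) (f (x i)) r) ->
  exists c0 gamma0 l0 k0, [/\ critical g f c0, out_flow g f x0 c0 gamma0, broken g f c0 a l0,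
    forall A, entourage A -> \forall i \near V, forall r, A (k0 r, k i r) &
    forall k' : R -> M, (forall r, path_set a c0 l0 gamma0 (k' r)) ->
      (forall r, f (k' r) = clamp (f a) (f x0) r) -> k' = k0].
Proof.
move=> ca cc xl fl br kP fk; pose P i := path_set a (c i) (l i) (gamma i).
have dP i : dpath g f (P i) (x i) a by apply: dpath_out => //; exact: br.
have [k0 [ck lu unif fk0 k0P]] := concat_limit dP xl (cvg_cst a) kP fk.
have [gamma0 [c0 [cg lug cc0 fl0]]] := out_half_limit xl fl.
have [fg0 g0 gc0] := fl0.
have k0a : k0 (f a) = a.
  by apply: (k0P (fun=> a) a _ (cvg_cst a)); apply: nearW => i; left; left; left.
have k0x : k0 (f x0) = x0.
  by apply: (k0P x x0 _ xl); apply: nearW => i; have [] := dP i.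
have k0g s : k0 (f (gamma0 s)) = gamma0 s.
  by apply: (k0P (gamma^~ s) _ _ (loc_unif_cvg (s := s) lug)); apply: nearW => i; right; exists s.
have fgl : f (gamma0 s) @[s --> +oo] --> f c0 by apply: cvg_comp gc0 _; exact: cf.
have k0c : k0 (f c0) = c0.
  apply: (@cvg_unique _ hausM (gamma0 s @[s --> +oo])) => //.
  have : k0 (f (gamma0 s)) @[s --> +oo] --> k0 (f c0) by apply: cvg_comp fgl _; exact: ck.
  by apply: cvg_trans; apply: near_eq_cvg; apply: nearW => s; rewrite k0g.
have fgc s : 0 <= s -> f c0 <= f (gamma0 s).
  by move=> s0; have [] := down_pinfty mf fg0 gc0 s0.
have fax : f a <= f x0.
  have h1 : f (x i) @[i --> V] --> f x0 by apply: cvg_comp xl _; exact: cf.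
  by apply: (ler_lim (cvg_cst (f a)) h1); apply: nearW => i; have [] := dpath_down (dP i).
have frange p : k0 (f p) = p -> f a <= f p <= f x0.
  by move=> kp; have := (fk0 (f p)).1; rewrite kp => e; rewrite e; exact: clamp_itv.
have /andP[ac0 c0x] := frange c0 k0c.
have fkr r : f a <= r <= f c0 -> f (k0 r) = r.
  by move=> /andP[h1 h2]; rewrite (fk0 r).1 clamp_id// h1 (le_trans h2).
have [||| l0 [br0 Hl0]] := @broken_exists R n M g compactM hausM f mf k0 (f a) (f c0) ck ac0 fkr.
- by rewrite k0a.
- by rewrite k0c.
- move=> r /andP[ar rc] ncr.
  pose full i := exists gamma', [/\ gradient_flow g f setT gamma', gamma' 0 = k i r & forall s, P i (gamma' s)].
  have : \forall i \near V, (critical g f (k i r) \/ full i) \/ exists2 t, 0 <= t & k i r = gamma i t.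
    apply: nearW => i; have [[[->|->]|Hp]|[t _ <-]] := kP i r; [by left; left|by left; left; exact: cc| |].
    - left; have [|?|[gamma' [fg' g'0 g'P]]] := broken_local (cc i) (br i) (p := k i r).
      + by right.
      + by left.
      right; exists gamma'; split => // s; have [->|?] := g'P s; [by left; left; right|by left; right].
    - right; exists (Num.max t 0); first by rewrite le_max lexx orbT.
      by have [_ gx _] := fl i; case: leP => // t0; rewrite !gx.
  move=> /ultra_or[/ultra_or[Hc|Hfull]|Hhalf].
  - by exfalso; apply: ncr; apply: critical_lim Hc; exact: loc_unif_cvg lu.
  - have /boolp.choice[gam Hgam] : forall i, exists gamma' : R -> M, full i ->
        [/\ gradient_flow g f setT gamma', gamma' 0 = k i r & forall s, P i (gamma' s)].
      move=> i; have [[gamma' H]|nf] := pselect (full i); first by exists gamma'.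
      by exists (gamma i).
    have [||gam0 [h1 h2 h3]] := full_limit lu k0P (gamma := gam) (I := fun=> setT) (rho := fun=> id) (r := r).
    + by apply: filterS Hfull => i /Hgam[h1 h2 h3].
    + by move=> N; apply: nearW => i.
    by exists gam0; split => // s _.
  - have /boolp.choice[t Ht] : forall i, exists t : R, (exists2 t, 0 <= t & k i r = gamma i t) ->
        0 <= t /\ k i r = gamma i t.
      move=> i; have [[t H1 H2]|nf] := pselect (exists2 t, 0 <= t & k i r = gamma i t); first by exists t.
      by exists 0.
    have {Hhalf}Ht : \forall i \near V, 0 <= t i /\ k i r = gamma i (t i) by apply: filterS Hhalf => i /Ht.
    have [HN|/existsNP[N HN]] := pselect (forall N, \forall i \near V, N <= t i).
      have [||gam0 [h1 h2 h3]] := full_limit lu k0P (gamma := fun i s => gamma i (s + t i))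
        (I := fun i => [set s | 0 <= s + t i]) (rho := fun i s => Num.max (s + t i) 0 - t i) (r := r).
      + apply: filterS Ht => i [ti0 kr]; have [fg gx _] := fl i; split.
        * split.
          - by move=> p q /= p0 q0 s /andP[ps sq]; rewrite (le_trans p0)// lerD2r.
          - suff -> : [set s | 0 <= s + t i] = [set s | `[0, +oo[%classic (s + t i)] by exact: gradient_flow_shift.
            by apply/seteqP; split => s /=; rewrite in_itv /= andbT.
          - move=> s /=; rewrite subrK le_max lexx orbT; split => //.
            by case: leP => // s0; rewrite !gx.
          - move=> p q; rewrite opprB addrA subrK; have := lexx (`|p - q|).
            have {1}-> : p - q = (p + t i) - (q + t i) by ring.
            move: (p + t i) (q + t i) => u v; rewrite !maxEle; do 2 case: ifPn; rewrite -?ltNge => *; rewrite ler_norml;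
            apply/andP; split; have := ler_norm (u - v); have := ler_norm (v - u); rewrite (distrC v u); lra.
        * by rewrite add0r.
        * by move=> s; right; exists (s + t i).
      + move=> N; apply: filterS (HN N) => i ti s /=; rewrite in_itv /= => /andP[sN _]; lra.
      by exists gam0; split => // s _.
    have {}HN : \forall i \near V, ~ N <= t i by have [] := in_ultra_setVsetC [set i | N <= t i] UV.
    have [|t0 tt0 _] := @real_lim_bounded t `|N|.
      apply: filterS2 HN Ht => i /negP; rewrite -ltNge => tN [t0 _]; apply/andP; split.
        by apply: le_trans _ t0; rewrite lerNl oppr0.
      exact: le_trans (ltW tN) (ler_norm _).
    have kr : k0 r = gamma0 t0.
      apply: (ultra_lim_unique (loc_unif_cvg (s := r) lu)).
      apply: cvg_trans (loc_unif_comp cg lug tt0); apply: near_eq_cvg.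
      by apply: filterS Ht => i [_ ->].
    have t00 : 0 <= t0 by apply: (ler_lim (cvg_cst (0 : R)) tt0); apply: filterS Ht => i [].
    have := fgc _ t00; rewrite -kr fkr ?(ltW ar) ?(ltW rc)//.
    by rewrite leNgt rc.
rewrite k0a k0c in br0 Hl0.
exists c0, gamma0, l0, k0; split => // k' k'P fk'; apply/funext => r.
have Pk p : path_set a c0 l0 gamma0 p -> k0 (f p) = p.
  move=> [[[->|->]|Hp]|[s _ <-]] //; have [|r' r'b ->] := Hl0 p; first by right.
  by rewrite fkr.
by rewrite -(Pk _ (k'P r)) fk' -(fk0 r).2.
Qed.

End LimitTools.

(** * The C^infinity topology *)

Section SupDist.
Context {R : realType} {D : Type} (K : set D).
Implicit Types (u v : D -> R).

(** Equal to 0 by the convention on [sup] if [K] is empty or the difference unbounded; hence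
    [bounded_on] wherever it has to bound values. *)
Definition supdist u v : R := sup [set `|u y - v y| | y in K].

Definition bounded_on u : Prop := exists B, forall y, K y -> `|u y| <= B.

Lemma supdist_ge u v y : bounded_on u -> bounded_on v -> K y -> `|u y - v y| <= supdist u v.
Proof.
move=> [B HB] [B' HB'] Ky; apply: sup_ubound; last by exists y.
exists (B + B') => _ [z Kz <-]; apply: le_trans (ler_normB _ _) _.
by rewrite lerD ?HB ?HB'.
Qed.

Lemma supdist_ge0 u v : 0 <= supdist u v.
Proof.
have [H|H] := pselect (has_sup [set `|u y - v y| | y in K]); last by rewrite /supdist sup_out.
have [[_ [y Ky _]] ub] := H; apply: le_trans (normr_ge0 (u y - v y)) _.
by apply: sup_ubound => //; exists y.
Qed.

Lemma supdist_le u v C : 0 <= C -> (forall y, K y -> `|u y - v y| <= C) -> supdist u v <= C.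
Proof.
move=> C0 H; have [[y Ky]|nK] := pselect (exists y, K y).
  by apply: ge_sup; [exists `|u y - v y|, y|move=> _ [z Kz <-]; exact: H].
suff e0 : [set `|u y - v y| | y in K] = set0 by rewrite /supdist e0 sup0.
by apply/seteqP; split => // r [z Kz _]; apply: nK; exists z.
Qed.

Lemma supdist_dist u v u' v' C C' : bounded_on u -> bounded_on v -> bounded_on u' -> bounded_on v' ->
  (forall y, K y -> `|u y - u' y| <= C) -> (forall y, K y -> `|v y - v' y| <= C') -> 0 <= C -> 0 <= C' ->
  `|supdist u v - supdist u' v'| <= C + C'.
Proof.
move=> bu bv bu' bv' hu hv C0 C'0.
have H a b a' b' : bounded_on a' -> bounded_on b' ->
    (forall y, K y -> `|a y - a' y| <= C) -> (forall y, K y -> `|b y - b' y| <= C') ->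
    0 <= supdist a' b' -> supdist a b <= supdist a' b' + (C + C').
  move=> ba' bb' ha hb s0; apply: supdist_le => [|y Ky]; first by rewrite !addr_ge0.
  have -> : a y - b y = (a' y - b' y) + ((a y - a' y) + (b' y - b y)) by ring.
  apply: le_trans (ler_normD _ _) _; apply: lerD; first exact: supdist_ge.
  by apply: le_trans (ler_normD _ _) _; rewrite lerD ?ha// distrC hb.
rewrite ler_norml; apply/andP; split.
  have : supdist u' v' <= supdist u v + (C + C').
    by apply: H => //; [move=> y Ky; rewrite distrC hu|move=> y Ky; rewrite distrC hv|exact: supdist_ge0].
  lra.
have : supdist u v <= supdist u' v' + (C + C') by apply: H => //; exact: supdist_ge0.
lra.
Qed.

Lemma supdist_cvg (T : Type) (F : set_system T) {FF : Filter F} (u v : T -> D -> R) u0 v0 :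
  (forall t, bounded_on (u t)) -> (forall t, bounded_on (v t)) -> bounded_on u0 -> bounded_on v0 ->
  (forall e, 0 < e -> \forall t \near F, forall y, K y -> `|u0 y - u t y| <= e) ->
  (forall e, 0 < e -> \forall t \near F, forall y, K y -> `|v0 y - v t y| <= e) ->
  supdist (u t) (v t) @[t --> F] --> supdist u0 v0.
Proof.
move=> bu bv bu0 bv0 hu hv; apply/cvgrPdist_le => e e0.
have e2 : 0 < e / 2 by rewrite divr_gt0.
apply: filterS2 (hu _ e2) (hv _ e2) => t h1 h2; rewrite [leRHS](splitr e).
by apply: supdist_dist => //; exact: ltW.
Qed.

End SupDist.

Lemma initial_cvg (S : choiceType) (X : topologicalType) (h : S -> X) (T : Type) (F : set_system T)
  {FF : Filter F} (u : T -> S) s : h (u t) @[t --> F] --> h s -> u @ F --> (s : initial_topology h).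
Proof.
move=> H A; rewrite nbhsE => -[B [[C oC <-] Cs] CA].
have : nbhs (h s) C by apply: open_nbhs_nbhs.
by move=> /H; rewrite /nbhs /= /fmap /=; apply: filterS => t; exact: CA.
Qed.

Lemma induced_cvg (S : Type) (X : topologicalType) (h : S -> X) (T : Type) (F : set_system T)
  {FF : Filter F} (u : T -> induced_topology h) (s : induced_topology h) :
  h (u t) @[t --> F] --> h s -> u @ F --> s.
Proof. exact: (@initial_cvg {classic S}). Qed.

Lemma induced_continuous (S : Type) (X : topologicalType) (h : S -> X) :
  continuous (h : induced_topology h -> X).
Proof. exact: (@initial_continuous {classic S}). Qed.

Lemma prod_cvg (I : Type) (X : I -> topologicalType) (T : Type) (F : set_system T)
  {FF : Filter F} (u : T -> prod_topology X) (l : prod_topology X) :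
  (forall i, u t i @[t --> F] --> l i) -> u @ F --> l.
Proof.
move=> H; apply/cvg_sup => i; apply: (@initial_cvg _ _ (fun u : {classic forall i, X i} => u i)).
exact: H.
Qed.

Lemma prod_proj (I : Type) (X : I -> topologicalType) (T : Type) (F : set_system T)
  {FF : Filter F} (u : T -> prod_topology X) (l : prod_topology X) i :
  u @ F --> l -> u t i @[t --> F] --> l i.
Proof.
move=> /cvg_sup /(_ i) H A nA.
exact: (H _ (@initial_continuous {classic forall i, X i} _ (fun u : {classic forall i, X i} => u i) l A nA)).
Qed.

Lemma near_dist {R : realType} (W : normedModType R) (p : W) r : 0 < r -> \forall y \near p, `|y - p| <= r.
Proof.
have /cvgrPdist_le H : nbhs p --> p by exact: cvg_id.
by move=> /H; apply: filterS => y; rewrite distrC.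
Qed.

Section CinftyTopology.
Context {R : realType} {n : nat} {M : topologicalType} {g : riemannian R n M}.
Implicit Types (c : chart R n M) (h : Cinfty g).

Definition jet c (s : seq 'I_n) (h : Cinfty g) : 'rV[R]_n -> R := partials s (in_chart (sval h) c).

Lemma jet_continuous c s h y : atlas g c -> cimg c y -> {for y, continuous (jet c s h)}.
Proof. by move=> ac cy; have [] := svalP h c ac s y cy. Qed.

Lemma jet_near c s K (h0 : CinftyT g) e : atlas g c -> compact_in_chart c K -> 0 < e ->
  \forall h \near h0, forall y, K y -> `|jet c s h0 y - jet c s h y| < e.
Proof.
move=> ac Kc e0.
pose i : {c : chart R n M | atlas g c} * seq 'I_n := (exist _ c ac, s).
have H : nbhs (jets h0 i : {family compact_in_chart (sval i.1), 'rV[R]_n -> R})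
    [set u | forall y, K y -> ball (jets h0 i y) e (u y)].
  apply: (fam_nbhs (E := [set xy | ball xy.1 e xy.2])) => //; exact: entourage_ball (PosNum e0).
have := @induced_continuous _ _ (@jets R n M g) h0 _ (prod_proj (F := nbhs (jets h0)) (i := i) cvg_id H).
exact.
Qed.

Lemma jet_cvg (T : Type) (F : set_system T) {FF : Filter F} (h : T -> CinftyT g) (h0 : CinftyT g) :
  (forall c s K e, atlas g c -> compact_in_chart c K -> 0 < e ->
    \forall t \near F, forall y, K y -> `|jet c s h0 y - jet c s (h t) y| < e) ->
  h @ F --> h0.
Proof.
move=> H; apply: (@induced_cvg _ _ (@jets R n M g)); apply: prod_cvg => -[[c ac] s].
apply/fam_cvgP => K Kc A /uniform_nbhs[E [entE EA]].
have [e e0 He] : exists2 e : R, 0 < e & forall x y : R, `|x - y| < e -> E (x, y).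
  by have [e e0 He] := entE; exists e => // x y xy; apply: He.
by apply: filterS (H c s K e ac Kc e0) => t Ht; apply: EA => y Ky /=; apply: He; exact: Ht.
Qed.

Lemma jet_point (T : Type) (F : set_system T) {FF : Filter F} (h : T -> CinftyT g) (h0 : CinftyT g) c s K e :
  h @ F --> h0 -> atlas g c -> compact_in_chart c K -> 0 < e ->
  \forall t \near F, forall y, K y -> `|jet c s h0 y - jet c s (h t) y| < e.
Proof. by move=> H ac Kc e0; exact: (H _ (jet_near s h0 ac Kc e0)). Qed.

Lemma jet_bounded c s K h : atlas g c -> compact_in_chart c K -> bounded_on K (jet c s h).
Proof.
move=> ac [cK Kc].
have [B B0 HB] := compact_upper cK (u := fun y => `|jet c s h y|)
  (fun y Ky => cvg_norm (jet_continuous (s := s) (h := h) ac (Kc y Ky))).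
by exists B.
Qed.

Lemma jet_supdist_cvg (T : Type) (F : set_system T) {FF : Filter F} (h h' : T -> CinftyT g)
  (h0 h0' : CinftyT g) c s K : atlas g c -> compact_in_chart c K -> h @ F --> h0 -> h' @ F --> h0' ->
  supdist K (jet c s (h t)) (jet c s (h' t)) @[t --> F] --> supdist K (jet c s h0) (jet c s h0').
Proof.
move=> ac Kc H H'; apply: supdist_cvg; try by move=> *; exact: jet_bounded.
  by move=> e e0; apply: filterS (jet_point s H ac Kc e0) => t Ht y Ky; exact/ltW/Ht.
by move=> e e0; apply: filterS (jet_point s H' ac Kc e0) => t Ht y Ky; exact/ltW/Ht.
Qed.

Context (compactM : compact [set: M]) (hausM : hausdorff_space M).

Lemma Cinfty_bounded h : bounded_on setT (sval h).
Proof.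
have [B B0 HB] := compact_upper compactM (u := fun y => `|sval h y|)
  (fun y _ => cvg_norm (smooth_continuous (svalP h) (x := y))).
by exists B.
Qed.

(** Finitely many chart balls cover [M], and on each of them the jet of order 0 is controlled. *)
Lemma value_near (h0 : CinftyT g) e : 0 < e -> \forall h \near h0, forall x, `|sval h0 x - sval h x| <= e.
Proof.
move=> e0; have /compact_near_coveringP := compactM.
move=> /(_ _ (nbhs h0) (fun h x => `|sval h0 x - sval h x| <= e) _) H.
suff : \forall h \near h0, forall x, setT x -> `|sval h0 x - sval h x| <= e by apply: filterS => h + x; apply.
apply: H => x _; have [c ac cx] := atlas_cover g x.
have [r r0 rc] := cball_near (nbhs_cimg (cimg_cmap cx)).
exists ([set z | cdom c z /\ cball c x r (cmap c z)],
  [set h | forall y, cball c x r y -> `|jet c [::] h0 y - jet c [::] h y| < e]); last first.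
  move=> [z h] /= [[cz bz] Hh]; have := Hh _ bz; rewrite /jet /= /in_chart /= cmapK//; exact: ltW.
have Kc : compact_in_chart c (cball c x r) by split => //; exact: cball_compact.
split => /=; last exact: (jet_near [::] h0 ac Kc e0).
apply: filterI; first exact: nbhs_cdom.
have : \forall y \near cmap c x, cball c x r y.
  exact: near_dist.
exact: (cmap_cont cx).
Qed.

Lemma value_point (T : Type) (F : set_system T) {FF : Filter F} (h : T -> CinftyT g) (h0 : CinftyT g) e :
  h @ F --> h0 -> 0 < e -> \forall t \near F, forall x, setT x -> `|sval h0 x - sval (h t) x| <= e.
Proof.
move=> H e0; have : \forall t \near F, forall x, `|sval h0 x - sval (h t) x| <= e by exact: (H _ (value_near h0 e0)).
by apply: filterS => t + x.
Qed.

Lemma value_supdist_cvg (T : Type) (F : set_system T) {FF : Filter F} (h h' : T -> CinftyT g)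
  (h0 h0' : CinftyT g) : h @ F --> h0 -> h' @ F --> h0' ->
  supdist setT (sval (h t)) (sval (h' t)) @[t --> F] --> supdist setT (sval h0) (sval h0').
Proof.
move=> H H'; apply: supdist_cvg; try by move=> *; exact: Cinfty_bounded.
  by move=> e; exact: value_point.
by move=> e; exact: value_point.
Qed.

End CinftyTopology.

Section GradientConvergence.
Context {R : realType} {n : nat} {M : uniformType} {g : riemannian R n M}.

Lemma jet_grad_conv (T : Type) (F : set_system T) {FF : Filter F} (h : T -> CinftyT g) (h0 : CinftyT g) :
  h @ F --> h0 -> grad_conv g F (fun t => sval (h t)) (sval h0).
Proof.
move=> H c K ac cK Kc e e0.
have Kc' : compact_in_chart c (cmap c @` K).
  split; last by move=> _ [z Kz <-]; exact/cimg_cmap/Kc.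
  apply: continuous_compact => //; apply: continuous_in_subspaceT => z /set_mem Kz.
  exact/cmap_cont/Kc.
have cinvm z : K z -> {for z, continuous (fun z => invmx (metric g c (cmap c z)))}.
  move=> /Kc cz; apply: continuous_invmx; first exact/metric_unit/cimg_cmap.
  apply/continuous_coord => i j.
  have [+ _] := metric_smooth i j ac [::] (cimg_cmap cz).
  by move=> H1; apply: (cvg_comp _ _ (cmap_cont cz) H1).
have [B B0 HB] := compact_upper cK (u := fun z => `|invmx (metric g c (cmap c z))|)
  (fun z Kz => cvg_norm (cinvm z Kz)).
have nB : 0 < n%:R * B + 1 by rewrite ltr_wpDl// mulr_ge0// ltW.
have : \forall t \near F, forall i, forall y, (cmap c @` K) y ->
    `|jet c [:: i] h0 y - jet c [:: i] (h t) y| < e / (n%:R * B + 1).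
  by apply: near_ord => i; apply: jet_point => //; rewrite divr_gt0.
apply: filterS => t Ht z Kz; rewrite /gradient -mulmxBl.
apply: le_trans (mulmx_norm _ _) _.
have : `|\row_i partial i (in_chart (sval (h t)) c) (cmap c z) -
   \row_i partial i (in_chart (sval h0) c) (cmap c z)| <= e / (n%:R * B + 1).
  apply: mx_norm_le => [|i]; first by rewrite ltW// divr_gt0.
  by rewrite !mxE distrC; apply: ltW; apply: (Ht i); exists z.
move=> H1; apply: le_trans (_ : n%:R * B * (e / (n%:R * B + 1)) <= _).
  by apply: ler_pM => //; rewrite ?mulr_ge0// ler_wpM2l// HB.
by rewrite mulrA ler_pdivrMr// mulrC ler_wpM2l ?(ltW e0)// lerDl.
Qed.

End GradientConvergence.

(** * Completeness of the space of labels *)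

Section CinftyComplete.
Context {R : realType} {n : nat} {M : topologicalType} {g : riemannian R n M}.
Context {T : Type} (V : set_system T) {UV : UltraFilter V} (h : T -> CinftyT g).
(** What total boundedness gives along an ultrafilter; the center [h1] may change with the jet, the
    compact set and [e]. *)
Hypothesis cauchy : forall c s K e, atlas g c -> compact_in_chart c K -> 0 < e ->
  exists h1 : Cinfty g, \forall t \near V, forall y, K y -> `|jet c s h1 y - jet c s (h t) y| <= e.

Let F (c : chart R n M) s y : R := lim (jet c s (h t) y @[t --> V]).

Let Fcvg c s y : atlas g c -> cimg c y -> jet c s (h t) y @[t --> V] --> F c s y.
Proof.
move=> ac cy; have Kc : compact_in_chart c [set y] by split; [exact: compact_set1|move=> _ ->].
have [h1 H1] := cauchy s ac Kc ltr01.
pose B := `|jet c s h1 y| + 1.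
have := @segment_compact R (- B) B; rewrite compact_ultra => /(_ (jet c s (h t) y @[t --> V]) (ultra_map _ UV)) [].
  apply: filterS H1 => t /(_ y erefl) Ht /=; rewrite in_itv /= -ler_norml /B -lerBlDl.
  by apply: le_trans (lerB_dist _ _) _; rewrite distrC.
by move=> l [_ Hl]; apply: cvgP Hl.
Qed.

Let Funif c s K e : atlas g c -> compact_in_chart c K -> 0 < e ->
  \forall t \near V, forall y, K y -> `|F c s y - jet c s (h t) y| <= e.
Proof.
move=> ac Kc e0; have e2 : 0 < e / 2 by rewrite divr_gt0.
have [h1 H1] := cauchy s ac Kc e2.
apply: filterS (H1) => t Ht y Ky; rewrite [leRHS](splitr e).
have -> : F c s y - jet c s (h t) y = (F c s y - jet c s h1 y) + (jet c s h1 y - jet c s (h t) y) by ring.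
apply: le_trans (ler_normD _ _) _; apply: lerD; last exact: Ht.
have cv := @Fcvg c s y ac (Kc.2 y Ky).
have cv' : `|jet c s (h t) y - jet c s h1 y| @[t --> V] --> `|F c s y - jet c s h1 y|.
  by apply: cvg_norm; apply: cvgB => //; exact: cvg_cst.
by apply: (ler_lim cv' (cvg_cst (e / 2))); apply: filterS H1 => t' Ht'; rewrite distrC; exact: Ht'.
Qed.

Let ball_in_chart (c : chart R n M) y : cimg c y -> exists2 r, 0 < r & compact_in_chart c [set z | `|z - y| <= r].
Proof.
move=> cy; have [xc yE] := cinvK cy.
have [r r0 Hr] := cball_near (c := c) (x := cinv c y) (P := cimg c) (nbhs_cimg (cimg_cmap xc)).
by exists r => //; rewrite -yE; split => //; exact: cball_compact.
Qed.

Let Fcont c s y : atlas g c -> cimg c y -> {for y, continuous (F c s)}.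
Proof.
move=> ac cy; have [r r0 Kc] := ball_in_chart cy.
suff : F c s z @[z --> y] --> F c s y by [].
apply: (@cvgrPdist_le _ _ _ (nbhs y) _ _ _).2 => e e0; have e3 : 0 < e / 3 by rewrite divr_gt0.
have /filter_ex[t Ht] := Funif s ac Kc e3.
have /cvgrPdist_le /(_ _ e3) Hc := jet_continuous (s := s) (h := h t) ac cy.
apply: filterS2 Hc (near_dist y r0) => z h1 zy.
have -> : F c s y - F c s z = (F c s y - jet c s (h t) y) + ((jet c s (h t) y - jet c s (h t) z) -
  (F c s z - jet c s (h t) z)) by ring.
have -> : e = e / 3 + (e / 3 + e / 3) by field.
apply: le_trans (ler_normD _ _) _; apply: lerD; first by apply: Ht; rewrite /= subrr normr0 ltW.
by apply: le_trans (ler_normB _ _) _; apply: lerD => //; exact: Ht.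
Qed.

(** [partial_mvt] is applied to [h t] with the limit derivative at [y] as [w]; the resulting
    estimate on increments passes to the limit in [t]. *)
Let Fderive c j s y : atlas g c -> cimg c y -> is_derive y (delta_mx 0 j) (F c s) (F c (j :: s) y).
Proof.
move=> ac cy; have [r0 r00 Kc0] := ball_in_chart cy.
suff H : eta^-1 *: ((F c s \o shift y) (eta *: delta_mx 0 j) - F c s y) @[eta --> 0^'] --> F c (j :: s) y.
  by apply: DeriveDef; [exact: cvgP H|exact: cvg_lim H].
apply/cvgrPdist_le => e e0; have e2 : 0 < e / 2 by rewrite divr_gt0.
have /cvgrPdist_le /(_ _ e2) Hc := Fcont (s := j :: s) ac cy.
have [r r_0 Hr] : exists2 r, 0 < r & forall z, `|z - y| <= r -> `|z - y| <= r0 /\ `|F c (j :: s) y - F c (j :: s) z| <= e / 2.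
  have : \forall z \near y, `|z - y| <= r0 /\ `|F c (j :: s) y - F c (j :: s) z| <= e / 2.
    by apply: filterS2 (near_dist y r00) Hc => z; split.
  move=> /nbhs_ballP[d /= d0 Hd]; exists (d / 2); first by rewrite divr_gt0.
  by move=> z zd; apply: Hd; rewrite -ball_normE /= distrC (le_lt_trans zd)// ltr_pdivrMr// ltr_pMr// ltr1n.
near=> eta; have eta0 : eta != 0 by near: eta; exact: nbhs_dnbhs_neq.
have etar : `|eta| <= r by near: eta; apply: nbhs_dnbhs; have := near_dist (0 : R) r_0; apply: filterS => z; rewrite subr0.
suff H : `|F c s (y + eta *: delta_mx 0 j) - F c s y - eta * F c (j :: s) y| <= e * `|eta|.
  rewrite /= [eta *: _ + y]addrC; move: H; set A := F c s (_ + _); set W := F c (_ :: _) y => H.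
  have -> : W - eta^-1 *: (A - F c s y) = - eta^-1 * (A - F c s y - eta * W) by rewrite /GRing.scale /=; field.
  by rewrite normrM normrN normfV mulrC ler_pdivrMr ?normr_gt0.
have in_ball a : `|a| <= `|eta| -> `|y + a *: delta_mx 0 j - y| <= r :> R.
  move=> ae; rewrite addrC addKr; apply: le_trans etar; apply: le_trans ae; apply: mx_norm_le => // i.
  rewrite !mxE eqxx /=; case: eqP => _; rewrite ?mulr1// mulr0 normr0//.
have Kr a : `|a| <= `|eta| -> `|y + a *: delta_mx 0 j - y| <= r0 by move=> /in_ball /Hr[].
have cr a : `|a| <= `|eta| -> cimg c (y + a *: delta_mx 0 j) by move=> /Kr; exact: Kc0.2.
have Hl : (jet c s (h t) (y + eta *: delta_mx 0 j) - jet c s (h t) y - eta * F c (j :: s) y) @[t --> V] -->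
    F c s (y + eta *: delta_mx 0 j) - F c s y - eta * F c (j :: s) y.
  by apply: cvgB; [apply: cvgB; [exact/Fcvg/cr|exact: Fcvg]|exact: cvg_cst].
apply: (ler_lim (cvg_norm Hl) (cvg_cst (e * `|eta|))); apply: filterS (Funif (j :: s) ac Kc0 e2) => t Ht.
apply: partial_mvt => a ae; split; first by have [_ ] := svalP (h t) c ac s _ (cr a ae); apply.
have [K1 H1] := Hr _ (in_ball a ae).
have H2 := Ht _ K1; rewrite [leRHS](splitr e).
rewrite -[X in `|X|](subrKA (F c (j :: s) (y + a *: delta_mx 0 j))).
by apply: le_trans (ler_normD _ _) _; apply: lerD; rewrite distrC.
Unshelve. all: by end_near. Qed.

Lemma Cinfty_complete : exists h0 : CinftyT g, h @ V --> h0.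
Proof.
pose h0 x : R := lim (sval (h t) x @[t --> V]).
have h0F c y : atlas g c -> cimg c y -> in_chart h0 c y = F c [::] y by [].
have DF c s : atlas g c -> forall y, cimg c y -> partials s (in_chart h0 c) y = F c s y.
  move=> ac; elim: s => [|j s IH] y cy //=.
  have [_ <-] := Fderive j s ac cy.
  by apply: near_eq_derive; apply: filterS (nbhs_cimg cy) => z; exact: IH.
have nDF c s y : atlas g c -> cimg c y -> \forall z \near y, F c s z = partials s (in_chart h0 c) z.
  by move=> ac cy; apply: filterS (nbhs_cimg cy) => z cz; rewrite DF.
have sh0 : smooth g h0.
  move=> c ac s y cy; split.
    rewrite /prop_for /continuous_at (DF _ _ ac)//; apply: cvg_trans (Fcont ac cy).
    exact: near_eq_cvg (nDF c s y ac cy).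
  by move=> j; have [+ _] := Fderive j s ac cy; apply: near_eq_derivable; exact: nDF.
exists (exist _ h0 sh0); apply: jet_cvg => c s K e ac Kc e0.
have e2 : 0 < e / 2 by rewrite divr_gt0.
apply: filterS (Funif s ac Kc e2) => t Ht y Ky; have cy : cimg c y by exact: Kc.2.
rewrite /jet /= (DF _ _ ac)//.
by apply: le_lt_trans (Ht y Ky) _; rewrite ltr_pdivrMr// ltr_pMr// ltr1n.
Qed.

End CinftyComplete.

(** * Trees and faces *)

Section Trees.
Context {R : realType} {G : graph R}.
Implicit Types (W : {set vert G}) (A : {set edge G}).

(** Without cycles the rows of the boundary matrix are independent, so its rank is [#|A|]; each row
    being a difference of two vertices of [W], the matrix factors through the [#|W| - 1] differences
    with a root. *)
Lemma tree_card W A : {in A, forall e, src e \in W /\ tgt e \in W} -> W != finset.set0 ->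
  betti1 A = 0%N -> (#|A| < #|W|)%N.
Proof.
move=> endsA /set0Pn[w0 Ww0] b0; pose W' := W :\ w0.
have cW : #|W| = #|W'|.+1 by rewrite (cardsD1 w0 W) Ww0.
rewrite cW ltnS; move: b0; rewrite /betti1 mxrank_ker; set D := (X in \rank X) => /eqP.
rewrite subn_eq0 => /leq_trans; apply.
(* The rows of [Q] are the differences [w - w0]; in [D'] the column of the root [w0] is dropped. *)
pose Q : 'M[rat]_(#|W'|, #|vert G|) := \matrix_(i, j)
  ((enum_val j == enum_val i :> vert G)%:R - (enum_val j == w0 :> vert G)%:R).
pose D' : 'M[rat]_(#|A|, #|W'|) := \matrix_(i, k)
  ((enum_val k == tgt (enum_val i))%:R - (enum_val k == src (enum_val i))%:R).
have -> : D = D' *m Q.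
  apply/matrixP => i j; rewrite !mxE; under eq_bigr do rewrite !mxE.
  set e := enum_val i; set v := enum_val j.
  have H a : a \in W -> \sum_(k < #|W'|) (enum_val k == a :> vert G)%:R *
      ((v == enum_val k)%:R - (v == w0)%:R) = (v == a)%:R - (v == w0)%:R :> rat.
    move=> Wa; rewrite -(big_enum_val (A := mem W') (fun w => (w == a)%:R * ((v == w)%:R - (v == w0)%:R))).
    have [->|aw0] := eqVneq a w0.
      by rewrite subrr big1// => w; rewrite !inE => /andP[/negPf->]; rewrite mul0r.
    rewrite (bigD1 a) ?inE ?aw0//= eqxx mul1r big1 ?addr0// => w /andP[_ /negPf->].
    by rewrite mul0r.
  have [Ws Wt] := endsA _ (enum_valP i).
  under eq_bigr do rewrite mulrBl.
  by rewrite sumrB !H//; ring.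
by apply: leq_trans (mxrankM_maxr _ _) _; exact: rank_leq_row.
Qed.

Lemma sum_valence W :
  \sum_(w in W) valence w = (#|[set e : edge G | src e \in W]%SET| + #|[set e : edge G | tgt e \in W]%SET|)%N.
Proof.
have H (h : edge G -> vert G) : \sum_(w in W) #|[set e | h e == w]%SET| = #|[set e | h e \in W]%SET|.
  rewrite -[RHS]sum1dep_card (partition_big h [in W])//=.
  by apply: eq_bigr => w Ww; rewrite -sum1dep_card; apply: eq_bigl => e; rewrite andb_idl// => /eqP->.
by rewrite /valence big_split !H.
Qed.

Lemma valence_gt0 (e : edge G) (v : vert G) : (src e == v) || (tgt e == v) -> (0 < valence v)%N.
Proof.
by rewrite addn_gt0 => /orP[H|H]; apply/orP; [left|right]; apply/card_gt0P; exists e; rewrite inE.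
Qed.

Lemma connected_valence W A (v w : vert G) : connected_graph W A -> v \in W -> w \in W -> v != w ->
  (0 < valence v)%N.
Proof.
move=> [_ H] Wv Ww vw; have /connectP[[|u p]] := H v w Wv Ww; first by move=> _ e; rewrite e eqxx in vw.
move=> /= /andP[/existsP[e /andP[_ /orP[|]]]] /andP[/eqP h1 /eqP h2] _ _.
  by apply: (@valence_gt0 e); rewrite h1 eqxx.
by apply: (@valence_gt0 e); rewrite h2 eqxx orbT.
Qed.

Lemma univalent_in_out (v : vert G) : univalent v -> incoming v || outgoing v.
Proof.
move=> uv; rewrite /incoming /outgoing uv /=; have : (0 < valence v)%N by rewrite (eqP uv).
by rewrite addn_gt0 => /orP[|] /card_gt0P[e]; rewrite inE => H; apply/orP; [left|right];
  apply/existsP; exists e.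
Qed.

End Trees.

(** * Morphisms of graphs and pullbacks of simplices *)

Section Mor.
Context {R : realType}.

Lemma mor_ext (G H : graph R) (phi psi : mor G H) : mcell phi =1 mcell psi -> phi = psi.
Proof.
case: phi psi => [mv1 me1 p1 p2 p3 p4 p5 p6] [mv2 me2 q1 q2 q3 q4 q5 q6] /= E.
have Ev : mv1 = mv2 by apply/funext => v; have [] := E (inl v).
have Ee : me1 = me2 by apply/funext => e; exact: (E (inr e)).
by subst; f_equal; exact: Prop_irrelevance.
Qed.

Context {G H : graph R} (phi : mor G H).

Definition elift (e : edge H) : edge G := sval (cid (mor_edge phi e)).

Lemma elift_me e : me phi (elift e) = inr e.
Proof. by rewrite /elift; case: cid => /= ? []. Qed.

Lemma elift_uniq e e' : me phi e = inr e' -> e = elift e'.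
Proof. by move=> E; rewrite /elift; case: cid => /= ? [_ /(_ e E)]. Qed.

Lemma elift_inj : injective elift.
Proof. by move=> e e' E; have := elift_me e; rewrite E elift_me => -[]. Qed.

Lemma mv_surj v : exists w, mv phi w = v.
Proof. by have [[/set0Pn[w]]] := mor_tree phi v; rewrite inE => /eqP; exists w. Qed.

Definition vlift (v : vert H) : vert G := sval (cid (mv_surj v)).

Lemma vliftK v : mv phi (vlift v) = v.
Proof. by rewrite /vlift; case: cid. Qed.

(** A fiber is connected by collapsed edges, along which equality propagates. *)
Lemma fiber_const (X : Type) (F : vert G -> X) :
  (forall e v, me phi e = inl v -> F (src e) = F (tgt e)) ->
  forall v w, mv phi v = mv phi w -> F v = F w.
Proof.
move=> HF v w vw; have [[_ con] _] := mor_tree phi (mv phi w).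
have Sv : v \in [set u | mv phi u == mv phi w]%SET by rewrite inE vw.
have Sw : w \in [set u | mv phi u == mv phi w]%SET by rewrite inE.
have /connectP[p] := con v w Sv Sw; clear -HF.
elim: p v => [|u p IH] v /=; first by move=> _ ->.
move=> /andP[/existsP[e /andP[+ H1]] /IH{}IH] /IH <-; rewrite inE => /eqP /HF.
by case/orP: H1 => /andP[/eqP -> /eqP ->].
Qed.

(* The edges of G meeting the fiber W of a leaf are the collapsed edges of that fiber, with both ends
   in W, and one further edge end: the valences in W sum to 2 (|W| - 1) + 1. *)
Lemma univalent_lift (v : vert H) : univalent v -> exists2 w, univalent w & mv phi w = v.
Proof.
move=> uv; have [[W0 con] b0] := mor_tree phi v.
set W := [set w | mv phi w == v]%SET in W0 con; set A := [set e | me phi e == inl v]%SET in con b0.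
have cA : (#|A| < #|W|)%N.
  apply: tree_card => // e; rewrite !inE => /eqP eA.
  by have := mor_ends phi e; rewrite eA => -[-> ->].
have cnt (h : forall K : graph R, edge K -> vert K) :
    (forall e, match me phi e with inl u => mv phi (h _ e) = u | inr e' => mv phi (h _ e) = h _ e' end) ->
    (#|[set e | h _ e \in W]%SET| = #|A| + #|[set e | h _ e == v]%SET|)%N.
  move=> Hh; rewrite -(card_imset _ elift_inj) -cardsUI [X in (_ + X)%N](_ : _ = 0%N); last first.
    apply: eq_card0 => e; rewrite !inE; apply/negP => /andP[/eqP eA /imsetP[e' _ E]].
    by move: eA; rewrite E elift_me.
  rewrite addn0; apply: eq_card => e; rewrite !inE; have := Hh e.
  case E: (me phi e) => [u|e'] ->.
    have -> : (e \in [set elift x | x in [set e0 | h _ e0 == v]%SET]%SET) = false.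
      by apply/negP => /imsetP[e' _ E']; move: E; rewrite E' elift_me.
    by rewrite orbF (inj_eq (fun x y (H : inl x = inl y) => let: erefl := H in erefl)).
  rewrite /= (elift_uniq E); apply/idP/imsetP => [he|[e0 + /elift_inj ->]]; last by rewrite inE.
  by exists e' => //; rewrite inE.
have Hsum : (\sum_(w in W) valence w = #|A|.*2.+1)%N.
  rewrite sum_valence (cnt (@src R)) ?(cnt (@tgt R)).
  - by rewrite addnACA -/(valence v) (eqP uv) addn1 addnn.
  - by move=> e; have := mor_ends phi e; case: (me phi e) => [u|e'] [].
  - by move=> e; have := mor_ends phi e; case: (me phi e) => [u|e'] [].
have [w Ww vw] : exists2 w, w \in W & (valence w <= 1)%N.
  apply: contrapT => nw; have : (\sum_(w in W) 2 <= \sum_(w in W) valence w)%N.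
    by apply: leq_sum => w Ww; rewrite ltnNge; apply/negP => H1; apply: nw; exists w.
  rewrite Hsum sum_nat_const; lia.
exists w; last by move: Ww; rewrite inE => /eqP.
rewrite /univalent eqn_leq vw /=.
have [/eqP/cards1P[u Wu]|cW] := eqVneq #|W| 1%N.
  by move: Hsum Ww; rewrite Wu big_set1 inE => Hu /eqP ->; rewrite Hu.
have /existsP[u /andP[Wu uw]] : [exists u, (u \in W) && (w != u)].
  apply: contraNT cW => /existsPn nu; apply/cards1P; exists w; apply/setP => u; rewrite inE.
  have := nu u; case: eqVneq => [<-|]; rewrite ?Ww// andbT => uw.
  exact: negPf.
exact: (connected_valence (conj W0 con) Ww Wu uw).
Qed.

End Mor.

Section Pullback.
Context {R : realType} {b p q : nat} (tau : chain R b p q).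
Context (l : nat) (theta : 'I_l.+1 -> 'I_(chain_len tau).+1) (mono : {homo theta : i j / (i <= j)%N}).

Notation m := (from_top tau (theta ord_max)).

Lemma from_top_pull (i : 'I_l.+1) (e : edge (top tau)) :
  me (from_top tau (theta i)) e =
  match me m e with inl v => inl (mv (from_top (pull mono) i) v) | inr e' => me (from_top (pull mono) i) e' end.
Proof.
have @le1 : (i <= @ord_max l)%N := leq_ord i.
have @le2 : (theta ord_max <= @ord_max (chain_len tau))%N := leq_ord (theta ord_max).
transitivity (mcell (from_top (pull mono) i) (me m e)); last by case: (me m e).
exact: (cm_comp (mono le1) le2 (leq_ord (theta i)) (inr e)).
Qed.

(** The maps to the graphs of the pullback factor through [m], so an edge collapsed by [m] is
    collapsed in all of them and gets length 0. *)
Lemma edge_length_push (t : 'rV[R]_l.+1) (e : edge (top tau)) :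
  edge_length (push theta t) e =
  if me m e is inr e' then @edge_length _ _ _ _ (pull mono) t e' else 0.
Proof.
have -> : edge_length (push theta t) e =
    \sum_i t 0 i * (if me (from_top tau (theta i)) e is inr _ then 1 else 0).
  rewrite /edge_length [RHS](partition_big theta xpredT)//=; apply: eq_bigr => j _.
  by rewrite mxE mulr_suml; apply: eq_bigr => i /eqP ->.
case E: (me m e) => [v|e'].
  by rewrite big1// => i _; rewrite from_top_pull E mulr0.
by apply: eq_bigr => i _; rewrite from_top_pull E.
Qed.

Lemma sum_push (t : 'rV[R]_l.+1) : \sum_j push theta t 0 j = \sum_i t 0 i.
Proof.
rewrite [RHS](partition_big theta xpredT)//=; apply: eq_bigr => j _; by rewrite mxE.
Qed.

Context {n : nat} {M : uniformType} {g : riemannian R n M} {f : M -> R} {Gam : object R b p q}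
  (pi : augmentation Gam tau) (a : leaf Gam -> M).

Lemma am_pull v : mv (am (pull_augmentation mono pi) ord_max) (mv m v) = mv (am pi ord_max) v.
Proof.
have @le2 : (theta ord_max <= @ord_max (chain_len tau))%N := leq_ord (theta ord_max).
by have [E] : inl _ = inl _ := am_comp pi le2 (inl v); apply: esym; exact: E.
Qed.

Lemma restrict_structure (y : structure g tau) (t : 'rV[R]_l.+1) : (forall i, 0 <= t 0 i) ->
  (sval y).1 = push theta t ->
  exists y' : structure g (pull mono), (sval y').1 = t /\ same_structure (sval y) (sval y').
Proof.
move=> t0 yt; have [y0 y1 yi] := svalP y.
have H : @is_structure _ _ _ g _ _ _ (pull mono) (t, fun e => (sval y).2 (elift m e)).
  split => //=; first by rewrite -sum_push -yt.
  by move=> e e' /yi /elift_inj.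
exists (exist _ _ H); split => //; split => // e e' /= E; by rewrite -(elift_uniq E).
Qed.

(** A collapsed edge has length 0, so its two ends have the same image in [M] and the map descends
    to the fibers of [m]; the conditions at leaves are read at univalent lifts. *)
Lemma restrict_flow (y : raw_structure g tau) (y' : raw_structure g (pull mono)) (z : raw_flow M Gam tau) :
  same_structure y y' -> is_flow f a pi y z ->
  exists2 z', is_flow f a (pull_augmentation mono pi) y' z' & same_flow z z'.
Proof.
move=> [yt yl] [ze zl].
have col e v : me m e = inl v -> fvert z (src e) = fvert z (tgt e).
  move=> E; have [_ h1 h2] := ze e; rewrite -(h1 0)// -(h2 0)//.
  by rewrite yt edge_length_push E.
have fv v w : mv m v = mv m w -> fvert z v = fvert z w by exact: fiber_const.
exists (RawFlow (tau := pull mono) (fun v => fvert z (vlift m v)) (fun e => fedge z (elift m e))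
  (fhalf z) (fcrit z) (fbroken z)).
  split => [e|v w uw wv] /=.
    have := ze (elift m e); rewrite yt edge_length_push elift_me.
    have := mor_ends m (elift m e); rewrite elift_me => -[hs ht].
    rewrite (yl _ _ (elift_me m e)).
    rewrite (fv (src (elift m e)) (vlift m (src e))) ?vliftK//.
    by rewrite (fv (tgt (elift m e)) (vlift m (tgt e))) ?vliftK.
  have [w' uw' ww'] := univalent_lift m uw.
  rewrite (fv (vlift m w) w') ?vliftK//; apply: zl => //.
  by rewrite -am_pull ww'.
split => //= [v|e e' E]; first by apply: fv; rewrite vliftK.
by rewrite -(elift_uniq E).
Qed.

Hypothesis top_theta : theta ord_max = ord_max.

Lemma top_edge (e : edge (top tau)) : exists e', me m e = inr e'.
Proof.
(* Generalizing over [j] allows replacing [theta ord_max] by [ord_max] inside dependent types; the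
   map is then an identity. *)
have : forall j, j = ord_max -> exists e', me (from_top tau j) e = inr e'.
  by move=> j ->; exists e; exact: (@cm_id _ _ _ _ tau ord_max (leq_ord ord_max) (inr e)).
exact.
Qed.

Definition epush e : edge (top (pull mono)) := sval (cid (top_edge e)).

Lemma epushE e : me m e = inr (epush e).
Proof. by rewrite /epush; case: cid. Qed.

Lemma extend_structure (y' : structure g (pull mono)) :
  exists y : structure g tau, same_structure (sval y) (sval y').
Proof.
have [y0 y1 yi] := svalP y'.
have H : @is_structure _ _ _ g _ _ _ tau (push theta (sval y').1, fun e => (sval y').2 (epush e)).
  split => /= [i||e e' /yi E]; [by rewrite mxE sumr_ge0|by rewrite sum_push|].
  by rewrite (elift_uniq (epushE e)) E -(elift_uniq (epushE e')).
by exists (exist _ _ H); split => // e e' /=; rewrite epushE => -[<-].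
Qed.

Lemma extend_flow (y : raw_structure g tau) (y' : raw_structure g (pull mono)) z' :
  same_structure y y' -> is_flow f a (pull_augmentation mono pi) y' z' ->
  exists2 z, is_flow f a pi y z & same_flow z z'.
Proof.
move=> [yt yl] [ze zl].
exists (RawFlow (tau := tau) (fun v => fvert z' (mv m v)) (fun e => fedge z' (epush e))
  (fhalf z') (fcrit z') (fbroken z')).
  split => [e|v w uw wv] /=.
    have := ze (epush e); have := mor_ends m e; rewrite epushE => -[-> ->].
    by rewrite yt edge_length_push epushE (yl _ _ (epushE e)).
  apply: zl; last by rewrite am_pull.
  by have /orP[/(mor_incoming m)/andP[]|/(mor_outgoing m)/andP[]] := univalent_in_out uw.
by split => //= e e'; rewrite epushE => -[<-].
Qed.

End Pullback.

Lemma clsP (T : topologicalType) (r : T -> T -> Prop) x y :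
  cls r x = cls r y <-> clos_refl_sym_trans T r x y.
Proof.
split=> [/eqmodP/asboolP//|H]; exact/eqmodP/asboolP.
Qed.

Lemma cls_surj (T : topologicalType) (r : T -> T -> Prop) (z : quot r) : exists x, z = cls r x.
Proof. by exists (repr z); rewrite /cls reprK. Qed.

Lemma cls_continuous (T : topologicalType) (r : T -> T -> Prop) : continuous (cls r).
Proof. exact: pi_continuous. Qed.

(** * Nondegenerate representatives *)

Section Degenerate.
Context {R : realType} {b p q : nat}.
Implicit Types tau rho : chain R b p q.

(* A condition on the chain only, not on its augmentation, so that it is invariant under Aut(Gamma). *)
Definition nondegenerate tau : Prop := forall rho l (zeta : 'I_l.+1 -> 'I_(chain_len rho).+1) mono,
  tau = @pull R b p q rho l zeta mono -> injective zeta.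

Context {Gam : object R b p q}.

(** The two chains carry different proofs and maps of different types. With the constructors
    exposed, substitution and proof irrelevance identify them; the augmentations are compared in a
    sigma type because their types depend on [z1 i] and [z2 i]. *)
Lemma simplex_pull_eq rho l (z1 z2 : 'I_l.+1 -> 'I_(chain_len rho).+1)
  (m1 : {homo z1 : i j / (i <= j)%N}) (m2 : {homo z2 : i j / (i <= j)%N}) id1 id2 comp1 comp2
  (pi1 : augmentation Gam (@Chain R b p q l (ob rho \o z1) (fun i j le => cm rho (m1 i j le)) id1 comp1))
  (pi2 : augmentation Gam (@Chain R b p q l (ob rho \o z2) (fun i j le => cm rho (m2 i j le)) id2 comp2)) :
  z1 = z2 -> (forall i, existT (fun v => mor (ob rho v) Gam) (z1 i) (am pi1 i) =
                        existT (fun v => mor (ob rho v) Gam) (z2 i) (am pi2 i)) ->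
  existT _ _ pi1 = existT _ _ pi2 :> simplex b p q Gam.
Proof.
move=> E; subst z2; rewrite (Prop_irrelevance m2 m1) in id2 comp2 pi2 *.
rewrite (Prop_irrelevance id2 id1) (Prop_irrelevance comp2 comp1) in pi2 * => H.
suff -> : pi1 = pi2 by [].
have {H} : am pi1 = am pi2.
  by apply: functional_extensionality_dep => i; exact: (eq_from_Tagged (H i)).
case: pi1 pi2 => [am1 c1] [am2 c2] /= E; subst am2; by rewrite (Prop_irrelevance c2 c1).
Qed.

Lemma am_pull_const rho l (zeta : 'I_l.+1 -> 'I_(chain_len rho).+1) mono
  (pi : augmentation Gam (@pull R b p q rho l zeta mono)) i j : zeta i = zeta j ->
  existT (fun v => mor (ob rho v) Gam) (zeta i) (am pi i) =
  existT (fun v => mor (ob rho v) Gam) (zeta j) (am pi j).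
Proof.
have H (u v : 'I_(chain_len rho).+1) (le : (u <= v)%N) (A : mor (ob rho u) Gam) (B : mor (ob rho v) Gam) : u = v ->
    is_comp A (cm rho le) B ->
    existT (fun v => mor (ob rho v) Gam) u A = existT (fun v => mor (ob rho v) Gam) v B.
  move=> e; subst v => AB; congr existT; apply: mor_ext => c.
  by rewrite AB /= (cm_id le).
wlog ij : i j / (i <= j)%N.
  move=> W; have /orP[ij|ji] := leq_total i j; first exact: W.
  by move=> e; apply/esym; apply: W.
move=> e; apply: (H _ _ (mono _ _ ij)) => //; exact: (am_comp pi ij).
Qed.

(** A monotone map that is not injective repeats a value at two consecutive indices; the second of
    these vertices can be removed. *)
Lemma degenerate_pull tau (pi : augmentation Gam tau) : ~ nondegenerate tau ->
  exists (sigma : chain R b p q) (pi' : augmentation Gam sigma)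
    (r : 'I_(chain_len tau).+1 -> 'I_(chain_len sigma).+1) (mono : {homo r : i j / (i <= j)%N}),
    [/\ (chain_len sigma < chain_len tau)%N, r ord_max = ord_max &
     existT _ _ (pull_augmentation mono pi') = existT _ tau pi :> simplex b p q Gam].
Proof.
move=> /existsNP[rho /existsNP[l /existsNP[zeta /existsNP[mono /not_implyP[E ninj]]]]].
subst tau; have [i zi] : exists2 i : 'I_l.+1, (i < l)%N & zeta i = zeta (inord i.+1).
  apply: contrapT => H; apply: ninj => x y.
  wlog xy : x y / (x < y)%N.
    move=> W e; case: (ltngtP x y) => [xy|yx|/val_inj//]; first exact: W.
    by apply/esym; apply: W.
  move=> e; exfalso; apply: H; have xl : (x < l)%N by apply: leq_trans xy _; rewrite -ltnS.
  exists x => //; apply/val_inj/eqP; rewrite eqn_leq; apply/andP; split.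
    by apply: (mono); rewrite inordK ?ltnS.
  by rewrite e; apply: (mono); rewrite inordK ?ltnS.
rewrite /=; have l0 : (0 < l)%N by apply: leq_ltn_trans zi.
(* [theta] skips the vertex [i.+1] and [r] sends it to [i]; as [zeta] agrees at both, the face given
   by [theta], pulled back along [r], is the simplex itself. *)
move=> ezi; pose theta (j : 'I_l.-1.+1) : 'I_l.+1 := inord (bump i.+1 j).
pose r (j : 'I_l.+1) : 'I_l.-1.+1 := inord (if (j <= i)%N then (j : nat) else j.-1).
have vtheta j : theta j = bump i.+1 j :> nat.
  by rewrite inordK// /bump; have := ltn_ord j; case: leqP; lia.
have vr (j : 'I_l.+1) : r j = (if (j <= i)%N then (j : nat) else j.-1) :> nat.
  by rewrite inordK//; have := ltn_ord j; have := zi; case: ifP; lia.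
have mt : {homo theta : x y / (x <= y)%N}.
  by move=> x y; rewrite !vtheta /bump; do 2 case: leqP; lia.
have mr : {homo r : x y / (x <= y)%N}.
  by move=> x y; rewrite !vr; do 2 case: ifP; lia.
have zr j : zeta (theta (r j)) = zeta j.
  case: (eqVneq (j : nat) i.+1) => [ji|ji].
    have -> : j = inord i.+1 by apply/val_inj; rewrite /= inordK// ltnS.
    rewrite -ezi; congr zeta; apply/val_inj => /=.
    by rewrite vtheta vr inordK ?ltnS// ltnn /bump ltnn.
  congr zeta; apply/val_inj; rewrite /= vtheta vr /bump; case: ifP; case: leqP; lia.
pose sigma : chain R b p q := @pull R b p q (pull mono) l.-1 theta mt.
pose pi' : augmentation Gam sigma := @pull_augmentation R b p q (pull mono) l.-1 theta mt Gam pi.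
exists sigma, pi', r, mr; split.
- by rewrite /= prednK.
- by apply/val_inj; transitivity (nat_of_ord (r ord_max)) => //; rewrite vr /= leqNgt zi.
- have := @simplex_pull_eq rho l (zeta \o theta \o r) zeta (fun x y xy => mono _ _ (mt _ _ (mr _ _ xy))) mono
    _ _ _ _ (@pull_augmentation R b p q sigma _ r mr Gam pi') pi.
  apply; first by apply/funext => j; exact: zr.
  by move=> j; exact: (am_pull_const pi (zr j)).
Qed.

End Degenerate.

Section Reduction.
Context {R : realType} {n : nat} {M : uniformType} {g : riemannian R n M} (f : M -> R).
Context {b p q : nat} {Gam : object R b p q} (a : leaf Gam -> M).

Definition flows (x : pre_S g Gam) : set (piecewise_flows g f a) :=
  [set P | exists z (H : is_flow f a (projT2 (projT1 x)) (sval (projT2 x)) z),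
    P = piecewise_flow_pt (pre_flow_pt (exist _ (projT2 x, z) H))].

Definition sim (x x' : pre_S g Gam) : Prop := M_Gamma_pt x = M_Gamma_pt x' /\ flows x `<=` flows x'.

Lemma sim_refl x : sim x x. Proof. by split. Qed.

Lemma sim_trans x y z : sim x y -> sim y z -> sim x z.
Proof. by move=> [e H] [e' H']; split; [rewrite e|exact: subset_trans H H']. Qed.

Section Glue.
Context (tau : chain R b p q) (pi : augmentation Gam tau).
Context l (theta : 'I_l.+1 -> 'I_(chain_len tau).+1) (mono : {homo theta : i j / (i <= j)%N}).

Lemma sim_restrict (y : structure g tau) (y' : structure g (pull mono)) :
  same_structure (sval y) (sval y') ->
  sim (pre_S_pt pi y) (pre_S_pt (pull_augmentation mono pi) y').
Proof.
move=> yy'; split.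
  by congr cls; apply/clsP/rst_step; exact: GlueS.
move=> _ [z [H ->]]; have [z' H' zz'] := restrict_flow yy' H; exists z', H'.
congr cls; apply/clsP/rst_step.
exact: (GlueFlow (u := exist _ (y, z) H) (u' := exist _ (y', z') H')).
Qed.

Lemma sim_extend (y : structure g tau) (y' : structure g (pull mono)) : theta ord_max = ord_max ->
  same_structure (sval y) (sval y') ->
  sim (pre_S_pt (pull_augmentation mono pi) y') (pre_S_pt pi y).
Proof.
move=> tm yy'; split.
  by congr cls; apply/clsP/rst_sym/rst_step; exact: GlueS.
move=> _ [z' [H' ->]]; have [z H zz'] := extend_flow tm yy' H'; exists z, H.
congr cls; apply/clsP/rst_sym/rst_step.
exact: (GlueFlow (u := exist _ (y, z) H) (u' := exist _ (y', z') H')).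
Qed.

End Glue.

Lemma is_aut_inv (alpha : mor Gam Gam) : is_aut alpha -> exists beta : mor Gam Gam, [/\ is_aut beta,
  cancel (mcell alpha) (mcell beta) & cancel (mcell beta) (mcell alpha)].
Proof.
move=> [[beta [ab ba]] fix_]; exists beta; split => //; split; first by exists alpha.
by move=> v /fix_ av; have [] := ab (inl v); rewrite av.
Qed.

(** Aut(Gamma) changes the augmentation only: the chain stays literally the same, and with it the
    type of the labels. *)
Inductive aut_simplex : simplex b p q Gam -> simplex b p q Gam -> Prop :=
| AutSimplex alpha tau (pi pi' : augmentation Gam tau) : is_aut alpha ->
    (forall i, is_comp alpha (am pi i) (am pi' i)) -> aut_simplex (existT _ tau pi) (existT _ tau pi').

Lemma aut_simplex_sym s s' : aut_simplex s s' -> aut_simplex s' s.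
Proof.
case=> alpha tau pi pi' Aa comp; have [beta [Ab ab ba]] := is_aut_inv Aa.
by apply: (AutSimplex (alpha := beta)) => // i c; rewrite /= comp /= ab.
Qed.

Lemma sim_aut alpha tau (pi pi' : augmentation Gam tau) (y : structure g tau) : is_aut alpha ->
  (forall i, is_comp alpha (am pi i) (am pi' i)) -> sim (pre_S_pt pi y) (pre_S_pt pi' y).
Proof.
move=> Aa comp; split; first by apply/clsP/rst_step; exact: AutS comp.
move=> _ [z [H ->]].
have H' : is_flow f a pi' (sval y) z.
  case: H => H1 H2; split => // v w uw wv; apply: H2 => //.
  have [beta [Ab ab ba]] := is_aut_inv Aa.
  have [E] := comp ord_max (inl w); have [E'] := ab (inl (mv (am pi ord_max) w)).
  by rewrite -E' -E wv; apply: Ab.2; exact: svalP v.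
exists z, H'; apply/clsP/rst_step; exact: (AutFlow (alpha := alpha)).
Qed.

Lemma sim_aut_clos s s' : clos_refl_sym_trans _ aut_simplex s s' -> forall y : structure g (projT1 s),
  exists2 y' : structure g (projT1 s'), sim (existT _ s y : pre_S g Gam) (existT _ s' y') &
    existT (@structure R n M g b p q) _ y = existT (@structure R n M g b p q) _ y'.
Proof.
pose P u v := forall y : structure g (projT1 u), exists2 y' : structure g (projT1 v),
  sim (existT _ u y : pre_S g Gam) (existT _ v y') &
  existT (@structure R n M g b p q) _ y = existT (@structure R n M g b p q) _ y'.
have step u v : aut_simplex u v -> P u v.
  by case=> alpha tau pi pi' Aa comp y; exists y => //; exact: sim_aut comp.
move=> ss'; suff : P s s' /\ P s' s by case.
elim: ss' => [u v uv|u|u v _ [H1 H2]|u v w _ [H1 H2] _ [H3 H4]].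
- by split; apply: step => //; exact: aut_simplex_sym.
- by split => y; exists y => //; exact: sim_refl.
- by [].
- by split => y; [have [y1 S1 E1] := H1 y; have [y2 S2 E2] := H3 y1|
    have [y1 S1 E1] := H4 y; have [y2 S2 E2] := H2 y1];
    exists y2; [exact: sim_trans S1 S2|rewrite E1|exact: sim_trans S1 S2|rewrite E1].
Qed.

Definition reduced (x : pre_S g Gam) : Prop :=
  nondegenerate (projT1 (projT1 x)) /\ forall i, 0 < (sval (projT2 x)).1 0 i.

(** Each step shortens the chain: a degenerate simplex is replaced by the one that it comes from,
    and a vertex of weight 0 is deleted. *)
Lemma reduce x : exists2 x', sim x x' & reduced x'.
Proof.
have [k] := ubnP (chain_len (projT1 (projT1 x))); elim: k x => // k IH [[tau pi] y] /= ltk.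
have [y0 y1 yi] := svalP y.
have [nd|/(degenerate_pull pi)] := pselect (nondegenerate tau); last first.
  move=> [sigma [pi' [r [mr [ll rmax E]]]]].
  have step (y2 : structure g (pull mr)) : exists2 x', sim (pre_S_pt (pull_augmentation mr pi') y2) x' & reduced x'.
    have [y3 /(sim_extend pi' rmax) S3] := extend_structure rmax y2.
    have [|x' S4 rx'] := IH (pre_S_pt pi' y3); first by apply: leq_trans ll _; rewrite -ltnS.
    by exists x' => //; exact: sim_trans S3 S4.
  (* Quantifying over the simplex lets the equality [E] transport the structure [y]. *)
  suff : forall s : simplex b p q Gam, existT _ _ (pull_augmentation mr pi') = s ->
      forall y : structure g (projT1 s), exists2 x', sim (existT _ s y : pre_S g Gam) x' & reduced x' by move=> /(_ _ E).
  by move=> s <-.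
have [tpos|/existsNP[i ti]] := pselect (forall i, 0 < (sval y).1 0 i).
  by exists (pre_S_pt pi y); [exact: sim_refl|split].
have {}ti : (sval y).1 0 i = 0 by apply/eqP; rewrite eq_le y0 andbT leNgt; exact/negP.
have k0 : (0 < chain_len tau)%N.
  rewrite lt0n; apply/negP => /eqP k0; have := y1; rewrite big1 => [|j _].
    by move/esym/eqP; rewrite oner_eq0.
  rewrite -ti; congr ((sval y).1 0 _); apply/val_inj.
  by have := ltn_ord j; have := ltn_ord i; rewrite !ltnS {2 4}k0 /=; lia.
(* The face omitting [i]. It exists because the weights sum to 1, so that [i] is not the only
   vertex. *)
pose theta (j : 'I_(chain_len tau).-1.+1) : 'I_(chain_len tau).+1 := inord (bump i j).
have vtheta j : theta j = bump i j :> nat.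
  by rewrite inordK// /bump; have := ltn_ord j; case: leqP; lia.
have mt : {homo theta : x y / (x <= y)%N}.
  by move=> x z; rewrite !vtheta /bump; do 2 case: leqP; lia.
pose t : 'rV[R]_(chain_len tau).-1.+1 := \row_j (sval y).1 0 (theta j).
have pt : (sval y).1 = push theta t.
  apply/rowP => v; rewrite mxE; have [->|vi] := eqVneq v i.
    rewrite ti big1// => j /eqP /(congr1 (@nat_of_ord _)); rewrite vtheta => e.
    by have := neq_bump i j; rewrite e eqxx.
  have vi' : (v : nat) != i by [].
  have uv : (unbump i v < (chain_len tau).-1.+1)%N.
    have lv : (v < (chain_len tau).+1)%N := ltn_ord v; have li : (i < (chain_len tau).+1)%N := ltn_ord i.
    by rewrite prednK// /unbump; move: vi' lv li k0; case: ltngtP => //=; lia.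
  have tv : theta (Ordinal uv) = v.
    apply/val_inj; transitivity (nat_of_ord (theta (Ordinal uv))) => //.
    by rewrite vtheta /= unbumpK.
  rewrite (bigD1 (Ordinal uv)) ?tv//= mxE tv big1 ?addr0// => j /andP[/eqP jv /eqP ju].
  exfalso; apply: ju; apply/val_inj => /=.
  by rewrite -[LHS](bumpK i) -vtheta jv.
have [|y' [y't yy']] := restrict_structure (theta := theta) mt (y := y) (t := t) _ pt.
  by move=> j; rewrite mxE.
have [|x' S rx'] := IH (pre_S_pt (pull_augmentation mt pi) y').
  by rewrite /= -ltnS prednK.
by exists x' => //; apply: sim_trans S; exact: sim_restrict.
Qed.

End Reduction.

Lemma quot_factor (T Y : topologicalType) (r : T -> T -> Prop) (h : T -> Y) : continuous h ->
  (forall x y, r x y -> h x = h y) -> exists h' : quot r -> Y, continuous h' /\ forall x, h' (cls r x) = h x.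
Proof.
move=> ch hr; have H x y : clos_refl_sym_trans T r x y -> h x = h y.
  by elim=> [u v /hr|u|u v _ ->|u v w _ -> _ ->].
have E x : h (repr (cls r x)) = h x by apply/H/clsP; rewrite /cls reprK.
exists (h \o repr); split=> //; apply/quotient_continuous.
by rewrite (_ : _ \o _ = h)//; apply/funext => x; exact: E.
Qed.

(** * Invariant functions on the homotopy colimit *)

Section Telescope.
Context {R : realType}.
Implicit Types (Psi : R -> R).

Lemma telescope_pred Psi (u : nat -> R) (P : pred nat) n :
  (forall i j, (i <= j)%N -> P j -> P i) ->
  \sum_(i < n | P i) (Psi (\sum_(j < i.+1) u j) - Psi (\sum_(j < i) u j)) =
  Psi (\sum_(i < n | P i) u i) - Psi 0.
Proof.
move=> Pd; elim: n => [|n IH]; first by rewrite !big_ord0 subrr.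
rewrite [LHS]big_mkcond [X in Psi X]big_mkcond !big_ord_recr /= -!big_mkcond /= IH.
case: ifP => Pn; last by rewrite !addr0.
have -> : \sum_(i < n | P i) u i = \sum_(i < n) u i.
  by apply: eq_bigl => i; apply: Pd Pn; exact: ltnW.
by ring.
Qed.

Definition cum n (t : 'rV[R]_n.+1) (j : nat) : R := \sum_(i < j) t 0 (inord i).

(** With [Psi] the identity these are the coordinates of [t]; for any other [Psi] they still
    telescope. *)
Definition dcum Psi n (t : 'rV[R]_n.+1) (j : 'I_n.+1) : R := Psi (cum t j.+1) - Psi (cum t j).

Lemma dcum_id n (t : 'rV[R]_n.+1) j : dcum id t j = t 0 j.
Proof. by rewrite /dcum /cum big_ord_recr /= inord_val addrAC subrr add0r. Qed.

(** The indices with [zeta i < w] form an initial segment, so partial sums of [push zeta t] are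
    partial sums of [t], and the increments over a fiber telescope. *)
Lemma dcum_push Psi l k (zeta : 'I_l.+1 -> 'I_k.+1) (t : 'rV[R]_l.+1) v :
  {homo zeta : i j / (i <= j)%N} ->
  \sum_(j | zeta j == v) dcum Psi t j = dcum Psi (push zeta t) v.
Proof.
move=> mono; have split_lt (F : 'I_l.+1 -> R) (w : 'I_k.+1) :
    \sum_(i | (zeta i < w.+1)%N) F i = \sum_(i | (zeta i < w)%N) F i + \sum_(i | zeta i == w) F i.
  rewrite (bigID (fun i => zeta i == w)) /= addrC; congr (_ + _); apply: eq_bigl => i.
    by rewrite ltnS ltn_neqAle andbC.
  by rewrite andbC; case: eqVneq => //= ->; rewrite ltnS leqnn.
have cumE w : (w <= k.+1)%N -> cum (push zeta t) w = \sum_(i | (zeta i < w)%N) t 0 i.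
  elim: w => [|w IH] wk; first by rewrite /cum big_ord0 big1// => i; rewrite ltn0.
  rewrite /cum big_ord_recr /= -/(cum _ _) IH 1?ltnW//.
  by have := split_lt (t 0) (inord w); rewrite inordK// => ->; rewrite mxE.
have S (w : nat) : \sum_(i | (zeta i < w)%N) dcum Psi t i = Psi (\sum_(i | (zeta i < w)%N) t 0 i) - Psi 0.
  have := @telescope_pred Psi (fun i => t 0 (inord i)) (fun i => (i < l.+1)%N && (zeta (inord i) < w)%N) l.+1.
  have E (F : 'I_l.+1 -> R) : \sum_(i < l.+1 | (i < l.+1)%N && (zeta (inord i) < w)%N) F i =
      \sum_(i | (zeta i < w)%N) F i by apply: eq_bigl => i; rewrite ltn_ord inord_val.
  rewrite !E; under [X in Psi X]eq_bigr do rewrite inord_val.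
  move=> <-; first by apply: eq_bigr => i _.
    move=> i j ij /andP[jl zj]; rewrite (leq_ltn_trans ij)//=; apply: leq_ltn_trans zj.
    by apply: mono; rewrite !inordK// (leq_ltn_trans ij).
apply: (@addrI _ (\sum_(j | (zeta j < v)%N) dcum Psi t j)).
have v1 : (v.+1 <= k.+1)%N := ltn_ord v.
by rewrite -split_lt !S /dcum (cumE v.+1 v1) (cumE v (ltnW v1)); ring.
Qed.

End Telescope.

Section Faces.
Context {R : realType} {n : nat} {M : topologicalType} {g : riemannian R n M}.
Context {b p q : nat} {Gam : object R b p q}.
Implicit Types tau : chain R b p q.

Definition labels tau : Type := edge (top tau) -> Cinfty g.

Definition restrict tau l (theta : 'I_l.+1 -> 'I_(chain_len tau).+1) (mono : {homo theta : i j / (i <= j)%N})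
  (L : labels tau) : labels (pull mono) := fun e => L (elift (from_top tau (theta ord_max)) e).

Arguments restrict {tau l theta} mono L e.

Context (B : forall tau, augmentation Gam tau -> labels tau -> R).

Lemma test_chain l (o : 'I_l.+1 -> object R b p q) (c1 c2 : forall i j : 'I_l.+1, (i <= j)%N -> mor (o j) (o i))
  i1 i2 k1 k2 (A : forall i, mor (o i) Gam) a1 a2 (L1 L2 : edge (o ord_max) -> Cinfty g) :
  c1 = c2 -> L1 = L2 ->
  @B (@Chain R b p q l o c1 i1 k1) (@Augmentation R b p q Gam (Chain i1 k1) A a1) L1 =
  @B (@Chain R b p q l o c2 i2 k2) (@Augmentation R b p q Gam (Chain i2 k2) A a2) L2.
Proof.
move=> Ec EL; subst c2 L2; rewrite (Prop_irrelevance i2 i1) (Prop_irrelevance k2 k1) in a2 *.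
by rewrite (Prop_irrelevance a2 a1).
Qed.

(** The value 0 at maps that are not monotone lets sums run over all finite functions. *)
Definition face tau (pi : augmentation Gam tau) (L : labels tau) l (theta : 'I_l.+1 -> 'I_(chain_len tau).+1) : R :=
  match pselect {homo theta : i j / (i <= j)%N} with
  | left mono => B (pull_augmentation mono pi) (restrict mono L)
  | right _ => 0
  end.

Lemma faceE tau (pi : augmentation Gam tau) (L : labels tau) l (theta : 'I_l.+1 -> 'I_(chain_len tau).+1)
  (mono : {homo theta : i j / (i <= j)%N}) :
  face pi L theta = B (pull_augmentation mono pi) (restrict mono L).
Proof. by rewrite /face; case: pselect => // m; rewrite (Prop_irrelevance m mono). Qed.

Lemma face_id tau (pi : augmentation Gam tau) (L : labels tau) : face pi L id = B pi L.
Proof.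
have mid : {homo (@id 'I_(chain_len tau).+1) : i j / (i <= j)%N} by [].
rewrite (faceE _ _ mid).
case: tau pi L mid => k o c ci cc [A a] L mid; apply: test_chain.
  do 3 (apply: functional_extensionality_dep => ?); congr (c _ _ _); exact: Prop_irrelevance.
by apply/funext => e; rewrite /restrict; congr L; apply/esym/elift_uniq; exact: (ci ord_max _ (inr e)).
Qed.

(** If [theta \o theta'] is monotone but [theta'] is not, then the composite is not injective; it
    gives a degenerate simplex, on which [B] vanishes, and both sides are 0. *)
Lemma face_comp tau (pi : augmentation Gam tau) (L : labels tau) l (theta : 'I_l.+1 -> 'I_(chain_len tau).+1)
  (mono : {homo theta : i j / (i <= j)%N}) l' (theta' : 'I_l'.+1 -> 'I_l.+1) :
  (forall c (pc : augmentation Gam c) (Lc : labels c), ~ nondegenerate c -> B pc Lc = 0) ->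
  @face (pull mono) (pull_augmentation mono pi) (restrict mono L) l' theta' = face pi L (theta \o theta').
Proof.
move=> Bnd; have [m'|nm'] := pselect {homo theta' : i j / (i <= j)%N}; last first.
  rewrite /face; case: pselect => //; case: pselect => // mc _.
  have [nd|/Bnd->//] := pselect (nondegenerate (pull mc)).
  exfalso; apply: nm' => i j ij; have tinj : injective (theta \o theta') by exact: (nd tau _ _ mc erefl).
  rewrite leqNgt; apply/negP => ji; have := mono _ _ (ltnW ji) => h.
  have e : (theta \o theta') i = (theta \o theta') j.
    by apply/val_inj/eqP; rewrite eqn_leq h andbT; exact: (mc _ _ ij).
  by move: ji; rewrite (tinj _ _ e) ltnn.
have mc : {homo (theta \o theta') : i j / (i <= j)%N} by move=> i j ij; apply: mono; exact: m'.
rewrite (faceE (tau := pull mono) _ _ m') (faceE _ _ mc).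
apply: (@test_chain l' (ob tau \o theta \o theta') (fun i j le => cm tau (mono _ _ (m' _ _ le)))
  (fun i j le => cm tau (mc _ _ le)) _ _ _ _ (fun i => am pi (theta (theta' i)))).
  by do 3 (apply: functional_extensionality_dep => ?); congr (cm _ _); exact: Prop_irrelevance.
apply/funext => e; rewrite /restrict; congr L; apply: elift_uniq.
by rewrite (from_top_pull mono) !elift_me.
Qed.

End Faces.

Arguments labels {R n M} g {b p q} tau.
Arguments restrict {R n M g b p q tau l theta} mono L e.

Section Invariants.
Context {R : realType} {n : nat} {M : topologicalType} {g : riemannian R n M}.
Context {b p q : nat} {Gam : object R b p q}.
Implicit Types tau : chain R b p q.

Definition invariant (h : pre_S g Gam -> R) : Prop :=
  [/\ continuous h, forall x x', glue_S x x' -> h x = h x' &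
   forall alpha tau (pi pi' : augmentation Gam tau) (y : structure g tau), is_aut alpha ->
     (forall i, is_comp alpha (am pi i) (am pi' i)) -> h (pre_S_pt pi y) = h (pre_S_pt pi' y)].

Lemma invariant_factor h : invariant h -> exists h' : M_Gamma g Gam -> R,
  continuous h' /\ forall x, h' (M_Gamma_pt x) = h x.
Proof.
move=> [ch hg ha]; have [h1 [ch1 H1]] := quot_factor ch hg.
have [|h2 [ch2 H2]] := @quot_factor _ _ (@aut_S R n M g b p q Gam) h1 ch1.
  by move=> _ _ [alpha tau pi pi' y Aa comp]; rewrite !H1; exact: ha comp.
by exists h2; split => // x; rewrite /M_Gamma_pt H2.
Qed.

(** Continuity is asked at injective labels only, where the families summed later are locally
    finite. *)
Definition test (B : forall tau, augmentation Gam tau -> labels g tau -> R) : Prop :=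
  [/\ forall tau (pi : augmentation Gam tau) L, ~ nondegenerate tau -> B tau pi L = 0,
   forall alpha tau (pi pi' : augmentation Gam tau) L, is_aut alpha ->
     (forall i, is_comp alpha (am pi i) (am pi' i)) -> B tau pi L = B tau pi' L &
   forall tau (pi : augmentation Gam tau) (F : set_system (labels g tau)) (L0 : labels g tau),
     Filter F -> injective L0 -> F [set L : labels g tau | injective L] ->
     (forall e, (fun L : labels g tau => L e : CinftyT g) @ F --> (L0 e : CinftyT g)) -> B tau pi @ F --> B tau pi L0].

Context (B : forall tau, augmentation Gam tau -> labels g tau -> R) (tB : test B).

(* The weight of a face theta is the product of the increments of the Psi i over the steps theta i of the
   partial sums of t.  Along a degeneracy the increments telescope, whence the invariance under gluing. *)
Definition phi (Psi : nat -> R -> R) l (x : pre_S g Gam) : R :=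
  let pi := projT2 (projT1 x) in let y := sval (projT2 x) in
  \sum_(theta : {ffun 'I_l.+1 -> 'I_(chain_len (projT1 (projT1 x))).+1})
    face B pi y.2 theta * \prod_(i < l.+1) dcum (Psi i) y.1 (theta i).

Lemma phi_glue Psi l x x' : glue_S x x' -> phi Psi l x = phi Psi l x'.
Proof.
case=> tau pi l' theta mono y y' [yt yl]; rewrite /phi /= yt.
have yE : (sval y').2 = restrict mono (sval y).2.
  by apply/funext => e; rewrite /restrict -(yl (elift (from_top tau (theta ord_max)) e) e)// elift_me.
have [Bnd _ _] := tB; rewrite yE.
(* Faces of the pullback are grouped by their composite [t] with [theta]; expanding the product of
   the sums over fibers gives the same sum over the [t'] above [t]. *)
rewrite (partition_big (fun t' : {ffun 'I_l.+1 -> 'I_l'.+1} => [ffun i => theta (t' i)]) xpredT)//=.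
apply: eq_bigr => t _; under [in LHS]eq_bigr do rewrite -dcum_push//.
rewrite bigA_distr_big_dep big_distrr /=; apply: eq_big => t'.
  apply/familyP/eqP => [H|<- i]; last by rewrite unfold_in ffunE.
  by apply/ffunP => i; rewrite ffunE; exact/eqP/H.
move=> /familyP H; rewrite (face_comp _ _ _ _ Bnd); congr (face _ _ _ _ * _).
by apply/funext => i /=; apply/esym/eqP/H.
Qed.

Lemma phi_aut Psi l alpha tau (pi pi' : augmentation Gam tau) (y : structure g tau) : is_aut alpha ->
  (forall i, is_comp alpha (am pi i) (am pi' i)) -> phi Psi l (pre_S_pt pi y) = phi Psi l (pre_S_pt pi' y).
Proof.
move=> Aa comp; apply: eq_bigr => t _; congr (_ * _); rewrite /face; case: pselect => // m.
by have [_ Ba _] := tB; apply: Ba Aa _ => i; exact: comp.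
Qed.

Lemma phi_high Psi l x : (chain_len (projT1 (projT1 x)) < l)%N -> phi Psi l x = 0.
Proof.
move=> lt; apply: big1 => t _; rewrite /face; case: pselect => [m|_]; last by rewrite mul0r.
have [nd|/(let: And3 H _ _ := tB in H) ->] := pselect (nondegenerate (pull m)); last by rewrite mul0r.
by have := leq_card _ (nd _ _ _ m erefl); rewrite !card_ord ltnS leqNgt lt.
Qed.

Lemma structure_cvg tau (y0 : structureT g tau) :
  (fun y : structureT g tau => (sval y).1) @ y0 --> (sval y0).1 /\
  forall e, (fun y : structureT g tau => (sval y).2 e : CinftyT g) @ y0 --> ((sval y0).2 e : CinftyT g).
Proof.
have H : (fun y : structureT g tau => sval y : raw_structureT g tau) @ y0 --> (sval y0 : raw_structureT g tau).
  exact: induced_continuous.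
split; first by apply: cvg_comp H _; exact: cvg_fst.
move=> e; apply: (@prod_proj _ (fun _ : edge (top tau) => CinftyT g) _ (nbhs y0) (nbhs_filter y0) (fun y : structureT g tau => (sval y).2)).
by apply: cvg_comp H _; exact: cvg_snd.
Qed.

Lemma dcum_cvg (Psi : R -> R) k (T : Type) (F : set_system T) {FF : Filter F} (t : T -> 'rV[R]_k.+1) t0 j :
  continuous Psi -> t @ F --> t0 -> dcum Psi (t x) j @[x --> F] --> dcum Psi t0 j.
Proof.
move=> cP tt; have cc i : cum (t x) i @[x --> F] --> cum t0 i.
  by rewrite /cum; apply: cvg_big => [|i' _]; [exact: add_continuous|exact: cvg_coord].
by apply: cvgB; (apply: cvg_comp (cc _) _; exact: cP).
Qed.

Lemma phi_cvg Psi l tau (pi : augmentation Gam tau) (T : Type) (F : set_system T) {FF : Filter F}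
  (y : T -> structure g tau) (y0 : structure g tau) : (forall i, continuous (Psi i)) ->
  (sval (y x)).1 @[x --> F] --> (sval y0).1 ->
  (forall e, ((sval (y x)).2 e : CinftyT g) @[x --> F] --> ((sval y0).2 e : CinftyT g)) ->
  phi Psi l (pre_S_pt pi (y x)) @[x --> F] --> phi Psi l (pre_S_pt pi y0).
Proof.
move=> cP ct cl; rewrite /phi /=.
apply: cvg_big => [|t _]; first exact: add_continuous.
apply: cvgM; last by apply: cvg_big => [|i _]; [exact: mul_continuous|exact: dcum_cvg].
rewrite /face; case: pselect => [m|_]; last exact: cvg_cst.
have [_ _ Bc] := tB.
have hinj (y1 : structure g tau) : injective (restrict m (sval y1).2).
  by have [_ _ yi] := svalP y1; move=> e e' /yi /elift_inj.
pose h x := restrict m (sval (y x)).2.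
apply: (@Bc _ (pull_augmentation m pi) (h @ F) (restrict m (sval y0).2) _ (hinj y0)).
- by apply: nearW => x; exact: hinj.
- by move=> e; exact: cl.
Qed.

Lemma phi_continuous Psi l : (forall i, continuous (Psi i)) -> continuous (phi Psi l).
Proof.
move=> cP; apply: (@sigT_continuous _ (fun s : {classic simplex b p q Gam} => structureT g (projT1 s)) _
  (fun s y => phi Psi l (existT _ s y))) => -[tau pi] y0.
have [ct cl] := structure_cvg y0; exact: (@phi_cvg Psi l tau pi _ (nbhs y0) (nbhs_filter y0) id).
Qed.

Lemma phi_invariant Psi l : (forall i, continuous (Psi i)) -> invariant (phi Psi l).
Proof. by move=> cP; split; [exact: phi_continuous|exact: phi_glue|exact: phi_aut]. Qed.

(** Faces of all dimensions count, which admits tests that are nonzero in infinitely many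
    dimensions; by [phi_high] the summation bound may be raised at will. *)
Definition phi_sum (x : pre_S g Gam) : R := \sum_(l < (chain_len (projT1 (projT1 x))).+1) phi (fun=> id) l x.

Lemma phi_sum_cvg tau (pi : augmentation Gam tau) (T : Type) (F : set_system T) {FF : Filter F}
  (y : T -> structure g tau) (y0 : structure g tau) :
  (sval (y x)).1 @[x --> F] --> (sval y0).1 ->
  (forall e, ((sval (y x)).2 e : CinftyT g) @[x --> F] --> ((sval y0).2 e : CinftyT g)) ->
  phi_sum (pre_S_pt pi (y x)) @[x --> F] --> phi_sum (pre_S_pt pi y0).
Proof.
move=> ct cl; rewrite /phi_sum /=; apply: cvg_big => [|l _]; first exact: add_continuous.
by apply: phi_cvg => // _ x; exact: cvg_id.
Qed.

Lemma phi_sum_invariant : invariant phi_sum.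
Proof.
have cid i : continuous ((fun=> id) i : R -> R) by move=> x; exact: cvg_id.
have tE k x : (chain_len (projT1 (projT1 x)) <= k)%N -> phi_sum x = \sum_(l < k.+1) phi (fun=> id) l x.
  move=> xk; rewrite -(subnKC xk); elim: (k - _)%N => [|m ->]; first by rewrite addn0.
  by rewrite addnS [RHS]big_ord_recr /= [X in _ + X]phi_high ?addr0// ltnS leq_addr.
split.
- apply: (@sigT_continuous _ (fun s : {classic simplex b p q Gam} => structureT g (projT1 s)) _
    (fun s y => phi_sum (existT _ s y))) => -[tau pi] y0; have [ct cl] := structure_cvg y0.
  exact: (@phi_sum_cvg tau pi _ (nbhs y0) (nbhs_filter y0) id y0 ct cl).
- move=> x x' xx'; set k := (chain_len (projT1 (projT1 x)) + chain_len (projT1 (projT1 x')))%N.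
  rewrite (tE k) ?leq_addr// (tE k x') ?leq_addl//; apply: eq_bigr => l _; exact: phi_glue.
- by move=> alpha tau pi pi' y Aa comp; apply: eq_bigr => l _; exact: phi_aut comp.
Qed.

(** Here [i <= theta i] for all [i], and the sums of both sides over all [i] are equal. *)
Lemma mono_inj_id k (theta : 'I_k -> 'I_k) : {homo theta : i j / (i <= j)%N} -> injective theta -> theta =1 id.
Proof.
move=> mono inj; have ge (i : 'I_k) : (i <= theta i)%N.
  case: i => i; elim: i => // i IH lt; have := IH (ltnW lt); set a := Ordinal (ltnW lt) => /leq_ltn_trans; apply.
  rewrite ltn_neqAle mono//= andbT; apply/negP => /eqP/val_inj/inj/(congr1 val)/= /eqP.
  by rewrite ltn_eqF.
have [_] := @leqif_sum _ xpredT (fun i => val i == val (theta i)) (fun i : 'I_k => val i) (fun i => val (theta i))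
  (fun i _ => leqif_eq (ge i)).
rewrite -(reindex_inj (P := xpredT) (F := fun i => val i) inj) /= eqxx => /esym/forallP H i.
by apply/val_inj/esym/eqP; exact: H.
Qed.

Lemma phi_top Psi (x : pre_S g Gam) (k := chain_len (projT1 (projT1 x))) :
  phi Psi k x = B (projT2 (projT1 x)) (sval (projT2 x)).2 * \prod_(i < k.+1) dcum (Psi i) (sval (projT2 x)).1 i.
Proof.
rewrite /phi (bigD1 [ffun i => i])//= [X in _ + X]big1 ?addr0.
  have -> : ([ffun i : 'I_k.+1 => i] : 'I_k.+1 -> 'I_k.+1) = id by apply/funext => i; rewrite ffunE.
  by rewrite face_id.
move=> t tid; rewrite /face; case: pselect => [m|_]; last by rewrite mul0r.
have [nd|/(let: And3 H _ _ := tB in H) ->] := pselect (nondegenerate (pull m)); last by rewrite mul0r.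
have := mono_inj_id m (nd _ _ _ m erefl) => H; case/eqP: tid; apply/ffunP => i; by rewrite ffunE H.
Qed.

Lemma phi_sum_ge (x : pre_S g Gam) : (forall tau (pi : augmentation Gam tau) L, 0 <= B pi L) ->
  B (projT2 (projT1 x)) (sval (projT2 x)).2 *
    \prod_(i < (chain_len (projT1 (projT1 x))).+1) (sval (projT2 x)).1 0 i <= phi_sum x.
Proof.
move=> B0; have [t0 _ _] := svalP (projT2 x).
rewrite [leRHS](bigD1 ord_max)//=.
have -> := phi_top (fun=> id) x.
under [X in _ <= _ * X + _]eq_bigr do rewrite dcum_id.
rewrite lerDl; apply: sumr_ge0 => l _; apply: sumr_ge0 => t _; apply: mulr_ge0.
  by rewrite /face; case: pselect.
by apply: prodr_ge0 => i _; rewrite dcum_id.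
Qed.

End Invariants.

Lemma cvg_pair_top (X Y : topologicalType) (T : Type) (F : set_system T) {FF : Filter F} (u : T -> X * Y) (l : X * Y) :
  (u t).1 @[t --> F] --> l.1 -> (u t).2 @[t --> F] --> l.2 -> u @ F --> l.
Proof.
case: l => x y /= ux uy; have E : u = (fun t => ((u t).1, (u t).2)) by apply/funext => t; case: (u t).
by rewrite E; exact: cvg_pair.
Qed.

Lemma separated_sequence (X : Type) (G : X -> Prop) (E : X -> X -> Prop) :
  (forall l : seq X, exists2 x, G x & forall s, List.In s l -> ~ E s x) ->
  exists x : nat -> X, (forall j, G (x j)) /\ forall i j, (i < j)%N -> ~ E (x i) (x j).
Proof.
move=> H; have /boolp.choice[f Hf] : forall l, exists x, G x /\ forall s, List.In s l -> ~ E s x.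
  by move=> l; have [x Gx Ex] := H l; exists x.
pose l := fix l j := if j is j'.+1 then f (l j') :: l j' else [::].
exists (fun j => f (l j)); split=> [j|i j ij]; first by have [] := Hf (l j).
apply: (Hf (l j)).2; elim: j ij => // j IH; rewrite ltnS leq_eqVlt => /orP[/eqP->|/IH]; by [left|right].
Qed.

Lemma Cinfty_ext (R : realType) n (M : topologicalType) (g : riemannian R n M) (h h' : Cinfty g) :
  sval h = sval h' -> h = h'.
Proof. by case: h h' => [h sh] [h' sh'] /= e; subst h'; rewrite (Prop_irrelevance sh' sh). Qed.

(** * Consequences of the compactness of N *)

Section Tests.
Context {R : realType} {n : nat} {M : uniformType} {g : riemannian R n M}.
Context {b p q : nat} {Gam : object R b p q}.
Implicit Types tau : chain R b p q.

Definition autrel : simplex b p q Gam -> simplex b p q Gam -> Prop := clos_refl_sym_trans _ (@aut_simplex R b p q Gam).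

Definition label_continuous tau (beta : labels g tau -> R) : Prop :=
  forall (F : set_system (labels g tau)) (L0 : labels g tau),
    Filter F -> injective L0 -> F [set L : labels g tau | injective L] ->
    (forall e, (fun L : labels g tau => L e : CinftyT g) @ F --> (L0 e : CinftyT g)) -> beta @ F --> beta L0.

Definition class_test (beta : simplex b p q Gam -> R) tau (pi : augmentation Gam tau) (L : labels g tau) : R :=
  if `[< nondegenerate tau >] then beta (existT _ tau pi) else 0.

Lemma class_testP beta : (forall s s', aut_simplex s s' -> beta s = beta s') -> test (class_test beta).
Proof.
move=> H; split.
- by move=> tau pi L nd; rewrite /class_test asboolF.
- move=> alpha tau pi pi' L Aa comp; rewrite /class_test; case: ifP => // _; apply: H; exact: AutSimplex comp.
- by move=> *; rewrite /class_test; exact: cvg_cst.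
Qed.

(** Concentrated on one Aut(Gamma)-class; equivalent simplices share their chain, so labels are
    compared through a proof of [tau = tau0]. *)
Definition label_test tau0 (pi0 : augmentation Gam tau0) (beta : labels g tau0 -> R) tau
    (pi : augmentation Gam tau) (L : labels g tau) : R :=
  match pselect (tau = tau0) with
  | left e => if `[< autrel (existT _ tau0 pi0) (existT _ tau pi) >] then beta (eq_rect _ (labels g) L _ e) else 0
  | right _ => 0
  end.

Lemma label_testE tau (pi pi' : augmentation Gam tau) beta L :
  autrel (existT _ tau pi) (existT _ tau pi') -> label_test pi beta pi' L = beta L.
Proof.
move=> H; rewrite /label_test; case: pselect => // e; rewrite asboolT//.
by rewrite (Prop_irrelevance e erefl).
Qed.

Lemma label_testP tau (pi : augmentation Gam tau) beta : nondegenerate tau -> label_continuous beta ->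
  test (label_test pi beta).
Proof.
move=> nd cb; split.
- by move=> tau' pi' L nd'; rewrite /label_test; case: pselect => // e; subst.
- move=> alpha tau' pi1 pi2 L Aa comp; rewrite /label_test; case: pselect => // e.
  congr (if _ then _ else _); apply: asbool_equiv_eq.
  have H : autrel (existT _ tau' pi1) (existT _ tau' pi2) by exact: rst_step (AutSimplex Aa comp).
  by split=> H'; [exact: rst_trans H' H|apply: rst_trans H' _; exact: rst_sym].
- move=> tau' pi' F L0 FF iL FL cL; rewrite /label_test; case: pselect => e; last exact: cvg_cst.
  by subst tau'; case: ifP => _; [exact: cb|exact: cvg_cst].
Qed.

Lemma label_test_ge0 tau (pi : augmentation Gam tau) (beta : labels g tau -> R) tau' (pi' : augmentation Gam tau') L :
  (forall L, 0 <= beta L) -> 0 <= label_test pi beta pi' L.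
Proof. by move=> b0; rewrite /label_test; case: pselect => // e; case: ifP. Qed.

Context (N : set (M_Gamma g Gam)) (cN : compact N).

Lemma invariant_bounded h : invariant h -> exists C, forall x : pre_S g Gam, N (M_Gamma_pt x) -> h x <= C.
Proof.
move=> /invariant_factor[h' [ch' H]].
have [C C0 HC] := compact_upper cN (fun z _ => ch' z).
by exists C => x Nx; rewrite -H; exact: HC.
Qed.

Definition reduced_over (x : pre_S g Gam) : Prop := N (M_Gamma_pt x) /\ reduced x.

Lemma weight_gt0 (x : pre_S g Gam) : reduced x ->
  0 < \prod_(i < (chain_len (projT1 (projT1 x))).+1) (sval (projT2 x)).1 0 i.
Proof. by move=> [_ t0]; apply: prodr_gt0 => i _; exact: t0. Qed.

(** The top face alone would contribute at least [j] to [phi_sum] at [x j], but this invariant is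
    bounded over [N]. *)
Lemma test_bounded (B : forall tau, augmentation Gam tau -> labels g tau -> R) (x : nat -> pre_S g Gam)
  (c : nat -> R) : test B -> (forall tau (pi : augmentation Gam tau) L, 0 <= B tau pi L) ->
  (forall j, reduced_over (x j)) -> ~ forall j, j%:R / \prod_(i < (chain_len (projT1 (projT1 (x j)))).+1) (sval (projT2 (x j))).1 0 i <=
     B _ (projT2 (projT1 (x j))) (sval (projT2 (x j))).2.
Proof.
move=> tB B0 gx H; have [C HC] := invariant_bounded (phi_sum_invariant tB).
pose j := (Num.truncn `|C|).+1; have [Nj rj] := gx j.
have := HC _ Nj; apply/negP; rewrite -ltNge; apply: lt_le_trans (phi_sum_ge tB _ B0).
apply: lt_le_trans (_ : j%:R <= _); first by apply: le_lt_trans (ler_norm C) _; exact: truncnS_gt.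
by have := H j; rewrite ler_pdivrMr// weight_gt0.
Qed.

(** Otherwise there are infinitely many inequivalent simplices, and a test may take the value
    [j / w j] on the class of the [j]-th. It is constant on each simplex, so that it is continuous
    on the disjoint union. *)
Lemma finite_classes : exists l : seq (pre_S g Gam), forall x, reduced_over x ->
  exists2 s, List.In s l & autrel (projT1 s) (projT1 x).
Proof.
apply: contrapT => nl.
have [|x [gx Ex]] := @separated_sequence (pre_S g Gam) reduced_over (fun s x => autrel (projT1 s) (projT1 x)).
  move=> l; apply: contrapT => H; apply: nl; exists l => x gx; apply: contrapT => nx.
  by apply: H; exists x => // s sl sx; apply: nx; exists s.
pose w j := \prod_(i < (chain_len (projT1 (projT1 (x j)))).+1) (sval (projT2 (x j))).1 0 i.
have w0 j : 0 < w j by apply: weight_gt0; have [] := gx j.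
pose beta (s : simplex b p q Gam) : R :=
  if pselect (exists j, autrel (projT1 (x j)) s) is left e then (sval (cid e))%:R / w (sval (cid e)) else 0.
have betax j s : autrel (projT1 (x j)) s -> beta s = j%:R / w j.
  move=> H; rewrite /beta; case: pselect => [e|[]]; last by exists j.
  case: (cid e) => i /= Hi; suff -> : i = j by [].
  have [ij|ji|//] := ltngtP i j; first by exfalso; apply: (Ex _ _ ij); apply: rst_trans Hi _; exact: rst_sym.
  by exfalso; apply: (Ex _ _ ji); apply: rst_trans H _; exact: rst_sym.
have beta_none s : ~ (exists j, autrel (projT1 (x j)) s) -> beta s = 0.
  by rewrite /beta; case: pselect.
apply: (@test_bounded (class_test beta) x w) => //.
- apply: class_testP => s s' ss'; have [[j sj]|ns] := pselect (exists j, autrel (projT1 (x j)) s).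
    by rewrite !(betax j)//; apply: rst_trans sj _; exact: rst_step.
  rewrite !beta_none// => -[j sj]; apply: ns; exists j.
  by apply: rst_trans sj _; apply/rst_sym/rst_step.
- move=> tau pi L; rewrite /class_test; case: ifP => // _; rewrite /beta; case: pselect => // e.
  by rewrite divr_ge0// ltW.
- move=> j; have [_ [nd _]] := gx j; rewrite /class_test asboolT// (betax j)//.
  case: (x j) => -[tau pi] y; exact: rst_refl.
Qed.

(** With the principal filter, local finiteness at [L] speaks of the values at [L] itself. *)
Lemma globally_cvg tau (L : labels g tau) e :
  (fun L' : labels g tau => L' e : CinftyT g) @ globally [set L] --> (L e : CinftyT g).
Proof. by move=> A nA L' ->; exact: (@nbhs_singleton (CinftyT g) (L e) A nA). Qed.

(* Summing multiples of a locally finite family of tests gives an unbounded invariant function. *)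
Lemma locally_finite tau (pi : augmentation Gam tau) (y : nat -> structure g tau) (beta : nat -> labels g tau -> R) :
  (forall j, reduced_over (pre_S_pt pi (y j))) -> (forall j, label_continuous (beta j)) -> (forall j L, 0 <= beta j L) ->
  (forall j, 0 < beta j (sval (y j)).2) ->
  ~ (forall L0 : labels g tau, injective L0 -> exists J, forall F : set_system (labels g tau), Filter F ->
      (forall e, (fun L : labels g tau => L e : CinftyT g) @ F --> (L0 e : CinftyT g)) ->
      F [set L | forall j, (J <= j)%N -> beta j L = 0]).
Proof.
move=> gy cb b0 by0 lf; have nd : nondegenerate tau by have [_ []] := gy 0%N.
pose w j := \prod_(i < (chain_len tau).+1) (sval (y j)).1 0 i.
have w0 j : 0 < w j by apply: (weight_gt0 (gy j).2).
pose c j := j%:R / w j / beta j (sval (y j)).2.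
have c0 j : 0 <= c j by rewrite !divr_ge0// ltW.
have /boolp.choice[J HJ] : forall L : labels g tau, exists J, injective L -> forall j, (J <= j)%N -> beta j L = 0.
  move=> L; have [iL|niL] := pselect (injective L); last by exists 0%N.
  have [J HJ] := lf L iL; exists J => _; have := HJ (globally [set L]) _ _; apply => //.
  by move=> e; exact: globally_cvg.
have sumE L K : injective L -> (forall j, (K <= j)%N -> beta j L = 0) ->
    \sum_(j < J L) c j * beta j L = \sum_(j < K) c j * beta j L.
  move=> iL HK; have ext a d : (a <= d)%N -> (forall j, (a <= j)%N -> beta j L = 0) ->
      \sum_(j < d) c j * beta j L = \sum_(j < a) c j * beta j L.
    move=> /subnKC <-; elim: (d - a)%N => [|m IH] H; first by rewrite addn0.
    by rewrite addnS big_ord_recr /= IH// H ?leq_addr// mulr0 addr0.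
  by rewrite -(ext _ (maxn (J L) K))// ?leq_maxl ?(ext K)// ?leq_maxr//; exact: HJ.
pose B := fun L : labels g tau => \sum_(j < J L) c j * beta j L.
have B0 L : 0 <= B L by apply: sumr_ge0 => j _; rewrite mulr_ge0.
apply: (@test_bounded (label_test pi B) (fun j => pre_S_pt pi (y j)) w) => //.
- apply: label_testP => // F L0 FF iL FL cL; have [K HK] := lf L0 iL.
  rewrite /B (sumE L0 K)//; last first.
    move=> j Kj; have := HK (globally [set L0]) _ _; apply => //.
    by move=> e; exact: globally_cvg.
  have : \sum_(j < K) c j * beta j L @[L --> F] --> \sum_(j < K) c j * beta j L0.
    by apply: cvg_big => [|j _]; [exact: add_continuous|apply: cvgM; [exact: cvg_cst|exact: cb]].
  apply: cvg_trans; apply: near_eq_cvg.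
  by apply: filterS2 FL (HK F FF cL) => L iL' HL; rewrite (sumE L K).
- by move=> *; exact: label_test_ge0.
- move=> j; rewrite /= label_testE; last exact: rst_refl.
  have [_ _ yi] := svalP (y j).
  have jm : (j < maxn (J (sval (y j)).2) j.+1)%N by rewrite leq_max ltnSn orbT.
  rewrite /B (sumE _ (maxn (J (sval (y j)).2) j.+1))//; last first.
    by move=> i; rewrite geq_max => /andP[Ji _]; exact: HJ.
  rewrite (bigD1 (Ordinal jm))//= {1}/c divfK ?gt_eqF// -/(w j) lerDl.
  by apply: sumr_ge0 => i _; rewrite mulr_ge0.
Qed.

Section Labels.
Context (compactM : compact [set: M]) (tau : chain R b p q) (pi : augmentation Gam tau).

(** Otherwise infinitely many labels at the edge [e] are pairwise [eps] apart for the semi-distance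
    [d], and the bumps of radius [eps / 3] around them are a locally finite family. *)
Lemma labels_totally_bounded e c s K eps : atlas g c -> compact_in_chart c K -> 0 < eps ->
  exists l : seq (structure g tau), forall y, reduced_over (pre_S_pt pi y) ->
    exists2 y', List.In y' l & supdist K (jet c s ((sval y').2 e)) (jet c s ((sval y).2 e)) < eps.
Proof.
move=> ac Kc e0; pose d (h h' : Cinfty g) := supdist K (jet c s h) (jet c s h').
have bd (h : Cinfty g) : bounded_on K (jet c s h) by exact: jet_bounded.
have dsym h h' : d h h' = d h' h.
  by rewrite /d /supdist; congr sup; apply/eq_imagel => z _; rewrite distrC.
have dtri h1 h2 h3 : d h1 h3 <= d h1 h2 + d h2 h3.
  apply: supdist_le => [|z Kz]; first by rewrite addr_ge0 ?supdist_ge0.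
  by apply: le_trans (ler_distD (jet c s h2 z) _ _) _; rewrite lerD ?supdist_ge.
have dcvg (F : set_system (labels g tau)) (L0 : labels g tau) h : Filter F ->
    (forall e, (fun L : labels g tau => L e : CinftyT g) @ F --> (L0 e : CinftyT g)) -> d (L e) h @[L --> F] --> d (L0 e) h.
  move=> FF cL; apply: (@jet_supdist_cvg _ _ _ _ _ F FF (fun L : labels g tau => L e) (fun=> h) (L0 e) h) => //.
  exact: cvg_cst.
apply: contrapT => nl.
have [|y [gy Ey]] := @separated_sequence (structure g tau) (fun y => reduced_over (pre_S_pt pi y))
    (fun y' y => d ((sval y').2 e) ((sval y).2 e) < eps).
  move=> l; apply: contrapT => H; apply: nl; exists l => y gy; apply: contrapT => ny.
  by apply: H; exists y => // y' y'l yy'; apply: ny; exists y'.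
pose h j := (sval (y j)).2 e.
have sep i j : (i < j)%N -> eps <= d (h i) (h j) by move=> /Ey; rewrite leNgt => /negP.
pose beta j (L : labels g tau) := Num.max 0 (eps / 3 - d (L e) (h j)).
have dxx j : d (h j) (h j) = 0.
  by apply/eqP; rewrite eq_le supdist_ge0 andbT; apply: supdist_le => // z _; rewrite subrr normr0.
apply: (@locally_finite tau pi y beta) => //.
- move=> j F L0 FF iL FL cL; apply: cvg_maxr; first exact: cvg_cst.
  by apply: cvgB; [exact: cvg_cst|exact: dcvg].
- by move=> j L; rewrite le_max lexx.
- by move=> j; rewrite /beta lt_max -/(h j) dxx subr0 divr_gt0// orbT.
(* If [L0] is within [eps / 2] of some [h i], it is at least [eps / 2] away from all later ones;
   within [eps / 6 = eps / 2 - eps / 3] of [L0] their bumps vanish. *)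
- move=> L0 iL; have e6 : 0 < eps / 6 by rewrite divr_gt0.
  have near_d (F : set_system (labels g tau)) : Filter F ->
      (forall e, (fun L : labels g tau => L e : CinftyT g) @ F --> (L0 e : CinftyT g)) ->
      F [set L | d (L e) (L0 e) < eps / 6].
    move=> FF cL; have /cvgrPdist_lt /(_ _ e6) := dcvg F L0 (L0 e) FF cL; apply: filterS => L /=.
    rewrite (_ : d (L0 e) (L0 e) = 0) ?sub0r ?normrN ?ger0_norm ?supdist_ge0//.
    by apply/eqP; rewrite eq_le supdist_ge0 andbT; apply: supdist_le => // z _; rewrite subrr normr0.
  have zero L j : eps / 2 <= d (L0 e) (h j) -> d (L e) (L0 e) < eps / 6 -> beta j L = 0.
    move=> h1 h2; apply/max_idPl; rewrite subr_le0; have := dtri (L0 e) (L e) (h j); rewrite dsym in h2; lra.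
  have [[i di]|ni] := pselect (exists i, d (L0 e) (h i) < eps / 2).
    exists i.+1 => F FF cL; apply: filterS (near_d F FF cL) => L HL j ij; apply: zero HL.
    by have := dtri (h i) (L0 e) (h j); have := sep _ _ ij; rewrite (dsym (h i) (L0 e)); lra.
  exists 0%N => F FF cL; apply: filterS (near_d F FF cL) => L HL j _; apply: zero HL.
  by rewrite leNgt; apply/negP => dj; apply: ni; exists j.
Qed.

(** Otherwise the distance [d] of the two labels gets below every [1 / j.+1]. The tests [beta j]
    vanish unless [d < 2 / j.+1], so they are locally finite at injective labels, where [d] is
    positive. *)
Lemma labels_separated e e' : e <> e' -> exists2 delta, 0 < delta & forall y, reduced_over (pre_S_pt pi y) ->
  delta <= supdist setT (sval ((sval y).2 e)) (sval ((sval y).2 e')).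
Proof.
move=> ee'; pose d (L : labels g tau) := supdist setT (sval (L e)) (sval (L e')).
apply: contrapT => nd.
have /boolp.choice[y Hy] : forall j, exists y : structure g tau, reduced_over (pre_S_pt pi y) /\ d (sval y).2 < j.+1%:R^-1.
  move=> j; apply: contrapT => H; apply: nd; exists j.+1%:R^-1; first by rewrite invr_gt0.
  by move=> y gy; rewrite leNgt; apply/negP => dy; apply: H; exists y.
pose beta j (L : labels g tau) := Num.max 0 (2 - j.+1%:R * d L).
have dcvg (F : set_system (labels g tau)) (L0 : labels g tau) : Filter F ->
    (forall e, (fun L : labels g tau => L e : CinftyT g) @ F --> (L0 e : CinftyT g)) -> d L @[L --> F] --> d L0.
  move=> FF cL; exact: (@value_supdist_cvg _ _ _ _ compactM _ F FF (fun L : labels g tau => L e)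
    (fun L : labels g tau => L e') (L0 e) (L0 e')).
apply: (@locally_finite tau pi y beta).
- by move=> j; have [] := Hy j.
- move=> j F L0 FF iL FL cL; apply: cvg_maxr; first exact: cvg_cst.
  by apply: cvgB; [exact: cvg_cst|apply: cvgM; [exact: cvg_cst|exact: dcvg]].
- by move=> j L; rewrite le_max lexx.
- move=> j; rewrite /beta lt_max; apply/orP; right; have [_] := Hy j.
  by rewrite -(ltr_pM2l (ltr0Sn R j)) mulfV ?pnatr_eq0//; lra.
- move=> L0 iL; have d0 : 0 < d L0.
    rewrite lt_neqAle supdist_ge0 andbT eq_sym; apply/eqP => d0; apply: ee'; apply: iL.
    apply: Cinfty_ext; apply/funext => x; apply/eqP; rewrite -subr_eq0 -normr_le0 -d0.
    by apply: supdist_ge => //; exact: Cinfty_bounded.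
  (* Near [L0] one has [d L >= d L0 / 2], and [J] makes [j.+1 * d L] at least 2. *)
  pose J := (Num.truncn (4 / d L0)).+1; exists J => F FF cL; have := dcvg F L0 FF cL => /cvgrPdist_lt.
  have d2 : 0 < d L0 / 2 by rewrite divr_gt0.
  move=> /(_ _ d2); apply: filterS => L HL j Jj; apply/max_idPl; rewrite subr_le0.
  have h1 : d L0 / 2 <= d L by have := ler_norm (d L0 - d L); lra.
  have h2 : 4 / d L0 <= j.+1%:R.
    by apply: le_trans (ltW (truncnS_gt _)) _; rewrite ler_nat (leq_trans Jj).
  have -> : 2 = 4 / d L0 * (d L0 / 2) :> R by field; rewrite gt_eqF.
  by apply: ler_pM => //; rewrite divr_ge0// ltW.
Qed.

Lemma ultra_list (T X : Type) (V : set_system T) {UV : UltraFilter V} (l : seq X) (P : X -> T -> Prop) :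
  (\forall i \near V, exists2 s, List.In s l & P s i) -> exists s, \forall i \near V, P s i.
Proof.
elim: l => [|s l IH] H; first by have /filter_ex[i []] := H.
have [H1|/IH//] : (\forall i \near V, P s i) \/ \forall i \near V, exists2 s, List.In s l & P s i.
  by apply: ultra_or; apply: filterS H => i [s' /= [->|sl] Ps]; [left|right; exists s'].
by exists s.
Qed.

(** The labels converge by total boundedness and completeness, and separation keeps the limits
    distinct. Coordinates of [t] may tend to 0, so the limit need not be reduced. *)
Lemma structure_limit (T : Type) (V : set_system T) {UV : UltraFilter V} (y : T -> structure g tau) :
  (\forall i \near V, reduced_over (pre_S_pt pi (y i))) -> exists y0 : structure g tau,
  [/\ (sval (y i)).1 @[i --> V] --> (sval y0).1,
     forall e, ((sval (y i)).2 e : CinftyT g) @[i --> V] --> ((sval y0).2 e : CinftyT g) &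
     (y i : structureT g tau) @[i --> V] --> (y0 : structureT g tau)].
Proof.
move=> gy; have /boolp.choice[t0 Ht0] : forall j, exists t0 : R, (sval (y i)).1 0 j @[i --> V] --> t0.
  move=> j; have [|t0 H _] := @real_lim_bounded _ _ V _ (fun i => (sval (y i)).1 0 j) 1; last by exists t0.
  apply: nearW => i; have [y0 y1 _] := svalP (y i); rewrite (le_trans _ (y0 j))//= -y1 (bigD1 j)//=.
  by rewrite lerDl sumr_ge0.
have /boolp.choice[L0 HL0] : forall e, exists L0 : CinftyT g, ((sval (y i)).2 e : CinftyT g) @[i --> V] --> L0.
  move=> e; apply: Cinfty_complete => c s K eps ac Kc e0.
  have [l Hl] := labels_totally_bounded e s ac Kc e0.
  have [y' Hy'] := @ultra_list T _ V _ l (fun y' i => supdist K (jet c s ((sval y').2 e)) (jet c s ((sval (y i)).2 e)) < eps)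
    (filterS (fun i gi => Hl (y i) gi) gy).
  exists ((sval y').2 e); apply: filterS Hy' => i Hi z Kz; apply: le_trans (ltW Hi).
  by apply: supdist_ge => //; exact: jet_bounded.
have t0c : (sval (y i)).1 @[i --> V] --> \row_j t0 j.
  apply/cvgrPdist_le => eps e0.
  have : \forall i \near V, forall j, `|t0 j - (sval (y i)).1 0 j| <= eps.
    by apply: near_ord => j; have /cvgrPdist_le := Ht0 j; apply.
  by apply: filterS => i Hi; apply: mx_norm_le => [|j]; [exact: ltW|rewrite !mxE].
have H : @is_structure _ _ _ g _ _ _ tau (\row_j t0 j, L0).
  split => /= [j||e e' LL].
  - rewrite mxE; apply: (ler_lim (cvg_cst (0 : R)) (Ht0 j)); apply: nearW => i.
    by have [y0 _ _] := svalP (y i); exact: y0.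
  - under eq_bigr do rewrite mxE.
    have h1 : \sum_j (sval (y i)).1 0 j @[i --> V] --> \sum_j t0 j.
      by apply: cvg_big => [|j _]; [exact: add_continuous|exact: Ht0].
    have E : (fun i => \sum_j (sval (y i)).1 0 j) = fun=> 1.
      by apply/funext => i; have [_ -> _] := svalP (y i).
    by rewrite E in h1; exact: (cvg_unique _ h1 (cvg_cst (1 : R))).
  - apply: contrapT => /labels_separated[delta d0 Hd].
    have := value_supdist_cvg compactM (HL0 e) (HL0 e'); rewrite LL.
    have -> : supdist setT (sval (L0 e')) (sval (L0 e')) = 0.
      by apply/eqP; rewrite eq_le supdist_ge0 andbT; apply: supdist_le => // z _; rewrite subrr normr0.
    move=> /(_ _) Hc; have : delta <= 0 by apply: (ler_lim (cvg_cst delta) Hc); apply: filterS gy => i /Hd.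
    by rewrite leNgt d0.
exists (exist _ _ H); split => //; apply: induced_cvg.
have H2 : (sval (y i)).2 @[i --> V] --> (L0 : prod_topology (fun _ : edge (top tau) => CinftyT g)).
  exact: (@prod_cvg _ (fun _ : edge (top tau) => CinftyT g) _ V _ (fun i => (sval (y i)).2) L0 HL0).
exact: (@cvg_pair_top _ (prod_topology (fun _ : edge (top tau) => CinftyT g)) _ V _
  (fun i => sval (y i)) (\row_j t0 j, L0)).
Qed.

End Labels.

End Tests.

(** * Separation of points by invariant functions *)

Section Separation.
Context {R : realType} {n : nat} {M : uniformType} {g : riemannian R n M}.
Context {b p q : nat} {Gam : object R b p q} (compactM : compact [set: M]).
Implicit Types tau : chain R b p q.

Lemma label_test_inv tau (pi : augmentation Gam tau) beta tau' (pi' : augmentation Gam tau') L :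
  label_test (g := g) pi beta pi' L <> 0 -> autrel (existT _ tau' pi') (existT _ tau pi).
Proof.
rewrite /label_test; case: pselect => // e; case: ifP => // /asboolP H _; exact: rst_sym.
Qed.

Lemma label_continuous_cst tau c : label_continuous (fun _ : labels g tau => c).
Proof. by move=> *; exact: cvg_cst. Qed.

(* A test on the simplex of higher dimension shows that the simplices agree up to Aut(Gamma), a test on
   the labels that the labels agree, and the weights given by r and r ^+ 2 determine t. *)
Lemma invariant_separated (f : M -> R) (a : leaf Gam -> M) (x x' : pre_S g Gam) : reduced x -> reduced x' ->
  (forall h, invariant h -> h x = h x') -> M_Gamma_pt x = M_Gamma_pt x'.
Proof.
wlog kk : x x' / (chain_len (projT1 (projT1 x')) <= chain_len (projT1 (projT1 x)))%N.
  move=> W rx rx' H; have /orP[?|?] := leq_total (chain_len (projT1 (projT1 x'))) (chain_len (projT1 (projT1 x))).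
    exact: W.
  by apply/esym; apply: W => // h /H.
move=> rx rx' H; have cid (i : nat) : continuous (@id R) by move=> ?; exact: cvg_id.
case: x => -[tau pi] y in kk rx H *; have [nd t0] := rx; rewrite /= in kk nd t0.
have w0 (z : structure g tau) : (forall i, 0 < (sval z).1 0 i) ->
    0 < \prod_(i < (chain_len tau).+1) (sval z).1 0 i by move=> z0; apply: prodr_gt0.
have dE (z : structure g tau) : \prod_(i < (chain_len tau).+1) dcum id (sval z).1 i =
    \prod_(i < (chain_len tau).+1) (sval z).1 0 i by apply: eq_bigr => i _; exact: dcum_id.
have top beta Psi (pi' : augmentation Gam tau) (z : structure g tau) :
    label_continuous beta -> autrel (existT _ tau pi) (existT _ tau pi') ->
    phi (label_test pi beta) Psi (chain_len tau) (pre_S_pt pi' z) =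
    beta (sval z).2 * \prod_(i < (chain_len tau).+1) dcum (Psi i) (sval z).1 i.
  by move=> cb rel; have -> := phi_top (label_testP pi nd cb) Psi (pre_S_pt pi' z); rewrite label_testE.
have inv (beta : labels g tau -> R) Psi : label_continuous beta -> (forall i, continuous (Psi i)) ->
    invariant (phi (label_test pi beta) Psi (chain_len tau)).
  by move=> cb cP; apply: phi_invariant => //; exact: label_testP.
have [y' E rx''] : exists2 y' : structure g tau, M_Gamma_pt (pre_S_pt pi y') = M_Gamma_pt x' &
    (forall i, 0 < (sval y').1 0 i) /\ forall h, invariant h -> h (pre_S_pt pi y) = h (pre_S_pt pi y').
  have c1 := @label_continuous_cst tau 1.
  (* At [x] this invariant is the product of the [t_i], which is positive; at [x'] it would be 0 in
     a lower dimension or on an inequivalent simplex. *)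
  have := H _ (inv _ (fun=> id) c1 cid); rewrite (top _ _ pi)//; last exact: rst_refl.
  rewrite mul1r dE; have [lt|] := ltnP (chain_len (projT1 (projT1 x'))) (chain_len tau).
    by rewrite phi_high; [move=> e; have := w0 y t0; rewrite e ltxx|exact: label_testP|].
  move=> le; have kE : chain_len tau = chain_len (projT1 (projT1 x')) by apply/eqP; rewrite eqn_leq le kk.
  have -> k : k = chain_len (projT1 (projT1 x')) -> phi (label_test pi (fun _ : labels g tau => 1)) (fun=> id) k x' =
      label_test pi (fun _ : labels g tau => 1) (projT2 (projT1 x')) (sval (projT2 x')).2 *
      \prod_(i < (chain_len (projT1 (projT1 x'))).+1) dcum id (sval (projT2 x')).1 i.
    by move=> ->; exact: phi_top (label_testP pi nd c1) _ _.
  2: exact: kE.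
  move=> e.
  have /label_test_inv rel : label_test pi (fun _ : labels g tau => 1) (projT2 (projT1 x')) (sval (projT2 x')).2 <> 0.
    by move=> e0; move: e; rewrite e0 mul0r => e; have := w0 y t0; rewrite e ltxx.
  case: x' => -[tau' pi'] u in rx' H {kk le kE e} rel *.
  have [y' [S _] EE] := sim_aut_clos f a rel u; exists y' => //.
  split; last first.
    move=> h ih; rewrite H//; have [h' [ch' Hh']] := invariant_factor ih.
    by rewrite -!Hh' S.
  have : forall v : {tau : chain R b p q & structure g tau}, existT _ tau' u = v -> forall i, 0 < (sval (projT2 v)).1 0 i.
    by move=> v <-; have [] := rx'.
  by move=> /(_ (existT _ tau y') EE).
rewrite -E; have [t'0 {}H] := rx''; congr (M_Gamma_pt (pre_S_pt _ _)).
have LE : (sval y).2 = (sval y').2.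
  apply/funext => e; apply: contrapT => ne.
  (* The distance to the label of [y] at [e] vanishes at [y], hence at [y'], where the weight is
     positive. *)
  pose beta (L : labels g tau) := supdist setT (sval (L e)) (sval ((sval y).2 e)).
  have cb : label_continuous beta.
    move=> F L0 FF iL FL cL; apply: (@value_supdist_cvg _ _ _ _ compactM _ F FF (fun L : labels g tau => L e)
      (fun=> (sval y).2 e) (L0 e) ((sval y).2 e)) => //; exact: cvg_cst.
  have := H _ (inv _ (fun=> id) cb cid); rewrite !(top _ _ pi)//; try exact: rst_refl.
  rewrite !dE [beta (sval y).2](_ : _ = 0) ?mul0r; last first.
    by apply/eqP; rewrite eq_le supdist_ge0 andbT; apply: supdist_le => // z _; rewrite subrr normr0.
  move=> /esym/eqP; rewrite mulf_eq0 (gt_eqF (w0 _ t'0)) orbF => /eqP b0; apply: ne.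
  apply/esym/Cinfty_ext/funext => z; apply/eqP; rewrite -subr_eq0 -normr_le0 -b0.
  by apply: supdist_ge => //; exact: Cinfty_bounded.
have c1 := @label_continuous_cst tau 1.
have PE : \prod_(i < (chain_len tau).+1) (sval y).1 0 i = \prod_(i < (chain_len tau).+1) (sval y').1 0 i.
  by have := H _ (inv _ (fun=> id) c1 cid); rewrite !(top _ _ pi)//; try exact: rst_refl; rewrite !mul1r !dE.
(* The increment of [r ^+ 2] at step [j] is [t_j] times the sum of the two adjacent partial sums.
   Dividing by the product of all [t_i] leaves these sums, from which the partial sums follow one by
   one. *)
have sqE (z : structure g tau) (j : 'I_(chain_len tau).+1) :
    \prod_(i < (chain_len tau).+1) dcum (if (i : nat) == j then fun r => r ^+ 2 else id) (sval z).1 i =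
    (\prod_(i < (chain_len tau).+1) (sval z).1 0 i) * (cum (sval z).1 j.+1 + cum (sval z).1 j).
  have hj : dcum (fun r => r ^+ 2) (sval z).1 j = (sval z).1 0 j * (cum (sval z).1 j.+1 + cum (sval z).1 j).
    by rewrite -(dcum_id (sval z).1 j) /dcum; ring.
  rewrite (bigD1 j)//= eqxx hj [in RHS](bigD1 j)//= mulrAC; congr (_ * _ * _).
  by apply: eq_bigr => i ij; rewrite -(inj_eq val_inj) in ij; rewrite (negPf ij) dcum_id.
have cE (j : 'I_(chain_len tau).+1) : cum (sval y).1 j.+1 + cum (sval y).1 j = cum (sval y').1 j.+1 + cum (sval y').1 j.
  pose Psi (i : nat) : R -> R := if i == j then fun r => r ^+ 2 else id.
  have cP i : continuous (Psi i).
    by rewrite /Psi; case: ifP => _ r; [exact: exprn_continuous|exact: cvg_id].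
  have := H _ (inv _ Psi c1 cP); rewrite !(top _ _ pi)//; try exact: rst_refl.
  rewrite !mul1r /Psi !sqE PE => /mulfI; apply.
  by rewrite gt_eqF// w0.
have cumE (j : nat) : (j <= (chain_len tau).+1)%N -> cum (sval y).1 j = cum (sval y').1 j.
  elim: j => [|j IH] jk; first by rewrite /cum !big_ord0.
  by have := cE (Ordinal jk); rewrite /= IH ?(ltnW jk)// => /addIr.
have tE : (sval y).1 = (sval y').1.
  by apply/rowP => j; rewrite -!dcum_id /dcum !cumE//; exact: ltnW.
apply: eq_sig_hprop => [z|]; first exact: Prop_irrelevance.
by move: tE LE; case: (sval y) => t1 L1; case: (sval y') => t2 L2 /= -> ->.
Qed.

(** Compactness gives the images some limit [z] in [N]. Invariant functions agree at [z] and at the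
    image of [x0], so these two points coincide. *)
Lemma limit_over (f : M -> R) (a : leaf Gam -> M) (N : set (M_Gamma g Gam)) (T : Type) (V : set_system T)
  {UV : UltraFilter V} (x : T -> pre_S g Gam) x0 : compact N ->
  (\forall i \near V, N (M_Gamma_pt (x i))) -> x @ V --> x0 -> N (M_Gamma_pt x0).
Proof.
move=> cN Nx xx; have [z [Nz xz]] : exists z, N z /\ M_Gamma_pt (x i) @[i --> V] --> z.
  by have := cN; rewrite compact_ultra => /(_ ((fun i => M_Gamma_pt (x i)) @ V) (ultra_map _ UV) Nx).
have [z' z'E] := cls_surj z; have [z'' z''E] := cls_surj z'; subst z z'.
have [x1 [E1 _] r1] := reduce f a x0; have [x2 [E2 _] r2] := reduce f a z''.
rewrite E1 (@invariant_separated f a x1 x2)// -?E2// => h ih.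
have [h' [ch' Hh']] := invariant_factor ih; rewrite -!Hh' -E1 -E2.
have h1 : h' (M_Gamma_pt (x i)) @[i --> V] --> h' (M_Gamma_pt z'').
  by apply: cvg_comp xz _; exact: ch'.
have h2 : h' (M_Gamma_pt (x i)) @[i --> V] --> h' (M_Gamma_pt x0).
  under eq_fun do rewrite Hh'; rewrite Hh'; apply: cvg_comp xx _.
  by have [ch _ _] := ih; exact: (ch x0).
exact: (cvg_unique _ h2 h1).
Qed.

End Separation.

(** * Limits of graph flows on one simplex *)

Lemma uniform_cvg (R : realType) (M : uniformType) (T : Type) (V : set_system T) {FV : Filter V}
  (gamma : T -> {uniform R -> M}) (gamma0 : {uniform R -> M}) :
  (forall A, entourage A -> \forall i \near V, forall s, A (gamma0 s, gamma i s)) -> gamma @ V --> gamma0.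
Proof.
move=> H A /uniform_nbhs[E [entE EA]]; apply: filterS (H E entE) => i Hi.
by apply: EA => s _; exact: Hi.
Qed.

Lemma incoming_outgoing (R : realType) (G : graph R) (v : vert G) : incoming v -> ~ outgoing v.
Proof.
move=> /andP[uv /existsP[e /eqP ev]] /andP[_ /existsP[e' /eqP ev']].
have : (1 + 1 <= valence v)%N.
  by apply: leq_add; apply/card_gt0P; [exists e|exists e']; rewrite inE; exact/eqP.
by rewrite (eqP uv).
Qed.

Section Limit.
Context {R : realType} {n : nat} {M : uniformType} {g : riemannian R n M}.
Context (compactM : compact [set: M]) (hausM : hausdorff_space M).
Context (f : M -> R) (mf : morse g f).
Context {b p q : nat} {Gam : object R b p q} (a : leaf Gam -> M) (ca : forall v, critical g f (a v)).

Section Concat.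
Context {tau : chain R b p q} (z : raw_flow M Gam tau) (v : leaf Gam) (x : M).

(** A point of the prescribed level exists, so [xget] does not fall back on its default. The two
    cases are the two orientations of a leaf. *)
Lemma concat_clamp (lo hi : R) : (forall r, lo <= r <= hi -> exists2 y, concat_points a z v y & f y = r) ->
  (f (fhalf z v 0) = lo /\ f (a v) = hi) \/ (f (fhalf z v 0) = hi /\ f (a v) = lo) -> lo <= hi ->
  forall s, concat_points a z v (concat f a z v s) /\ f (concat f a z v s) = clamp lo hi s.
Proof.
move=> ivt E lohi s; have [|y Py fy] := ivt (clamp lo hi s); first exact: clamp_itv.
rewrite /concat; have -> : Num.max (Num.min (f (fhalf z v 0)) (f (a v)))
    (Num.min (Num.max (f (fhalf z v 0)) (f (a v))) s) = clamp lo hi s.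
  have h1 : Num.min lo hi = lo by exact/min_idPl.
  have h2 : Num.max lo hi = hi by exact/max_idPr.
  by case: E => -[-> ->]; rewrite /clamp ?(minC hi lo) ?(maxC hi lo) h1 h2.
exact: (xgetPex _ (P := [set y | concat_points a z v y /\ f y = clamp lo hi s])
  (ex_intro _ y (conj Py fy))).
Qed.

Lemma concat_in : in_flow g f (fcrit z v) x (fhalf z v) -> broken g f (a v) (fcrit z v) (fbroken z v) ->
  forall s, path_set (a v) (fcrit z v) (fbroken z v) (fhalf z v) (concat f a z v s) /\
    f (concat f a z v s) = clamp (f x) (f (a v)) s.
Proof.
move=> fl br; have dP := dpath_in mf (@ca v) br fl; have [_ gx _] := fl.
apply: concat_clamp; last by have [] := dpath_down dP.
  by case: dP.
by left; rewrite gx.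
Qed.

Lemma concat_out : critical g f (fcrit z v) -> out_flow g f x (fcrit z v) (fhalf z v) ->
  broken g f (fcrit z v) (a v) (fbroken z v) ->
  forall s, path_set (a v) (fcrit z v) (fbroken z v) (fhalf z v) (concat f a z v s) /\
    f (concat f a z v s) = clamp (f (a v)) (f x) s.
Proof.
move=> cc fl br; have dP := dpath_out mf cc br fl; have [_ gx _] := fl.
apply: concat_clamp; last by have [] := dpath_down dP.
  by case: dP.
by right; rewrite gx.
Qed.

End Concat.

Lemma flow_half tau (pi : augmentation Gam tau) (y : raw_structure g tau) z (v : leaf Gam) (w : vert (top tau)) :
  is_flow f a pi y z -> univalent w -> mv (am pi ord_max) w = val v -> fvert z w = fhalf z v 0.
Proof.
move=> [_ H] uw wv; have [_ Hin Hout] := H v w uw wv.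
have /orP[/Hin|/Hout] := univalent_in_out (svalP v).
  by move=> [[_ -> //] _].
by move=> [[_ -> //] _].
Qed.

Context (N : set (M_Gamma g Gam)) (cN : compact N).
Context {tau : chain R b p q} (pi : augmentation Gam tau).
Context (V : set_system (flow g f a pi)) {UV : UltraFilter V}.

(** The last clause is stated for every [z0] with the given data at [v], because the limit flow is
    assembled only after all leaves have been treated. *)
Lemma leaf_limit (v : leaf Gam) (w : vert (top tau)) (x0 : M) : univalent w -> mv (am pi ord_max) w = val v ->
  (fun i => fvert (sval i).2 w) @ V --> x0 ->
  exists c0 gamma0 l0, [/\ critical g f c0,
    incoming (val v) -> in_flow g f c0 x0 gamma0 /\ broken g f (a v) c0 l0,
    outgoing (val v) -> out_flow g f x0 c0 gamma0 /\ broken g f c0 (a v) l0 &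
    forall z0 : raw_flow M Gam tau, fcrit z0 v = c0 -> fhalf z0 v = gamma0 -> fbroken z0 v = l0 ->
      forall A, entourage A -> \forall i \near V, forall s, A (concat f a z0 v s, concat f a (sval i).2 v s)].
Proof.
move=> uw wv xl; have H (i : flow g f a pi) := (svalP i).2 v w uw wv.
have /orP[vin|vout] := univalent_in_out (svalP v).
  have Hin (i : flow g f a pi) : in_flow g f (fcrit (sval i).2 v) (fvert (sval i).2 w) (fhalf (sval i).2 v) /\
      broken g f (a v) (fcrit (sval i).2 v) (fbroken (sval i).2 v) by have [_ + _] := H i; apply.
  have Hc i := concat_in (Hin i).1 (Hin i).2.
  have [||||c0 [gamma0 [l0 [k0 [cc0 fl0 br0 unif uniq]]]]] := in_limit compactM hausM mf (V := V) (@ca v) xl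
    (c := fun i => fcrit (sval i).2 v) (gamma := fun i => fhalf (sval i).2 v)
    (l := fun i => fbroken (sval i).2 v) (k := fun i => concat f a (sval i).2 v).
  - by move=> i; exact: (Hin i).1.
  - by move=> i; exact: (Hin i).2.
  - by move=> i r; exact: (Hc i r).1.
  - by move=> i r; exact: (Hc i r).2.
  exists c0, gamma0, l0; split => //; first by move=> /(incoming_outgoing vin).
  move=> z0 e1 e2 e3; subst c0 gamma0 l0; have Hc0 := concat_in fl0 br0.
  have -> : concat f a z0 v = k0 by apply: uniq => r; [exact: (Hc0 r).1|exact: (Hc0 r).2].
  exact: unif.
have Hout (i : flow g f a pi) : out_flow g f (fvert (sval i).2 w) (fcrit (sval i).2 v) (fhalf (sval i).2 v) /\
    broken g f (fcrit (sval i).2 v) (a v) (fbroken (sval i).2 v) by have [_ _] := H i; apply.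
have Hcr (i : flow g f a pi) : critical g f (fcrit (sval i).2 v) by have [] := H i.
have Hc i := concat_out (Hcr i) (Hout i).1 (Hout i).2.
have [|||||c0 [gamma0 [l0 [k0 [cc0 fl0 br0 unif uniq]]]]] := out_limit compactM hausM mf (V := V) (@ca v) _ xl
  (c := fun i => fcrit (sval i).2 v) (gamma := fun i => fhalf (sval i).2 v)
  (l := fun i => fbroken (sval i).2 v) (k := fun i => concat f a (sval i).2 v).
- exact: Hcr.
- by move=> i; exact: (Hout i).1.
- by move=> i; exact: (Hout i).2.
- by move=> i r; exact: (Hc i r).1.
- by move=> i r; exact: (Hc i r).2.
exists c0, gamma0, l0; split => //; first by move=> /incoming_outgoing.
move=> z0 e1 e2 e3; subst c0 gamma0 l0; have Hc0 := concat_out cc0 fl0 br0.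
have -> : concat f a z0 v = k0 by apply: uniq => r; [exact: (Hc0 r).1|exact: (Hc0 r).2].
exact: unif.
Qed.

Lemma flow_limit : (\forall i \near V, reduced_over N (pre_S_pt pi (sval i).1)) ->
  exists2 u0 : flow g f a pi, V --> (u0 : flowT g f a pi) & N (M_Gamma_pt (pre_S_pt pi (sval u0).1)).
Proof.
move=> gV; have [y0 [tl Ll yl]] := structure_limit cN compactM (y := fun i : flow g f a pi => (sval i).1) gV.
have /boolp.choice[x0 xl] : forall w : vert (top tau), exists x0 : M, (fun i : flow g f a pi => fvert (sval i).2 w) @ V --> x0.
  by move=> w; exact: (ultra_cvg compactM).
have lenl e : edge_length (sval (sval i).1).1 e @[i --> V] --> edge_length (sval y0).1 e.
  rewrite /edge_length; apply: cvg_big => [|j _]; first exact: add_continuous.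
  by apply: cvgM; [exact: cvg_coord|exact: cvg_cst].
have /boolp.choice[gamma0 Hg] : forall e : edge (top tau), exists gamma0,
    edge_flow g (sval ((sval y0).2 e)) (edge_length (sval y0).1 e) (x0 (src e)) (x0 (tgt e)) gamma0 /\
    forall A, entourage A -> \forall i \near V, forall s, A (gamma0 s, fedge (sval i).2 e s).
  move=> e; apply: (edge_limit compactM hausM (V := V) (svalP ((sval y0).2 e)) (jet_grad_conv (Ll e)) _ (lenl e) (xl _) (xl _)).
    move=> i; have [t0 _ _] := svalP (sval i).1; apply: sumr_ge0 => j _.
    by apply: mulr_ge0; [exact: t0|case: (me _ _)].
  by move=> i; have [] := svalP i.
have lift_leaf (v : leaf Gam) : exists2 w : vert (top tau), univalent w & mv (am pi ord_max) w = val v.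
  exact: univalent_lift (svalP v).
have /boolp.choice[d Hd] : forall v : leaf Gam, exists d : M * (R -> M) * seq (M * set (R -> M)),
    forall w : vert (top tau), univalent w -> mv (am pi ord_max) w = val v ->
    [/\ critical g f d.1.1,
    incoming (val v) -> in_flow g f d.1.1 (x0 w) d.1.2 /\ broken g f (a v) d.1.1 d.2,
    outgoing (val v) -> out_flow g f (x0 w) d.1.1 d.1.2 /\ broken g f d.1.1 (a v) d.2 &
    forall z0 : raw_flow M Gam tau, fcrit z0 v = d.1.1 -> fhalf z0 v = d.1.2 -> fbroken z0 v = d.2 ->
      forall A, entourage A -> \forall i \near V, forall s, A (concat f a z0 v s, concat f a (sval i).2 v s)].
  (* The data at [v] must suit every univalent lift of [v]: all lifts are sent to the point at time
     0 of the same half-line. *)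
  move=> v; have [w uw wv] := lift_leaf v.
  have [c0 [gam [l0 Hl]]] := leaf_limit uw wv (xl w); exists (c0, gam, l0) => w' uw' wv' /=.
  suff -> : x0 w' = x0 w by [].
  apply: (ultra_lim_unique hausM (xl w')); apply: cvg_trans (xl w); apply: near_eq_cvg; apply: nearW => i.
  by rewrite (flow_half (svalP i) uw wv) (flow_half (svalP i) uw' wv').
pose z0 := RawFlow (Gam := Gam) (tau := tau) x0 gamma0 (fun v => (d v).1.2) (fun v => (d v).1.1) (fun v => (d v).2).
have H0 : is_flow f a pi (sval y0) z0.
  split => [e|v w uw wv]; first by have [] := Hg e.
  by have [] := Hd v w uw wv.
exists (exist _ (y0, z0) H0) => /=; last first.
  apply: (limit_over compactM f a (x := fun i : flow g f a pi => pre_S_pt pi (sval i).1) cN).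
    by apply: filterS gV => i [].
  by apply: cvg_comp yl _; exact: existT_continuous.
have conc v A : entourage A -> \forall i \near V, forall s, A (concat f a z0 v s, concat f a (sval i).2 v s).
  by have [w uw wv] := lift_leaf v; have [_ _ _] := Hd v w uw wv; apply.
apply: (@induced_cvg _ _ (@flow_maps R n M g f b p q Gam a tau pi) _ V _ id).
apply: cvg_pair_top; first exact: yl.
apply: cvg_pair_top; first by apply: prod_cvg => w; exact: xl.
apply: cvg_pair_top; first by apply: prod_cvg => e; apply: uniform_cvg; have [] := Hg e.
by apply: prod_cvg => v; apply: uniform_cvg; exact: conc.
Qed.

End Limit.

(** * Compactness *)

Section Representatives.
Context {R : realType} {n : nat} {M : uniformType} {g : riemannian R n M} (f : M -> R).
Context {b p q : nat} {Gam : object R b p q} (a : leaf Gam -> M) (N : set (M_Gamma g Gam)).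

Lemma piecewise_flow_continuous tau (pi : augmentation Gam tau) :
  continuous (fun u : flowT g f a pi => piecewise_flow_pt (pre_flow_pt (u : flow g f a pi))).
Proof.
move=> u; apply: (@continuous_comp _ _ _ (fun u : flowT g f a pi => cls (@glue_flow R n M g f b p q Gam a) (pre_flow_pt (u : flow g f a pi)))
  (cls (@aut_flow R n M g f b p q Gam a))); last exact: cls_continuous.
apply: (@continuous_comp _ _ _ (fun u : flowT g f a pi => pre_flow_pt (u : flow g f a pi))); last exact: cls_continuous.
exact: existT_continuous.
Qed.

Definition represented tau (pi : augmentation Gam tau) : set (piecewise_flows g f a) :=
  [set P | exists u : flow g f a pi, reduced_over N (pre_S_pt pi (sval u).1) /\ P = piecewise_flow_pt (pre_flow_pt u)].

Lemma representative (l : seq (pre_S g Gam)) :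
  (forall x, reduced_over N x -> exists2 s, List.In s l & autrel (projT1 s) (projT1 x)) ->
  forall P, piecewise_flows_over f a N P -> exists2 s, List.In s l & represented (projT2 (projT1 s)) P.
Proof.
move=> Hl _ [tau [pi [[[y z] H] [-> Ny]]]].
have [x [E1 F1] rx] := reduce f a (pre_S_pt pi y).
have gx : reduced_over N x by split=> //; rewrite -E1.
have [s sl sx] := Hl x gx; exists s => //.
case: s sx {sl} => -[tau1 pi1] y1 /= sx; case: x => -[tau2 pi2] y2 in E1 F1 rx gx sx *.
have [y3 [E2 F2] EE] := sim_aut_clos f a (rst_sym _ _ _ _ sx) y2.
have [|z3 [H3 ->]] := F2 (piecewise_flow_pt (pre_flow_pt (exist _ (y, z) H))).
  by apply: F1; exists z, H.
exists (exist _ (y3, z3) H3); split => //; split => /=; first by move: gx.1; rewrite E2.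
(* Being reduced depends only on the chain and its structure, which [EE] identifies. *)
have : forall v : {tau : chain R b p q & structure g tau}, existT _ tau2 y2 = v ->
    nondegenerate (projT1 v) /\ forall i, 0 < (sval (projT2 v)).1 0 i by move=> v <-.
by move=> /(_ _ EE).
Qed.

End Representatives.

Arguments represented {R n M g} f {b p q Gam} a N {tau} pi _.

Theorem proposition34 (R : realType) (n : nat) (M : uniformType)
  (g : riemannian R n M) (closedM : closed_manifold M)
  (f : M -> R) (f_morse_smale : morse_smale g f)
  (b p q : nat) (Gam : object R b p q)
  (N : set (M_Gamma g Gam)) (N_submanifold : submanifold N)
  (a : leaf Gam -> M) (a_critical : forall v, critical g f (a v)) :
  compact N -> compact (piecewise_flows_over f a N).
Proof.
move=> cN; have [compactM hausM] := closedM; have [mf _] := f_morse_smale.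
rewrite compact_ultra => U UU UN.
have [l Hl] := finite_classes cN.
(* Finitely many simplices represent all points over [N], so one of them does so along [U]. *)
have [s Hs] := @ultra_list _ _ U UU l (fun s => represented f a N (projT2 (projT1 s))) (filterS (representative Hl) UN).
case: s Hs => -[tau pi] y /=; set rep := represented f a N pi => Hs.
have FU : Filter U by exact: _.
have PU : ProperFilter U by exact: _.
have [P1 [u1 _]] : exists P, rep P := @filter_ex _ U PU rep Hs.
(* Lifts [U] to flows on this simplex; the default [u1] is taken only off [rep]. *)
have /boolp.choice[c Hc] : forall P, exists u : flow g f a pi, rep P ->
    reduced_over N (pre_S_pt pi (sval u).1) /\ P = piecewise_flow_pt (pre_flow_pt u).
  by move=> P; have [[u Hu]|nu] := pselect (rep P); [exists u|exists u1].
have Gc : U [set P | reduced_over N (pre_S_pt pi (sval (c P)).1)] :=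
  @filterS _ U FU rep _ (fun P GP => (Hc P GP).1) Hs.
have [u0 cu0 Nu0] := @flow_limit R n M g compactM hausM f mf b p q Gam a a_critical N cN tau pi (c @ U) (ultra_map c UU) Gc.
exists (piecewise_flow_pt (pre_flow_pt u0)); split; first by exists tau, pi, u0.
have H : piecewise_flow_pt (pre_flow_pt (c P)) @[P --> U] --> piecewise_flow_pt (pre_flow_pt u0) :=
  cvg_comp _ _ cu0 (piecewise_flow_continuous (x := u0)).
move=> A /H HA; apply: (@filterS2 _ U FU _ rep A _ HA Hs) => P AP /Hc[_ ->].
exact: AP.
Qed.
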